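(* Let $\mu$ be an invariant probability measure with respect to a $C^1$ diffeomorphism $f:M\to M$. Then it admits a decomposition (in which some of the summands might be null) $$\mu=\tilde\mu+\sum_{i\ge1}\nu_i+\sum_{j\ge1}\rho_j,$$ where each $\nu_i$ (respectively, $\rho_j$) is a (positive multiple of a) Dirac mass equidistributed on a periodic attracting (respectively, repelling) orbit of $f$, both sums are over at most countably many such orbits, and $\tilde\mu$ satisfies $\chi(x)\ge0\ge-\tilde\chi(x)$ for $\tilde\mu$-a.e. $x\in M$. In particular, if $\mu$ is non-atomic, then $\mu=\tilde\mu$ and so either $\mu$ has some zero Lyapunov exponent, or $\mu$ is a hyperbolic measure with exponents of different signs.
   Context: $M$ is a connected compact $d$-dimensional manifold, $d\ge 2$, endowed with a Riemannian metric inducing a norm $\|\cdot\|$ on the tangent bundle (and operator norms) and a distance $\operatorname{dist}$ on $M$. For $x$ in a set of full measure for every $f$-invariant probability measure the limits $$\chi(x)=\lim_{n\to+\infty}\frac1n\ln\|Df^n(x)\|,\qquad \tilde\chi(x)=\lim_{n\to+\infty}\frac1n\ln\|(Df^{n}(x))^{-1}\|$$ exist ($\chi$ is the largest and $-\tilde\chi$ the least asymptotic growth rate). A hyperbolic measure is an invariant probability measure all of whose Lyapunov exponents are nonzero almost everywhere. For a map $g:M\to M$, a point $p$ with $g^\tau p=p$ for some $\tau\in\mathbb{Z}^+$ (not required to be minimal) belongs to the periodic orbit $\{p,gp,\dots,g^{\tau-1}p\}$; this orbit is attracting for $g$ if there is a neighborhood $V_p$ of $p$ such that $g^\tau|_{V_p}:V_p\to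 V_p$ is a contraction (there is $0<\lambda<1$ with $\operatorname{dist}(g^\tau q,g^\tau r)<\lambda\operatorname{dist}(q,r)$ for all distinct $q,r\in V_p$; equivalently $\|Dg^\tau(p)\|<\lambda$ for some $\lambda\in(0,1)$). A periodic orbit of $f$ is repelling if it is attracting for $f^{-1}$. The Dirac mass equidistributed on the orbit of $p$ is $\tau^{-1}\sum_{j=0}^{\tau-1}\delta_{f^jp}$. *)

(* Defs.v *)
From HB Require Import structures.
From mathcomp Require Import all_boot all_order all_algebra.
From mathcomp Require Import all_classical all_reals all_analysis.
Set Implicit Arguments.
Unset Strict Implicit.
Unset Printing Implicit Defensive.
Import Order.TTheory GRing.Theory Num.Theory.
Import numFieldNormedType.Exports.
Local Open Scope classical_set_scope.
Local Open Scope ring_scope.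

(* [h] is of class C^k on [U]; only meaningful for [U] open. *)
Fixpoint Ck (R : realType) (V W : normedModType R) (k : nat) (U : set V)
    (h : V -> W) : Prop :=
  match k with
  | 0 => forall x, U x -> {for x, continuous h}
  | k'.+1 => (forall x, U x -> differentiable h x) /\
             forall v : V, Ck k' U (fun x => 'd h x v)
  end.

Definition smooth (R : realType) (V W : normedModType R) (U : set V)
    (h : V -> W) : Prop := forall k, Ck k U h.

(* [lcoord i] and [para i] are total functions, significant only on [dom i] and
   on its image.  [chart_at x] is a preferred chart at [x]: it identifies the
   tangent space at [x] with row vectors. *)
Record smooth_atlas (R : realType) (d : nat) (M : topologicalType) := SmoothAtlas {
  chart : Type;
  dom : chart -> set M;
  lcoord : chart -> M -> 'rV[R]_d;
  para : chart -> 'rV[R]_d -> M;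
  chart_at : M -> chart;
  dom_chart_at : forall x, dom (chart_at x) x;
  dom_open : forall i, open (dom i);
  cod_open : forall i, open (lcoord i @` dom i);
  lcoordK : forall i x, dom i x -> para i (lcoord i x) = x;
  lcoord_continuous : forall i, {within dom i, continuous (lcoord i)};
  para_continuous : forall i, {within lcoord i @` dom i, continuous (para i)};
  transition_smooth : forall i j,
    smooth (lcoord i @` (dom i `&` dom j)) (lcoord j \o para i) }.

(* Vectors are rows, so differentials act on the right: [v *m 'J h p]. *)
Record riemannian (R : realType) (d : nat) (M : topologicalType)
    (A : smooth_atlas R d M) := Riemannian {
  gram : chart A -> M -> 'M[R]_d;
  gram_sym : forall i x, dom i x -> (gram i x)^T = gram i x;
  gram_pos : forall i x, dom i x -> forall v : 'rV[R]_d, v != 0 ->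
    0 < (v *m gram i x *m v^T) 0 0;
  gram_compat : forall i j x, dom i x -> dom j x ->
    let J := 'J (lcoord j \o para i) (lcoord i x) in
    gram i x = J *m gram j x *m J^T;
  gram_smooth : forall i, smooth (lcoord i @` dom i) (gram i \o para i) }.

Section Manifold.
Context (R : realType) (d : nat) (M : topologicalType).
Context (A : smooth_atlas R d M) (g : riemannian A).

Definition C1_map (f : M -> M) : Prop :=
  continuous f /\
  forall i j : chart A,
    Ck 1 (lcoord i @` (dom i `&` f @^-1` dom j)) (lcoord j \o f \o para i).

Definition Dmx (f : M -> M) (x : M) : 'M[R]_d :=
  'J (lcoord (chart_at A (f x)) \o f \o para (chart_at A x))
     (lcoord (chart_at A x) x).

Definition tnorm (x : M) (v : 'rV[R]_d) : R :=
  Num.sqrt ((v *m gram g (chart_at A x) x *m v^T) 0 0).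

(* operator norm of [B], seen as a linear map from T_x M to T_y M *)
Definition opnorm (x y : M) (B : 'M[R]_d) : R :=
  sup [set tnorm y (v *m B) | v in [set v | tnorm x v <= 1]].

Definition C1_curve (c : R -> M) : Prop :=
  continuous c /\ forall i : chart A, Ck 1 (c @^-1` dom i) (lcoord i \o c).

Definition speed (c : R -> M) (t : R) : R :=
  tnorm (c t) ('D_1 (lcoord (chart_at A (c t)) \o c) t).

Definition curve_length (c : R -> M) : R :=
  Rintegral lebesgue_measure `[0, 1] (speed c).

(* Since curves need not be regular, a (piecewise) C^1 path on [0, 1] can be
   reparametrised, with vanishing velocity at 0, 1 and at its corners, into one
   that is C^1 on the whole line; hence this is the usual distance. *)
Definition rdist (x y : M) : R :=
  inf [set curve_length c | c in [set c | [/\ C1_curve c, c 0 = x & c 1 = y]]].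

Definition log_growth (f : M -> M) (x : M) : R^nat :=
  fun n => n%:R^-1 * ln (opnorm x (iter n f x) (Dmx (iter n f) x)).

Definition log_growth_inv (f : M -> M) (x : M) : R^nat :=
  fun n => n%:R^-1 * ln (opnorm (iter n f x) x (invmx (Dmx (iter n f) x))).

(* [chi] and [chi_inv] are junk where the sequences diverge. *)
Definition chi (f : M -> M) (x : M) : R := limn (log_growth f x).
Definition chi_inv (f : M -> M) (x : M) : R := limn (log_growth_inv f x).

Definition lyapunov_exponent (f : M -> M) (x : M) (l : R) : Prop :=
  exists2 v : 'rV[R]_d, v != 0 &
    (fun n : nat => n%:R^-1 * ln (tnorm (iter n f x) (v *m Dmx (iter n f) x)))
      @ \oo --> l.

Definition periodic_orbit (h : M -> M) (p : M) (tau : nat) (O : set M) : Prop :=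
  [/\ (0 < tau)%N, iter tau h p = p & O = [set iter j h p | j in `I_tau]].

(* The period [tau] is not required to be minimal. *)
Definition attracting (h : M -> M) (O : set M) : Prop :=
  exists p tau, periodic_orbit h p tau O /\
    exists V : set M, [/\ nbhs p V,
      forall q, V q -> V (iter tau h q) &
      exists2 l : R, 0 < l < 1 &
        forall q r, V q -> V r -> q <> r ->
          rdist (iter tau h q) (iter tau h r) < l * rdist q r].

End Manifold.

Definition borel (M : ptopologicalType) := g_sigma_algebraType (@open M).

Section BorelMeasures.
Context (R : realType) (M : ptopologicalType).

Definition invariant_measure (f : M -> M) (mu : set (borel M) -> \bar R) : Prop :=
  forall B : set (borel M), measurable B -> mu (f @^-1` B) = mu B.

Definition non_atomic (mu : set (borel M) -> \bar R) : Prop :=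
  forall B : set (borel M), measurable B -> (0 < mu B)%E ->
    exists C : set (borel M),
      [/\ measurable C, C `<=` B, (0 < mu C)%E & (mu C < mu B)%E].

Definition null_measure (nu : set (borel M) -> \bar R) : Prop :=
  forall B : set (borel M), measurable B -> nu B = 0%E.

Definition orbit_dirac (f : M -> M) (O : set M)
    (nu : set (borel M) -> \bar R) : Prop :=
  exists (p : M) (tau : nat) (c : R), [/\ periodic_orbit f p tau O, 0 < c &
    forall B : set (borel M), measurable B ->
      nu B = (c%:E * ((tau%:R^-1)%:E *
                \sum_(j < tau) dirac (iter j f p : borel M) B))%E].

Context (d : nat) (A : smooth_atlas R d M) (g : riemannian A).

Definition hyperbolic (f : M -> M)
    (mu : {measure set (borel M) -> \bar R}) : Prop :=
  {ae mu, forall x, forall l, lyapunov_exponent g f x l -> l != 0}.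

Definition has_zero_exponent (f : M -> M)
    (mu : {measure set (borel M) -> \bar R}) : Prop :=
  ~ mu.-negligible [set x | lyapunov_exponent g f x 0].

Definition exponents_of_different_signs (f : M -> M)
    (mu : {measure set (borel M) -> \bar R}) : Prop :=
  {ae mu, forall x, exists l1 l2, [/\ l1 < 0, 0 < l2,
    lyapunov_exponent g f x l1 & lyapunov_exponent g f x l2]}.

End BorelMeasures.

(* Main.v *)
(* The rates chi and chi_inv exist almost everywhere by the subadditive ergodic
   theorem, proved here from a maximal inequality.  Suppose that chi < 0 on an
   invariant set L of positive measure.  By the maximal inequality a set of
   positive measure of points of L contracts at all times under some iterate of
   f.  By recurrence such a point x comes back near itself, and the
   corresponding iterate contracts a whole chart ball around it into itself: it
   has an attracting fixed point, and invariance of the measure forces an atom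
   there.  Removing these atoms, which carry at most countably many attracting
   orbits, leaves chi >= 0 almost everywhere; the same argument for the inverse
   map gives the repelling orbits and chi_inv >= 0.

   The rates chi and - chi_inv are themselves Lyapunov exponents: a generic
   vector grows at the rate chi, and a compactness argument on vectors growing
   slowly up to time N yields one growing at the rate - chi_inv.  So in the
   absence of a zero exponent there are exponents of both signs. *)
Require Import Defs.
From HB Require Import structures.
From mathcomp Require Import all_boot all_order all_algebra.
From mathcomp Require Import all_classical all_reals all_analysis.
From mathcomp Require Import measurable_realfun.
From mathcomp Require Import ring lra zify.
Set Implicit Arguments.
Unset Strict Implicit.
Unset Printing Implicit Defensive.
Import Order.TTheory GRing.Theory Num.Theory.
Import numFieldNormedType.Exports.
Local Open Scope classical_set_scope.
Local Open Scope ring_scope.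

(** * The maximal inequality and the subadditive ergodic theorem *)

(** The measure is not assumed ergodic and no ergodic decomposition is made: rates are functions of
    the point, and the sets they define are cut out by countably many conditions with rational
    bounds or margins [1/(k+1)]. The estimates along orbits share one shape: most points allow a
    jump of bounded length with a controlled gain, the other points cost a bounded amount, and the
    maximal inequality makes visits to them rare. [jump_chain] is the combinatorial core of these
    arguments. The attracting atoms are removed by contradiction: deleting them from a contracted
    set leaves a forward invariant set, and if that set had positive measure the construction would
    yield one more attracting atom inside it. This is why the fixed point has to be located in the
    given set and not merely near it. The distance is an infimum of lengths of curves and [M] is
    only a topological space. Contraction is therefore passed from an orbit to its neighbours along
    short curves, and closeness is measured by length or, inside one chart, by coordinates. *)

Lemma jump_chain (R : realFieldType) (z : nat -> R) (C : R) (N n : nat) :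
  0 <= C ->
  (forall k, (k + N <= n)%N -> exists l, (0 < l <= N)%N /\ z k <= z (k + l)%N) ->
  (forall k, (k < n)%N -> z k - C <= z k.+1) ->
  z 0%N - N%:R * C <= z n.
Proof.
move=> C0 jump lip.
have lipm m k : (k + m = n)%N -> z k - m%:R * C <= z n.
  elim: m k => [|m IH] k; first by rewrite addn0 => <-; rewrite mul0r subr0.
  rewrite addnS -addSn => kmn; have := IH _ kmn; apply: le_trans.
  have := lip k; rewrite -kmn leq_addr => /(_ isT).
  by rewrite -natr1; lra.
suff H m k : (k + m = n)%N -> z k - N%:R * C <= z n by exact: H (add0n n).
(* Follow free jumps as long as at least [N] steps remain; the fewer than [N] last steps lose [C]
   each. *)
elim/ltn_ind: m k => m IH k kmn.
have [Nm|mN] := leqP N m.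
  have [|l [/andP[l0 lN] zl]] := jump k; first by rewrite -kmn leq_add2l.
  have lm := leq_trans lN Nm.
  have ml : (m - l < m)%N by rewrite ltn_subrL l0 (leq_trans l0 lm).
  have := IH _ ml (k + l)%N; rewrite -addnA subnKC// => /(_ kmn).
  by apply: le_trans; rewrite lerB.
apply: le_trans (lipm m k kmn); rewrite lerD2l lerN2.
by rewrite ler_wpM2r// ler_nat ltnW.
Qed.

Section Ergodic.
Context {dd : measure_display} {X : measurableType dd} {R : realType}.
Context (mu : probability X R) (f : X -> X).
Hypothesis mf : measurable_fun setT f.
Hypothesis mu_inv : forall B, measurable B -> mu (f @^-1` B) = mu B.

Definition visits (E : set X) (n : nat) (x : X) : R :=
  \sum_(k < n) \1_E (iter k f x).

Lemma visitsS E n x : visits E n.+1 x = visits E n x + \1_E (iter n f x).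
Proof. by rewrite /visits big_ord_recr. Qed.

Lemma visitsD E m n x : visits E (m + n) x = visits E m x + visits E n (iter m f x).
Proof.
elim: n => [|n IH]; first by rewrite addn0 /visits big_ord0 addr0.
by rewrite addnS !visitsS IH addrA -iterD addnC.
Qed.

Lemma visits0 E x : visits E 0 x = 0.
Proof. by rewrite /visits big_ord0. Qed.

Lemma visits_ge0 E n x : 0 <= visits E n x.
Proof. by apply: sumr_ge0 => i _; rewrite indicE. Qed.

Lemma measurable_iter n : measurable_fun setT (iter n f).
Proof.
elim: n => [|n IH]; first exact: measurable_id.
exact: (measurableT_comp mf IH).
Qed.

Lemma measurable_iter_preimage n B : measurable B -> measurable (iter n f @^-1` B).
Proof. by move=> mB; rewrite -[X in measurable X]setTI; apply: measurable_iter. Qed.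

Lemma iter_invariant n B : measurable B -> mu (iter n f @^-1` B) = mu B.
Proof.
move=> mB; elim: n => [//|n IH].
rewrite -IH -(@mu_inv (iter n f @^-1` B)); last exact: measurable_iter_preimage.
by congr (mu _); apply/seteqP; split => x /=; rewrite -iterSr.
Qed.

Lemma measurable_visits E n : measurable E -> measurable_fun setT (visits E n).
Proof.
move=> mE; apply: measurable_sum => k.
apply: (@measurableT_comp _ _ _ _ _ _ (\1_E : X -> R)); last exact: measurable_iter.
exact: measurable_indic.
Qed.

Lemma measurable_gt_visits E n a : measurable E -> measurable [set x | a < visits E n x].
Proof.
move=> mE; rewrite -[X in measurable X]setTI.
have := @measurable_visits E n mE measurableT _ (@measurable_itv R `]a, +oo[).
by congr (measurable (_ `&` _)); apply/seteqP; split => x /=; rewrite in_itv /= andbT.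
Qed.

Lemma integral_visits E n : measurable E ->
  (\int[mu]_x (visits E n x)%:E = n%:R%:E * mu E)%E.
Proof.
move=> mE.
under eq_integral do rewrite /visits -sumEFin.
have mEk k : measurable_fun setT (fun x => (\1_E (iter k f x))%:E : \bar R).
  apply/measurable_EFinP.
  apply: (@measurableT_comp _ _ _ _ _ _ (\1_E : X -> R)); last exact: measurable_iter.
  exact: measurable_indic.
rewrite (ge0_integral_sum _ _ (fun k : 'I_n => mEk k))//.
transitivity (\sum_(k < n) mu E)%E.
  apply: eq_bigr => k _.
  under eq_integral => x _ do rewrite (_ : \1_E (iter k f x) = \1_(iter k f @^-1` E) x :> R)//.
  rewrite integral_indic ?setIT//; last exact: measurable_iter_preimage.
  exact: iter_invariant.
have fE : mu E \is a fin_num by exact: fin_num_measure.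
by rewrite -(fineK fE) sumEFin sumr_const card_ord -EFinM mulr_natl.
Qed.

(** A point of the maximal set starts a stretch of orbit along which the frequency of [E] exceeds
    [al]. If these stretches have length at most [N], an orbit can be cut into them, which bounds
    [al] times the visits to [F N] by the visits to [E] up to a boundary term. Integration over [n]
    steps, division by [n] and then a monotone limit in [N] give the result. *)
Lemma maximal_inequality E (al : R) : measurable E -> 0 < al ->
  (al%:E * mu [set x | exists n, (n%:R * al < visits E n x)%R] <= mu E)%E.
Proof.
move=> mE al0.
pose F N := [set x | exists2 n, (n <= N)%N & n%:R * al < visits E n x].
have mF N : measurable (F N).
  rewrite (_ : F N = \bigcup_(n in `I_N.+1) [set x | n%:R * al < visits E n x]).
    by apply: bigcup_measurable => n _; exact: measurable_gt_visits.
  by apply/seteqP; split=> x [n]; rewrite /= ?ltnS; exists n.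
have Fub : [set x | exists n, n%:R * al < visits E n x] = \bigcup_N F N.
  by apply/seteqP; split=> x /= [n]; [exists n => //; exists n | move=> _ [k _ ?]; exists k].
have FE N : (al%:E * mu (F N) <= mu E)%E.
  (* Outside [F N] the jump has length one, whence the bound [N.+1] on jumps, which also covers
     [N = 0]. *)
  have pt n x : al * visits (F N) n x <= visits E n x + N.+1%:R * al.
    pose z k := visits E k x - al * visits (F N) k x.
    suff : z 0%N - N.+1%:R * al <= z n by rewrite /z !visits0; lra.
    apply: jump_chain; first exact: ltW.
    - move=> k _; rewrite /z; have [[l lN Hl]|nF] := pselect (F N (iter k f x)); last first.
        exists 1%N; split=> //; rewrite addn1 !visitsS mulrDr.
        rewrite (_ : \1_(F N) _ = 0) ?mulr0 ?addr0; last by rewrite indicE memNset.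
        by rewrite lerD2r lerDl indicE.
      have l0 : (0 < l)%N by case: l Hl {lN} => //; rewrite visits0 mul0r ltxx.
      exists l; split; first by rewrite l0 leqW.
      rewrite !visitsD mulrDr.
      have : visits (F N) l (iter k f x) <= l%:R.
        rewrite /visits -[X in _ <= X%:R]card_ord -sumr_const ler_sum//.
      rewrite -(ler_pM2l al0); lra.
    - move=> k _; rewrite /z !visitsS mulrDr.
      have : al * \1_(F N) (iter k f x) <= al.
        by rewrite ler_piMr// ltW.
      have : 0 <= \1_E (iter k f x) :> R by rewrite indicE.
      lra.
  have fE : mu E \is a fin_num by exact: fin_num_measure.
  have fF : mu (F N) \is a fin_num by exact: fin_num_measure.
  rewrite -(fineK fE) -(fineK fF) -EFinM lee_fin; apply/ler_addgt0Pr => e e0.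
  have key n : n%:R * (al * fine (mu (F N))) <= n%:R * fine (mu E) + N.+1%:R * al.
    have : (\int[mu]_x (al * visits (F N) n x)%:E <=
            \int[mu]_x (visits E n x + N.+1%:R * al)%:E)%E.
      apply: ge0_le_integral => //.
      - by move=> x _; rewrite lee_fin mulr_ge0 ?visits_ge0 ?ltW.
      - apply/measurable_EFinP/measurable_funM => //; exact: measurable_visits.
      - apply/measurable_EFinP/measurable_funD => //; exact: measurable_visits.
      - by move=> x _; rewrite lee_fin pt.
    under eq_integral do rewrite EFinM.
    rewrite ge0_integralZl//; last 3 first.
    - by apply/measurable_EFinP; exact: measurable_visits.
    - by move=> x _; rewrite lee_fin visits_ge0.
    - by rewrite lee_fin ltW.
    under [X in (_ <= X)%E]eq_integral do rewrite EFinD.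
    rewrite ge0_integralD//; last 3 first.
    - by move=> x _; rewrite lee_fin visits_ge0.
    - by apply/measurable_EFinP; exact: measurable_visits.
    - by move=> x _; rewrite lee_fin mulr_ge0 ?ltW.
    rewrite integral_cst//; set m1 := (X in (_ + _ * X)%E).
    have -> : m1 = 1%E by exact: probability_setT.
    rewrite mule1 !integral_visits//.
    rewrite -(fineK fE) -(fineK fF) -!EFinM -EFinD lee_fin; lra.
  (* For [n] this large the boundary term [N.+1 * al] is below [n * e]. *)
  have [n ne] : exists n : nat, N.+1%:R * al / e < n%:R.
    by exists (Num.trunc (N.+1%:R * al / e)).+1; rewrite truncnS_gt.
  have n0 : 0 < n%:R :> R by apply: le_lt_trans ne; rewrite divr_ge0 ?mulr_ge0 ?ltW.
  rewrite -(ler_pM2l n0); apply: le_trans (key n) _.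
  by rewrite mulrDr lerD2l ltW// -ltr_pdivrMr.
rewrite Fub.
have mUF : measurable (\bigcup_N F N) by apply: bigcup_measurable.
have ndF : {homo F : n m / (n <= m)%N >-> (n <= m)%O}.
  by move=> n m nm; apply/subsetPset => x [k kn ?]; exists k => //; exact: leq_trans nm.
have Cv := @nondecreasing_cvg_mu _ _ _ mu _ mF mUF ndF.
have C := cvgeZl (isT : (al%:E \is a fin_num)) Cv.
rewrite -(cvg_lim _ C)//; apply: lime_le; first exact: cvgP C.
by apply: nearW => N; exact: FE.
Qed.


Lemma measurable_maximal_set E (al : R) : measurable E ->
  measurable [set x | exists n, n%:R * al < visits E n x].
Proof.
move=> mE; rewrite (_ : [set _ | _] = \bigcup_n [set x | n%:R * al < visits E n x]).
  by apply: bigcup_measurable => n _; exact: measurable_gt_visits.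
by apply/seteqP; split=> x; [case=> n ?; exists n|case=> n _ ?; exists n].
Qed.

(** Poincaré recurrence with a return time beyond [n0]. A late return is what makes the contraction
    factor of the returning iterate small. *)
Lemma recurrence A n0 : measurable A -> (0 < mu A)%E ->
  exists n x, [/\ (n0 < n)%N, A x & A (iter n f x)].
Proof.
(* Without such a return the preimages of [A] at multiples of [n0 + 1] are disjoint and have equal
   mass, too much for a probability. *)
move=> mA A0; apply: contrapT => noret.
pose B k := iter (k * n0.+1) f @^-1` A.
have tB : trivIset setT B.
  have ltB i j x : (i < j)%N -> B i x -> B j x -> False.
    rewrite /B /= => ij Bi Bj; apply: noret.
    exists ((j - i) * n0.+1)%N, (iter (i * n0.+1) f x); split=> //.
      by rewrite leq_pmull// subn_gt0.
    by rewrite -iterD -mulnDl subnK// ltnW.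
  move=> i j _ _ [x [Bi Bj]].
  by case: (ltngtP i j) => // ij; [case: (ltB _ _ _ ij Bi Bj)|case: (ltB _ _ _ ij Bj Bi)].
have bnd m : (m%:R%:E * mu A <= 1)%E.
  have fA : mu A \is a fin_num by exact: fin_num_measure.
  have mB k : measurable (B k) by exact: measurable_iter_preimage.
  have := @probability_le1 _ _ _ mu (\bigcup_(k in `I_m) B k).
  rewrite measure_fin_bigcup//; last first.
    by move=> i j _ _; exact: tB.
  rewrite (eq_fsbigr (fun=> mu A)); last by move=> k _; exact: iter_invariant.
  rewrite -(fineK fA) -fsbig_ord sumEFin sumr_const card_ord -EFinM mulr_natl.
  by apply; exact: fin_bigcup_measurable.
have fA : mu A \is a fin_num by exact: fin_num_measure.
move: A0 bnd; rewrite -(fineK fA) lte_fin => A0 bnd.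
have := bnd (Num.trunc (fine (mu A))^-1).+1.
rewrite -EFinM lee_fin leNgt => /negP; apply.
by rewrite -ltr_pdivrMr// mul1r truncnS_gt.
Qed.

(** The sets [L] minus [T N] decrease to the empty set, so their measures tend to 0. By the maximal
    inequality, so do the measures of the points that visit them with frequency above a fixed
    level. *)
Lemma rarely_outside L (T : nat -> set X) :
  measurable L -> (forall N, measurable (T N)) ->
  {homo T : m n / (m <= n)%N >-> m `<=` n} -> L `<=` \bigcup_N T N ->
  {ae mu, forall x, forall al : R, 0 < al ->
     exists N, forall n, visits (L `\` T N) n x <= n%:R * al}.
Proof.
move=> mL mT ndT LT.
pose E N := L `\` T N.
have mE N : measurable (E N) by apply: measurableD.
have E0 : mu \o E @ \oo --> 0%E.
  rewrite -(@measure0 _ _ _ mu).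
  have <- : \bigcap_N E N = set0.
    apply/seteqP; split => // x Ex; have [Lx _] := Ex 0%N I.
    by have [N _ TN] := LT _ Lx; have [_] := Ex N I.
  apply: nonincreasing_cvg_mu => //.
  - by rewrite -ge0_fin_numE// fin_num_measure.
  - exact: bigcap_measurable.
  - move=> m n mn; apply/subsetPset => x [Lx nTx]; split=> // Tx; apply: nTx.
    exact: ndT Tx.
(* Testing the levels [1/(k+1)] suffices and gives one null set for all [al]. *)
pose bad k := \bigcap_N [set x | exists n, n%:R * k.+1%:R^-1 < visits (E N) n x].
have bad0 k : mu.-negligible (bad k).
  have mbad : measurable (bad k).
    by apply: bigcap_measurable => // N _; exact: measurable_maximal_set.
  apply/negligibleP => //; apply/eqP; rewrite -measure_le0.
  have k0 : 0 < k.+1%:R^-1 :> R by rewrite invr_gt0.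
  rewrite -(@pmule_rle0 _ k.+1%:R^-1%:E)//.
  have -> : 0%E = limn (mu \o E) by exact/esym/(cvg_lim _ E0).
  apply: lime_ge; first exact: cvgP E0.
  apply: nearW => N; apply: le_trans (maximal_inequality (mE N) k0).
  rewrite lee_pmul2l// le_measure ?inE//; first exact: measurable_maximal_set.
  by move=> x /(_ N I).
apply: negligibleS (negligible_bigcup bad0) => x /= Hx; apply: contrapT => nbad.
apply: Hx => al al0; apply: contrapT => Hx; apply: nbad.
exists (Num.trunc al^-1) => // N _ /=; apply: contrapT => nN; apply: Hx; exists N => n.
apply: contrapT => /negP; rewrite -ltNge => Hn; apply: nN; exists n; apply: le_lt_trans Hn.
rewrite ler_wpM2l// -[leRHS]invrK lef_pV2 ?posrE ?invr_gt0//.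
by rewrite ltW// truncnS_gt.
Qed.

End Ergodic.

(** * Linear upper bounds for real sequences and convergence of averages *)

Section LinearBounds.
Context {R : realType}.
Implicit Types (s : nat -> R) (p q C : R).

(* [freq_below s p] says that liminf (s n / n) < p, and [ev_below s p] that
   limsup (s n / n) < p; the margins 1/(k+1) keep both countable conditions. *)
Definition freq_below s p := exists k, forall m, exists2 n, (m <= n)%N &
  s n <= n%:R * (p - k.+1%:R^-1).

Definition ev_below s p := exists k m, forall n, (m <= n)%N ->
  s n <= n%:R * (p - k.+1%:R^-1).

Lemma exists_inv_lt (e : R) : 0 < e -> exists k, k.+1%:R^-1 < e.
Proof.
move=> e0; exists (Num.trunc e^-1); rewrite -[ltRHS]invrK ltf_pV2 ?posrE ?invr_gt0//.
exact: truncnS_gt.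
Qed.

Lemma exists_nat_ge (a e : R) : 0 < e -> exists m, forall n, (m <= n)%N -> a <= n%:R * e.
Proof.
move=> e0; exists (Num.trunc (a / e)).+1 => n mn.
by rewrite -ler_pdivrMr// (le_trans (ltW (truncnS_gt _)))// ler_nat.
Qed.

Lemma inv_gap (k : nat) : 0 < k.+1%:R^-1 - k.+2%:R^-1 :> R.
Proof. by rewrite subr_gt0 ltf_pV2 ?posrE// ltr_nat. Qed.

Lemma freq_below_shift s s' p C : (forall n, s' n <= s n.+1 + C) ->
  freq_below s p -> freq_below s' p.
Proof.
(* Lowering the margin from [1/(k+1)] to [1/(k+2)] frees a multiple of [n], which absorbs the
   constants of the shift once [n] is large. *)
move=> ss' [k Hk]; exists k.+1 => m.
have [m1 Hm1] := exists_nat_ge (C + p - k.+1%:R^-1) (inv_gap k).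
have [[|n] mn Hn] := Hk (maxn m m1).+1; first by [].
move: mn; rewrite ltnS geq_max => /andP[mn m1n]; exists n => //.
have := Hm1 n m1n.
have := ss' n; move: Hn; rewrite -[n.+1%:R]natr1.
by move: k.+1%:R^-1 k.+2%:R^-1 => k1 k2; lra.
Qed.

Lemma ev_below_shift s s' p C : (forall n, s' n <= s n.+1 + C) ->
  ev_below s p -> ev_below s' p.
Proof.
move=> ss' [k [m Hk]].
have [m1 Hm1] := exists_nat_ge (C + p - k.+1%:R^-1) (inv_gap k).
exists k.+1, (maxn m m1) => n; rewrite geq_max => /andP[mn m1n].
have := Hm1 n m1n.
have := ss' n; have := Hk n.+1 (leqW mn); rewrite -[n.+1%:R]natr1.
by move: k.+1%:R^-1 k.+2%:R^-1 => k1 k2; lra.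
Qed.

Lemma ev_below_shiftl s s' p C : (forall n, s' n.+1 <= s n + C) ->
  ev_below s p -> ev_below s' p.
Proof.
move=> ss' [k [m Hk]].
have [m1 Hm1] := exists_nat_ge (C - p + k.+1%:R^-1) (inv_gap k).
exists k.+1, (maxn m m1).+1 => -[//|n]; rewrite ltnS geq_max => /andP[mn m1n].
have := Hm1 n m1n.
have := ss' n; have := Hk n mn; rewrite -[n.+1%:R]natr1.
have := inv_gap k.
by move: k.+1%:R^-1 k.+2%:R^-1 => k1 k2; lra.
Qed.

(** The last step of a jump argument: [v N n] counts exceptional visits. These visits, the boundary
    term and the margin each use at most a quarter of the gap [q - p]. *)
Lemma ev_below_of_rare s (v : nat -> nat -> R) p q C : 0 <= C -> p < q ->
  (forall N n, s n <= n%:R * p + C * v N n + N.+1%:R * C) ->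
  (forall al, 0 < al -> exists N, forall n, v N n <= n%:R * al) ->
  ev_below s q.
Proof.
move=> C0 pq sv rare.
have d0 : 0 < (q - p) / 4 by rewrite divr_gt0// subr_gt0.
(* Dividing by [C + 1] rather than [C] allows [C = 0]. *)
have [N HN] := rare ((q - p) / 4 / (C + 1)) (divr_gt0 d0 (ltr_wpDl C0 ltr01)).
have [k Hk] := exists_inv_lt d0.
have [m Hm] := exists_nat_ge (N.+1%:R * C) d0.
exists k, m => n mn.
have := sv N n; have := Hm n mn.
have : C * v N n <= n%:R * ((q - p) / 4).
  apply: le_trans (ler_wpM2l C0 (HN n)) _.
  rewrite mulrCA ler_wpM2l// mulrCA -[leRHS]mulr1 ler_wpM2l ?(ltW d0)//.
  by rewrite ler_pdivrMr ?mul1r ?lerDl// ltr_wpDl.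
have : n%:R * (k.+1%:R^-1) <= n%:R * ((q - p) / 4) by rewrite ler_wpM2l// ltW.
have : 0 <= n%:R * ((q - p) / 4) by rewrite mulr_ge0// ltW.
by move: k.+1%:R^-1 => k1; lra.
Qed.

(** The limit is the infimum of [S], that is the liminf of [s n / n]; the hypothesis forces the
    limsup down to it. Only rational pairs are required, so that a countable union of null sets
    suffices when the lemma is applied almost everywhere. *)
Lemma cvg_of_below s C : (forall n, `|s n| <= n%:R * C) ->
  (forall p q : rat, p < q -> freq_below s (ratr p) -> ev_below s (ratr q)) ->
  cvgn (fun n : nat => n%:R^-1 * s n).
Proof.
move=> sC fe.
pose S := [set p | freq_below s p].
have mono p q : p <= q -> S p -> S q.
  move=> pq [k Hk]; exists k => m; have [n mn Hn] := Hk m; exists n => //.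
  by apply: le_trans Hn _; rewrite ler_wpM2l// lerB.
have S0 : S !=set0.
  exists (C + 2), 0%N => m; exists m => //; rewrite invr1.
  have := sC m; rewrite ler_norml => /andP[_ /le_trans]; apply.
  by rewrite ler_wpM2l//; lra.
have lbS : lbound S (- C).
  move=> p [k Hk]; have [n n0 Hn] := Hk 1%N.
  have n0' : 0 < n%:R :> R by rewrite ltr0n.
  have := sC n; rewrite ler_norml => /andP[+ _].
  move=> /le_trans/(_ Hn); rewrite -mulrN ler_pM2l//.
  have : 0 < k.+1%:R^-1 :> R by rewrite invr_gt0.
  by move: k.+1%:R^-1 => k1; lra.
have infS : has_inf S by split=> //; exists (- C).
apply: (cvgP (inf S)); apply/cvgrPdist_le => e e0.
have e2 : 0 < e / 2 by rewrite divr_gt0.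
have [p Sp pinf] := inf_adherent e2 infS.
(* [p'] lies in [S], and a rational [q'] between it and [inf S + e] turns this into an eventual
   upper bound. *)
have [p' /andP[pp' p'e]] : exists r : rat, (p < ratr r) && (ratr r < inf S + e / 2).
  by have [r /itvP rin] := rat_in_itvoo pinf; exists r; rewrite !rin.
have [q' /andP[eq' q'e]] : exists r : rat, (inf S + e / 2 < ratr r) && (ratr r < inf S + e).
  have lt : inf S + e / 2 < inf S + e by lra.
  by have [r /itvP rin] := rat_in_itvoo lt; exists r; rewrite !rin.
have [k [m1 Hm1]] : ev_below s (ratr q').
  apply: (fe p'); first by rewrite -(ltr_rat R) (lt_trans p'e).
  by apply: mono Sp; exact: ltW.
have [j Hj] := exists_inv_lt e2.
(* A number below [inf S] is not in [S], which is an eventual lower bound. *)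
have [m2 Hm2] : exists m, forall n, (m <= n)%N -> n%:R * (inf S - e / 2 - j.+1%:R^-1) < s n.
  apply: contrapT => H.
  have : S (inf S - e / 2).
    exists j => m; apply: contrapT => Hn; apply: H; exists m => n mn.
    by rewrite ltNge; apply/negP => Hs; apply: Hn; exists n.
  by move=> /(ge_inf infS.2); lra.
near=> n.
have n0 : 0 < n%:R :> R by rewrite ltr0n; near: n; exists 1%N.
have m1n : (m1 <= n)%N by near: n; exists m1.
have m2n : (m2 <= n)%N by near: n; exists m2.
rewrite ler_distlC mulrC ler_pdivlMr// ler_pdivrMr// ![_ * n%:R]mulrC.
apply/andP; split.
  apply: le_trans (ltW (Hm2 _ m2n)); rewrite ler_wpM2l//.
  by move: j.+1%:R^-1 Hj => j1; lra.
apply: le_trans (Hm1 _ m1n) _; rewrite ler_wpM2l//.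
have : 0 < k.+1%:R^-1 :> R by rewrite invr_gt0.
by move: k.+1%:R^-1 => k1; lra.
Unshelve. all: by end_near. Qed.

Lemma lim_lt_ev_below s p : cvgn (fun n : nat => n%:R^-1 * s n) ->
  limn (fun n : nat => n%:R^-1 * s n) < p -> ev_below s p.
Proof.
set l := limn _ => sl lp.
have d0 : 0 < (p - l) / 2 by rewrite divr_gt0// subr_gt0.
have [k Hk] := exists_inv_lt d0.
have /cvgrPdist_le/(_ _ d0)[m _ Hm] := sl.
exists k, m.+1 => n mn.
have n0 : 0 < n%:R :> R by rewrite ltr0n (leq_ltn_trans _ mn).
have := Hm n (ltnW mn); rewrite /= -/l ler_distlC => /andP[_].
rewrite mulrC ler_pdivrMr// mulrC => /le_trans; apply.
by rewrite ler_wpM2l//; move: k.+1%:R^-1 Hk => k1; lra.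
Qed.

End LinearBounds.

Section Kingman.
Context {dd : measure_display} {X : measurableType dd} {R : realType}.
Context (mu : probability X R) (f : X -> X).
Hypothesis mf : measurable_fun setT f.
Hypothesis mu_inv : forall B, measurable B -> mu (f @^-1` B) = mu B.

Lemma measurable_le (g : X -> R) c : measurable_fun setT g -> measurable [set x | g x <= c].
Proof.
move=> mg; rewrite -[X in measurable X]setTI.
have := mg measurableT _ (@measurable_itv R `]-oo, c]).
by congr (measurable (_ `&` _)); apply/seteqP; split => x /=; rewrite in_itv.
Qed.

Lemma measurable_freq_below (a : nat -> X -> R) p :
  (forall n, measurable_fun setT (a n)) -> measurable [set x | freq_below (a^~ x) p].
Proof.
move=> ma; rewrite (_ : [set _ | _] = \bigcup_k \bigcap_m \bigcup_(n in [set n | (m <= n)%N])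
    [set x | a n x <= n%:R * (p - k.+1%:R^-1)]).
  apply: bigcup_measurable => k _; apply: bigcap_measurable => // m _.
  by apply: bigcup_measurable => n _; exact: measurable_le.
apply/seteqP; split=> x.
- by move=> [k Hk]; exists k => // m _; have [n mn Hn] := Hk m; exists n.
- by move=> [k _ Hk]; exists k => m; have [n mn Hn] := Hk m I; exists n.
Qed.

Lemma measurable_ev_below (a : nat -> X -> R) p :
  (forall n, measurable_fun setT (a n)) -> measurable [set x | ev_below (a^~ x) p].
Proof.
move=> ma; rewrite (_ : [set _ | _] = \bigcup_k \bigcup_m \bigcap_(n in [set n | (m <= n)%N])
    [set x | a n x <= n%:R * (p - k.+1%:R^-1)]).
  apply: bigcup_measurable => k _; apply: bigcup_measurable => m _.
  by apply: bigcap_measurable => [|n _]; [exists m => /=|exact: measurable_le].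
apply/seteqP; split=> x.
- by move=> [k [m Hk]]; exists k => //; exists m.
- by move=> [k _ [m _ Hk]]; exists k, m.
Qed.

Lemma negligible_bigcup_countType (I : countType) (F : I -> set X) :
  (forall i, mu.-negligible (F i)) -> mu.-negligible (\bigcup_i F i).
Proof.
move=> F0; pose G n := if (unpickle n : option I) is Some i then F i else set0.
have G0 n : mu.-negligible (G n) by rewrite /G; case: unpickle => // *; exact: negligible_set0.
apply: negligibleS (negligible_bigcup G0) => x [i _ Fx]; exists (pickle i) => //.
by rewrite /G pickleK.
Qed.

(* Along an orbit in the set L where liminf (a n / n) < p, points of T N allow a
   jump of length l <= N along which a grows by at most l * p; the visits to
   L \ T N, each charged C + |p|, are rare by the maximal inequality.  Hence
   limsup (a n / n) < q for every q > p. *)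
Lemma kingman (a : nat -> X -> R) (C : R) :
  (forall n, measurable_fun setT (a n)) ->
  (forall x, a 0%N x = 0) -> (forall x, a 1%N x <= C) ->
  (forall n x, `|a n x| <= n%:R * C) ->
  (forall m n x, a (m + n)%N x <= a m x + a n (iter m f x)) ->
  (forall n x, a n (f x) <= a n.+1 x + C) ->
  {ae mu, forall x, cvgn (fun n : nat => n%:R^-1 * a n x)}.
Proof.
move=> ma a0 a1 aC asub ashift.
have main (p q : rat) : p < q -> {ae mu, forall x,
    freq_below (a^~ x) (ratr p) -> ev_below (a^~ x) (ratr q)}.
  move=> pq; pose L := [set x | freq_below (a^~ x) (ratr p)].
  pose T N := [set x | exists l, (0 < l <= N)%N /\ a l x <= l%:R * ratr p].
  have mL : measurable L by exact: measurable_freq_below.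
  have mT N : measurable (T N).
    rewrite (_ : T N = \bigcup_(l in [set l | (0 < l <= N)%N]) [set x | a l x <= l%:R * ratr p]).
      by apply: bigcup_measurable => n _; exact: measurable_le.
    by apply/seteqP; split=> x; case=> l; [case=> ? ?|move=> ? ?]; exists l.
  have ndT : {homo T : m n / (m <= n)%N >-> m `<=` n}.
    move=> m n mn x [l [/andP[l0 lm] al]]; exists l; split=> //.
    by rewrite l0 (leq_trans lm).
  have LT : L `<=` \bigcup_N T N.
    move=> x [k Hk]; have [n n0 Hn] := Hk 1%N; exists n => //; exists n.
    split; first by rewrite n0 leqnn.
    by apply: le_trans Hn _; rewrite ler_wpM2l// gerBl.
  apply: filterS (rarely_outside mf mu_inv mL mT ndT LT) => x rare Lx.
  (* The whole orbit stays in [L], so each of its points outside [T N] counts as a visit to the rare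
     set. *)
  have Liter k : L (iter k f x).
    elim: k => //= k; apply: freq_below_shift => n; exact: ashift.
  have C0 : 0 <= C + `|ratr p|.
    rewrite addr_ge0//; have := aC 1%N x; rewrite mul1r; exact: le_trans.
  have pq' : ratr p < ratr q :> R by rewrite ltr_rat.
  apply: (ev_below_of_rare C0 pq' _ rare) => N n.
  (* The first [k] steps of [a n x] are replaced by their cost at rate [p] plus the charge for
     visits: [z 0] is [a n x] and [z n] is the bound wanted, up to the boundary term. *)
  pose z k := a (n - k)%N (iter k f x) + k%:R * ratr p
              + (C + `|ratr p|) * visits f (L `\` T N) k x.
  have absp : - `|ratr p : R| <= ratr p by rewrite lerNl -normrN ler_norm.
  suff : z 0%N - N.+1%:R * (C + `|ratr p|) <= z n.
    by rewrite /z subn0 subnn a0 /visits big_ord0 /=; lra.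
  apply: jump_chain => // k.
  - move=> kN; have [[l [/andP[l0 lN] al]]|nT] := pselect (T N (iter k f x)).
      exists l; rewrite l0 (leqW lN); split=> //; rewrite /z visitsD.
      have := asub l (n - (k + l))%N (iter k f x); rewrite -iterD [(l + k)%N]addnC.
      rewrite subnDA subnKC; last by lia.
      have := mulr_ge0 C0 (visits_ge0 (R := R) f (L `\` T N) l (iter k f x)).
      rewrite natrD; lra.
    have zk := asub 1%N (n - k.+1)%N (iter k f x).
    exists 1%N; split=> //.
    rewrite addn1 /z visitsS indicE mem_set ?[iter 1 _ _]/=; last by split.
    move: zk; rewrite (_ : (1 + (n - k.+1))%N = (n - k)%N); last by lia.
    have := a1 (iter k f x); rewrite -[k.+1%:R]natr1 /=; lra.
  - move=> kn; rewrite /z visitsS mulrDr.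
    have := asub 1%N (n - k.+1)%N (iter k f x).
    rewrite (_ : (1 + (n - k.+1))%N = (n - k)%N); last by lia.
    have : 0 <= (C + `|ratr p|) * \1_(L `\` T N) (iter k f x) by rewrite mulr_ge0// indicE.
    have := a1 (iter k f x); rewrite -[k.+1%:R]natr1 /=; lra.
(* One null set for all pairs of rationals. *)
have : {ae mu, forall x, forall p q : rat, p < q ->
    freq_below (a^~ x) (ratr p) -> ev_below (a^~ x) (ratr q)}.
  have H (u : rat * rat) : mu.-negligible (~` [set x | u.1 < u.2 ->
      freq_below (a^~ x) (ratr u.1) -> ev_below (a^~ x) (ratr u.2)]).
    have [lt|nlt] := boolP (u.1 < u.2); last first.
      apply: negligibleS (negligible_set0 mu) => x /= nx.
      by apply: nx.
    apply: negligibleS (main _ _ lt) => x /= nx Hx; apply: nx => _; exact: Hx.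
  apply: negligibleS (negligible_bigcup_countType H) => x /= nx; apply: contrapT => nF.
  by apply: nx => p q pq fr; apply: contrapT => ne; apply: nF; exists (p, q) => //= /(_ pq fr).
by apply: filterS => x Hx; exact: cvg_of_below (fun n => aC n x) Hx.
Qed.

End Kingman.

(** * Vectors of extremal growth *)

Section NormLike.
Context {R : realType} {d : nat}.
Implicit Types (N : 'rV[R]_d -> R) (u v : 'rV[R]_d).

Definition normlike N := [/\ forall a v, N (a *: v) = `|a| * N v,
  forall u v, N (u + v) <= N u + N v & forall v, v != 0 -> 0 < N v].

Lemma normlike0 N : normlike N -> N 0 = 0.
Proof. by move=> [NZ _ _]; rewrite -(scale0r 0) NZ normr0 mul0r. Qed.

Lemma normlike_ge0 N v : normlike N -> 0 <= N v.
Proof.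
move=> NN; have [->|v0] := eqVneq v 0; first by rewrite normlike0.
by case: NN => _ _ /(_ _ v0)/ltW.
Qed.

Lemma normlikeN N v : normlike N -> N (- v) = N v.
Proof. by move=> [NZ _ _]; rewrite -scaleN1r NZ normrN1 mul1r. Qed.

Lemma normlike_le_sum N v : normlike N ->
  N v <= \sum_(i < d) `|v 0 i| * N (delta_mx 0 i).
Proof.
move=> NN; have [NZ ND _] := NN; rewrite {1}(row_sum_delta v).
elim/big_ind2: _ => [|x y z w xy zw|i _]; first by rewrite normlike0.
  by rewrite (le_trans (ND _ _))// lerD.
by rewrite NZ.
Qed.

(** [16 * margin n] is [1/(n+1) - 1/(n+2)], so the sum telescopes below 1. At the same time the
    decay is only polynomial, hence invisible in exponential growth rates. *)
Definition margin (n : nat) : R := (16 * (n.+1%:R * n.+2%:R))^-1.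

Lemma margin_gt0 n : 0 < margin n.
Proof. by rewrite invr_gt0 !mulr_gt0. Qed.

Lemma margin_le1 n : margin n <= 1.
Proof.
rewrite invf_le1; last by rewrite !mulr_gt0.
by rewrite -!natrM ler1n.
Qed.

Lemma sum_margin n : \sum_(0 <= k < n) (16 * margin k) = 1 - n.+1%:R^-1.
Proof.
elim: n => [|n IH]; first by rewrite big_geq// invr1 subrr.
rewrite big_nat_recr//= IH /margin.
have a0 : n.+1%:R != 0 :> R by rewrite pnatr_eq0.
have b0 : n.+2%:R != 0 :> R by rewrite pnatr_eq0.
move: b0; have -> : n.+2%:R = n.+1%:R + 1 :> R by rewrite natr1.
move: n.+1%:R a0 => m m0 m1; field.
by rewrite m0 m1.
Qed.

(* The bad coefficients t for a given n lie in an interval of length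
   8 * margin n, and the sum of these lengths is at most 1/2. *)
Lemma generic_coefficient (N : nat -> 'rV[R]_d -> R) u w :
  (forall n, normlike (N n)) ->
  exists2 t, 0 <= t <= 1 & forall n, 2 * margin n * N n u <= N n (t *: u + w).
Proof.
move=> NN; apply: contrapT => Hno.
have [u0|u0] := eqVneq u 0.
  apply: Hno; exists 0; first by rewrite lexx ler01.
  by move=> n; rewrite u0 normlike0// mulr0 normlike_ge0.
pose bad n t := N n (t *: u + w) < 2 * margin n * N n u.
pose c n := xget 0 [set t | bad n t].
pose I n : set R := `[c n - 4 * margin n, c n + 4 * margin n]%classic.
(* For two bad coefficients, the difference of the two vectors is a multiple of [u] of norm at most
   [4 * margin n * N n u]; so all of them lie near any one of them. *)
have badI n t : bad n t -> I n t.
  move=> bt; have : bad n (c n) by apply: (@xgetPex _ 0 [set t | bad n t]); exists t.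
  move: bt; rewrite /bad /I /= in_itv/= -ler_distl.
  have [NZ ND N0] := NN n; have Nu := N0 _ u0 => bt bc.
  rewrite -(ler_pM2r Nu) -NZ.
  have -> : (t - c n) *: u = (t *: u + w) + - (c n *: u + w).
    by rewrite opprD addrACA subrr addr0 scalerBl.
  apply: le_trans (ND _ _) _; rewrite normlikeN//; lra.
have cover : (`[0, 1]%classic : set R) `<=` \bigcup_n I n.
  move=> t; rewrite /= in_itv/= => t01; apply: contrapT => nI; apply: Hno.
  exists t => // n; rewrite leNgt; apply/negP => bt; apply: nI.
  by exists n => //; exact: badI.
have : (lebesgue_measure (`[0%R, 1%R]%classic : set R) <= (2^-1 : R)%:E)%E.
  have mI n : measurable (I n) by exact: measurable_itv.
  apply: le_trans (measure_sigma_subadditive lebesgue_measure mI (measurable_itv _) cover) _.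
  apply: lime_le; first exact: is_cvg_nneseries.
  apply: nearW => n.
  have -> : (\sum_(0 <= k < n) lebesgue_measure (I k) =
     (\sum_(0 <= k < n) 8 * margin k)%:E)%E.
    rewrite -sumEFin; apply: eq_bigr => k _.
    rewrite lebesgue_measure_itv/= lte_fin; have := margin_gt0 k => m0.
    by rewrite ifT; [rewrite -EFinD; congr EFin; lra|lra].
  rewrite lee_fin.
  have : \sum_(0 <= k < n) (8 * margin k) = 2^-1 * \sum_(0 <= k < n) (16 * margin k).
    by rewrite big_distrr/=; apply: eq_bigr => k _; lra.
  rewrite sum_margin => ->.
  have : 0 < n.+1%:R^-1 :> R by rewrite invr_gt0.
  by move: n.+1%:R^-1 => m; lra.
rewrite lebesgue_measure_itv/= lte_fin ltr01 oppr0 adde0 lee_fin; lra.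
Qed.

(** Induction on the list: add to the previous vector [w] a generic multiple of the new vector [e].
    This secures the bound for [e] and weakens the older bounds by one factor [margin n]. *)
Lemma generic_vector_seq (N : nat -> 'rV[R]_d -> R) (s : seq 'rV[R]_d) :
  (forall n, normlike (N n)) ->
  exists v, forall n e, e \in s -> margin n ^+ size s * N n e <= N n v.
Proof.
move=> NN; elim: s => [|e s [w Hw]]; first by exists 0.
have [t /andP[t0 t1] Ht] := generic_coefficient e w NN.
exists (t *: e + w) => n e'; rewrite inE /= exprS.
have m0 := margin_gt0 n; have m1 := margin_le1 n.
have [NZ ND N0] := NN n; have Ne := normlike_ge0 e (NN n).
have ms1 : margin n ^+ size s <= 1 by rewrite exprn_ile1// ltW.
have ms0 : 0 <= margin n ^+ size s by rewrite exprn_ge0// ltW.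
move=> /orP[/eqP ->|es].
  apply: le_trans (Ht n); rewrite ler_wpM2r//.
  have : margin n * margin n ^+ size s <= margin n * 1 by rewrite ler_wpM2l// ltW.
  lra.
rewrite -mulrA; have Hwn := Hw n _ es.
(* [N n w] is at most [N n v + N n e] for the new vector [v]. After multiplication by [margin n],
   each term is at most half of [N n v]: the first since the margin is small, the second by the
   choice of [t]. *)
apply: le_trans (_ : margin n * N n w <= _); first by rewrite ler_wpM2l// ltW.
have Nw : N n w <= N n (t *: e + w) + N n e.
  have {1}-> : w = (t *: e + w) + - (t *: e) by rewrite addrAC subrr add0r.
  apply: le_trans (ND _ _) _; rewrite lerD2l normlikeN// NZ ger0_norm//.
  by rewrite ler_piMl.
have := Ht n; have Nte := normlike_ge0 (t *: e + w) (NN n) => Htn.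
have : margin n * N n w <= margin n * (N n (t *: e + w) + N n e).
  by rewrite ler_wpM2l// ltW.
have : margin n * N n (t *: e + w) <= 2^-1 * N n (t *: e + w).
  rewrite ler_wpM2r// /margin invfM.
  have : (n.+1%:R * n.+2%:R)^-1 <= 1 :> R by rewrite invf_le1 -?natrM ?ltr0n// ler1n.
  by move: (_ * _)^-1 => m; lra.
lra.
Qed.

(** The list is the standard basis. One vector serves all [n]: up to the factor [margin n ^+ d] it
    is stretched as much as any other vector. *)
Lemma generic_vector (N : nat -> 'rV[R]_d -> R) : (forall n, normlike (N n)) ->
  exists v, forall n u, margin n ^+ d * N n u <= (\sum_i `|u 0 i|) * N n v.
Proof.
move=> NN; have [v Hv] := generic_vector_seq [seq delta_mx 0 i | i <- enum 'I_d] NN.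
exists v => n u; rewrite size_map size_enum_ord in Hv.
have m0 : 0 <= margin n ^+ d by rewrite exprn_ge0// ltW// margin_gt0.
apply: le_trans (ler_wpM2l m0 (normlike_le_sum u (NN n))) _.
rewrite big_distrr big_distrl/=; apply: ler_sum => i _.
rewrite mulrCA ler_wpM2l//; apply: Hv; apply/mapP; exists i => //.
by rewrite mem_enum.
Qed.

End NormLike.

(** Take a matrix of maximal rank with rows in [W]: a vector of [W] outside its row space could be
    added and would raise the rank. The rank is what makes nested families stabilise. *)
Lemma matrix_of_subspace (F : fieldType) (d : nat) (W : set 'rV[F]_d) :
  (forall a u v, W u -> W v -> W (a *: u + v)) -> W 0 ->
  exists B : 'M[F]_d, forall u, W u <-> (u <= B)%MS.
Proof.
move=> lW W0.
pose P r := `[< exists B : 'M[F]_d, (forall u : 'rV_d, (u <= B)%MS -> W u) /\ \rank B = r >].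
have exP : exists r, P r.
  exists 0%N; apply/asboolP; exists 0; split; last exact: mxrank0.
  by move=> u; rewrite submx0 => /eqP ->.
have ubP r : P r -> (r <= d)%N by move=> /asboolP[B [_ <-]]; exact: rank_leq_row.
case: (ex_maxnP exP ubP) => r /asboolP[B [BW Br]] maxr; exists B => v; split; last exact: BW.
move=> Wv; apply/negPn/negP => nvB.
have BvW : forall u : 'rV_d, (u <= B + v)%MS -> W u.
  move=> u /sub_addsmxP[[u1 u2] ->] /=.
  rewrite (mx11_scalar u2) mul_scalar_mx addrC; apply: lW => //.
  by apply: BW; exact: submxMl.
have := maxr (\rank (B + v)%MS); rewrite leqNgt -Br rank_ltmx; last first.
  rewrite /ltmx addsmxSl/=; apply: contra nvB => BvB.
  exact: submx_trans (addsmxSr _ _) BvB.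
by move=> H; apply: notF; apply: H; apply/asboolP; exists (B + v)%MS.
Qed.

Lemma nested_subspaces (F : fieldType) (d : nat) (W : nat -> set 'rV[F]_d) :
  (forall j a u v, W j u -> W j v -> W j (a *: u + v)) ->
  {homo W : i j / (i <= j)%N >-> (j `<=` i)} ->
  (forall j, exists2 v, v != 0 & W j v) ->
  exists2 v, v != 0 & forall j, W j v.
Proof.
move=> lW dW nzW.
have W0 j : W j 0.
  by have [v _ Wv] := nzW j; have := lW j (-1) _ _ Wv Wv; rewrite scaleN1r addNr.
have [B HB] := choice (fun j => matrix_of_subspace (lW j) (W0 j)).
have exr : exists r, `[< exists j, \rank (B j) = r >].
  by exists (\rank (B 0%N)); apply/asboolP; exists 0%N.
(* From the index where the rank is minimal the row spaces no longer change. *)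
case: (ex_minnP exr) => r /asboolP[j0 j0r] minr.
have [v v0 Wv] := nzW j0; exists v => // j.
apply: (dW j (maxn j j0) (leq_maxl _ _)); apply/HB.
have BB : (B (maxn j j0) <= B j0)%MS.
  by apply/rV_subP => u /HB Wu; apply/HB; apply: dW Wu; exact: leq_maxr.
have /andP[_ B0] : (B (maxn j j0) == B j0)%MS.
  rewrite -(mxrank_leqif_eq BB) eqn_leq mxrankS// j0r.
  by apply: minr; apply/asboolP; exists (maxn j j0).
by apply: submx_trans B0; apply/HB.
Qed.

Section GrowthRates.
Context {R : realType}.
Implicit Types (s t : nat -> R) (l : R).

Lemma cvg_rate_close s t l :
  (forall e, 0 < e -> exists K, forall n, `|s n - t n| <= n%:R * e + K) ->
  (fun n : nat => n%:R^-1 * t n) @ \oo --> l -> (fun n : nat => n%:R^-1 * s n) @ \oo --> l.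
Proof.
move=> st tl; apply/cvgrPdist_le => e e0.
have e4 : 0 < e / 4 by rewrite divr_gt0.
have [K HK] := st _ e4.
move/cvgrPdist_le : tl => /(_ _ e4) tl.
have [m Hm] := exists_nat_ge K e4.
near=> n.
have n0 : 0 < n%:R :> R by rewrite ltr0n; near: n; exists 1%N.
have : `|l - n%:R^-1 * t n| <= e / 4 by near: n.
have : K <= n%:R * (e / 4) by apply: Hm; near: n; exists m.
move=> Kn tn.
have : `|n%:R^-1 * s n - n%:R^-1 * t n| <= e / 2.
  rewrite -mulrBr normrM ger0_norm ?invr_ge0// mulrC ler_pdivrMr//.
  by apply: le_trans (HK n) _; lra.
move: tn; rewrite !ler_norml; move: (_ * s n) (_ * t n) => u w; lra.
Unshelve. all: by end_near. Qed.

(** [K] collects the deviations of the finitely many terms before the convergence estimate takes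
    over. *)
Lemma rate_bound_of_cvg t l e : 0 < e -> (fun n : nat => n%:R^-1 * t n) @ \oo --> l ->
  exists K, forall n, `|t n - n%:R * l| <= n%:R * e + K.
Proof.
move=> e0 /cvgrPdist_le/(_ _ e0)[m _ Hm].
exists (\sum_(i < m.+1) `|t i - i%:R * l|) => n.
have [nm|mn] := ltnP n m.+1.
  rewrite (bigD1 (Ordinal nm))//= [leRHS]addrCA lerDl addr_ge0//.
    by rewrite mulr_ge0// ltW.
  by rewrite sumr_ge0.
have n0 : 0 < n%:R :> R by rewrite ltr0n (leq_ltn_trans _ mn).
apply: (@le_trans _ _ (n%:R * e)); last by rewrite lerDl sumr_ge0.
rewrite (_ : t n - n%:R * l = n%:R * (n%:R^-1 * t n - l)).
  by rewrite normrM ger0_norm// distrC ler_pM2l// Hm //= ltnW.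
by rewrite mulrBr mulrA divff ?mul1r// gt_eqF.
Qed.

(** The loss in [generic_vector] is subexponential, so a generic vector reaches the rate of the
    operator norm. *)
Lemma ln_margin_small d (e : R) : 0 < e ->
  exists K, forall n, - ln (margin (R := R) n ^+ d) <= n%:R * e + K.
Proof.
(* The factor 2 accounts for the two logarithms in [margin]; [d.+1] instead of [d] avoids a division
   by 0. *)
move=> e0; have [e1 e1E] : exists e1, e1 = e / (2 * d.+1%:R) by eexists.
have e10 : 0 < e1 by rewrite e1E divr_gt0// mulr_gt0.
have lnS n : ln (n.+2%:R) <= n.+2%:R * e1 - ln e1.
  rewrite lerBrDr -lnM ?posrE// -[leRHS]expRK ler_ln ?posrE ?expR_gt0 ?mulr_gt0//.
  by apply: le_trans (expR_ge1Dx _); rewrite lerDr.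
exists (d.+1%:R * (ln 16 + 4 * e1 - 2 * ln e1) + d.+1%:R * `|ln 16 + 4 * e1 - 2 * ln e1|).
move=> n.
have m0 := margin_gt0 (R := R) n.
have -> : - ln (margin n ^+ d) = d%:R * (- ln (margin (R := R) n)).
  by rewrite lnXn// mulrN mulr_natl.
have H : - ln (margin (R := R) n) <= 2 * e1 * n%:R + (ln 16 + 4 * e1 - 2 * ln e1).
  rewrite /margin lnV ?posrE ?mulr_gt0// opprK !lnM ?posrE ?mulr_gt0//.
  have : ln (n.+1%:R) <= ln (n.+2%:R) :> R by rewrite ler_ln ?posrE// ler_nat.
  have := lnS n; move: (ln n.+2%:R) (ln n.+1%:R) (ln 16) (ln e1) => u w c g.
  by have -> : n.+2%:R = n%:R + 2 :> R; [rewrite -natrD addn2|lra].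
have h0 : 0 <= - ln (margin (R := R) n) by rewrite oppr_ge0 ln_le0// margin_le1.
apply: (@le_trans _ _ (d.+1%:R * - ln (margin n))); first by rewrite ler_wpM2r// ler_nat.
apply: le_trans (ler_wpM2l _ H) _ => //.
rewrite mulrDr -!addrA lerD//; last by rewrite lerDl mulr_ge0.
have D0 : d.+1%:R != 0 :> R by rewrite pnatr_eq0.
rewrite e1E; move: (d.+1%:R) D0 => D D0.
by rewrite (_ : D * _ = n%:R * e)//; field.
Qed.

End GrowthRates.

(** * A vector of least growth for an abstract linear cocycle *)

Section BottomVector.
Context {dd : measure_display} {X : measurableType dd} {R : realType} {d : nat}.
Context (mu : probability X R) (f : X -> X).
Hypothesis mf : measurable_fun setT f.
Hypothesis mu_inv : forall B, measurable B -> mu (f @^-1` B) = mu B.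
Context (nrm : X -> 'rV[R]_d -> R) (A : nat -> X -> 'M[R]_d) (b : nat -> X -> R) (C : R).
Hypothesis nrmP : forall x, normlike (nrm x).
Hypothesis A0 : forall x, A 0 x = 1%:M.
Hypothesis AD : forall m n x, A (m + n) x = A m x *m A n (iter m f x).
Hypothesis A_inj : forall n x (v : 'rV[R]_d), v != 0 -> v *m A n x != 0.
Hypothesis C0 : 0 <= C.
Hypothesis A_lip : forall x v, nrm x v <= expR C * nrm (f x) (v *m A 1 x).
Hypothesis b_ub : forall n x v, nrm x v <= expR (b n x) * nrm (iter n f x) (v *m A n x).
(** Together with [b_ub] this characterises [b n x] as the logarithm of the operator norm of the
    inverse of [A n x]. *)
Hypothesis b_min : forall n x B,
  (forall v, nrm x v <= expR B * nrm (iter n f x) (v *m A n x)) -> b n x <= B.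

Definition slow_until N q x v :=
  forall n, (n <= N)%N -> nrm (iter n f x) (v *m A n x) <= expR (n%:R * q) * nrm x v.

Hypothesis m_slow : forall N q, measurable [set x | exists2 v : 'rV[R]_d, v != 0 & slow_until N q x v].
Hypothesis slow_compact : forall q x,
  (forall N, exists2 v : 'rV[R]_d, v != 0 & slow_until N q x v) ->
  exists2 v : 'rV[R]_d, v != 0 & forall N, slow_until N q x v.

(** If some point of the orbit has slow vectors up to every time, compactness gives one slow
    forever, which is pulled back to [x]. Otherwise, at every point of the orbit, each vector grows
    at rate [q] within a bounded time, the bound depending on the point. Chaining these stretches
    makes every vector grow at a rate close to [q], which by [b_min] bounds [b] at rate [- q]. *)
Lemma slow_vector q : {ae mu, forall x,
  (exists2 v : 'rV[R]_d, v != 0 & exists K, forall n,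
      nrm (iter n f x) (v *m A n x) <= expR (n%:R * q + K)) \/
  (forall p, - q < p -> ev_below (b^~ x) p)}.
Proof.
pose T N := [set x | ~ exists2 v : 'rV[R]_d, v != 0 & slow_until N q x v].
(* Intersecting over the orbit makes [L] forward invariant. *)
pose L := \bigcap_k iter k f @^-1` (\bigcup_N T N).
have mT N : measurable (T N) by apply: measurableC; exact: m_slow.
have mL : measurable L.
  apply: bigcap_measurable => // k _; apply: measurable_iter_preimage => //.
  exact: bigcup_measurable.
have ndT : {homo T : m n / (m <= n)%N >-> m `<=` n}.
  move=> m n mn x Tm [v v0 sv]; apply: Tm; exists v => // k km.
  by apply: sv; exact: leq_trans mn.
have LT : L `<=` \bigcup_N T N by move=> x /(_ 0%N I).
apply: filterS (rarely_outside mf mu_inv mL mT ndT LT) => x rare.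
have [Lx|nLx] := pselect (L x); last first.
  left.
  have [k Hk] : exists k, forall N, exists2 v : 'rV[R]_d, v != 0 & slow_until N q (iter k f x) v.
    apply: contrapT => H; apply: nLx => k _; apply: contrapT => nT; apply: H.
    by exists k => N; apply: contrapT => H; apply: nT; exists N.
  have [v v0 sv] := slow_compact Hk.
  have Ak : A k x \in unitmx.
    rewrite -row_free_unit -kermx_eq0; apply/rowV0P => u /sub_kermxP uA.
    by apply/eqP; apply: contraT => u0; have := A_inj k x u0; rewrite uA eqxx.
  pose w := v *m invmx (A k x).
  have w0 : w != 0.
    apply: contra_neq v0 => w0; rewrite -[v]mulmx1 -(mulVmx Ak) mulmxA -/w w0.
    by rewrite mul0mx.
  have wA : w *m A k x = v by rewrite mulmxKV.
  exists w => //.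
  (* The sum covers the times before [k]; the last term is the offset between slowness counted from
     time [k] and from time 0. *)
  exists (\sum_(i < k) `|ln (nrm (iter i f x) (w *m A i x)) - i%:R * q| +
          `|ln (nrm (iter k f x) v) - k%:R * q|) => n.
  have Np i y u : u != 0 -> 0 < nrm (iter i f y) (u *m A i y).
    by move=> u0; case: (nrmP (iter i f y)) => _ _; apply; exact: A_inj.
  rewrite -[leLHS]lnK ?posrE ?Np// ler_expR.
  have [nk|kn] := ltnP n k.
    have : `|ln (nrm (iter n f x) (w *m A n x)) - n%:R * q| <=
        \sum_(i < k) `|ln (nrm (iter i f x) (w *m A i x)) - i%:R * q|.
      by rewrite (bigD1 (Ordinal nk))//= lerDl sumr_ge0.
    have := ler_norm (ln (nrm (iter n f x) (w *m A n x)) - n%:R * q).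
    have : 0 <= `|ln (nrm (iter k f x) v) - k%:R * q| by [].
    set u1 := \sum_(i < k) _; set u2 := `|ln _ - k%:R * q|; lra.
  have nE : n = (k + (n - k))%N by rewrite subnKC.
  have := sv (n - k)%N (n - k)%N (leqnn _).
  rewrite -[iter _ f (iter k f x)]iterD -{1}wA -mulmxA -AD subnK// subnKC// => Hn.
  have vp : 0 < nrm (iter k f x) v by case: (nrmP (iter k f x)) => _ _; apply.
  have : ln (nrm (iter n f x) (w *m A n x)) <= (n - k)%:R * q + ln (nrm (iter k f x) v).
    rewrite -[X in X + _]expRK -lnM ?posrE ?expR_gt0// ler_ln ?posrE ?Np//.
    by rewrite mulr_gt0 ?expR_gt0.
  rewrite natrB// => /le_trans; apply.
  have : 0 <= \sum_(i < k) `|ln (nrm (iter i f x) (w *m A i x)) - i%:R * q| by rewrite sumr_ge0.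
  have := ler_norm (ln (nrm (iter k f x) v) - k%:R * q).
  set u1 := \sum_(i < k) _; set u2 := `| _ |; lra.
right => p qp; pose C' := C + `|q|.
have C'0 : 0 <= C' by rewrite addr_ge0.
have Np i y u : u != 0 -> 0 < nrm (iter i f y) (u *m A i y).
  by move=> u0; case: (nrmP (iter i f y)) => _ _; apply; exact: A_inj.
apply: (ev_below_of_rare C'0 qp _ rare) => N n.
apply: b_min => v; have [->|v0] := eqVneq v 0.
  by rewrite mul0mx !normlike0// mulr0.
(* Growth in excess of rate [q], corrected by the charge for visits to the rare set; one step loses
   at most [C']. *)
pose z k := ln (nrm (iter k f x) (v *m A k x)) - k%:R * q + C' * visits f (L `\` T N) k x.
have := ler_norm q; have := ler_norm (- q); rewrite normrN => q1 q2.
have step k : z k + C' * \1_(L `\` T N) (iter k f x) <= z k.+1 + C'.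
  rewrite /z visitsS.
  have := A_lip (iter k f x) (v *m A k x); rewrite -mulmxA -[f (iter k f x)]/(iter 1 f _) -AD.
  rewrite addn1 /= => Hl.
  have : ln (nrm (iter k f x) (v *m A k x)) <= C + ln (nrm (iter k.+1 f x) (v *m A k.+1 x)).
    rewrite -[X in X + _]expRK -lnM ?posrE ?expR_gt0 ?Np// ler_ln ?posrE ?Np//.
    by rewrite mulr_gt0 ?expR_gt0 ?Np.
  rewrite -[k.+1%:R]natr1 /C'; lra.
suff : z 0%N - N.+1%:R * C' <= z n.
  rewrite /z A0 mulmx1 mul0r subr0 /visits big_ord0 mulr0 addr0 -/(visits f (L `\` T N) n x) => Hz.
  have v0p : 0 < nrm x v by case: (nrmP x) => _ _; apply.
  rewrite -[leLHS]lnK ?posrE// -[X in _ * X]lnK ?posrE ?Np// -expRD ler_expR.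
  by move: Hz => /=; lra.
apply: jump_chain => // k kN; last first.
  have := step k; have : 0 <= C' * \1_(L `\` T N) (iter k f x) by rewrite mulr_ge0// indicE.
  lra.
have [Tk|nTk] := pselect (T N (iter k f x)); last first.
  exists 1%N; split=> //; have := step k; rewrite indicE mem_set ?addn1; last first.
    by split=> // i _ /=; rewrite -iterD; exact: Lx.
  by rewrite mulr1; lra.
have : exists l, (0 < l <= N)%N /\
    expR (l%:R * q) * nrm (iter k f x) (v *m A k x) <= nrm (iter (k + l) f x) (v *m A (k + l) x).
  apply: contrapT => H; apply: Tk; exists (v *m A k x); first exact: A_inj.
  move=> l lN; have [->|l0] := posnP l.
    by rewrite mul0r expR0 mul1r A0 mulmx1.
  rewrite leNgt; apply/negP => Hl; apply: H; exists l; rewrite l0 lN; split=> //.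
  by rewrite AD mulmxA addnC iterD ltW.
move=> [l [/andP[l0 lN] Hl]]; exists l; rewrite l0 (leqW lN); split => //.
rewrite /z visitsD natrD.
have : l%:R * q + ln (nrm (iter k f x) (v *m A k x)) <= ln (nrm (iter (k + l) f x) (v *m A (k + l) x)).
  rewrite -[X in X + _]expRK -lnM ?posrE ?expR_gt0 ?Np// ler_ln ?posrE ?Np//.
  by rewrite mulr_gt0 ?expR_gt0 ?Np.
have := mulr_ge0 C'0 (visits_ge0 (R := R) f (L `\` T N) l (iter k f x)).
lra.
Qed.

(** For a rational [q] slightly above [- l], the second alternative of [slow_vector] would push the
    limit of [b n x / n] below [l], so there are slow vectors at rate [q]. A common one for all such
    [q] grows at rate at most [- l], and [b_ub] gives the opposite inequality. *)
Lemma bottom_vector : {ae mu, forall x, forall l : R, (fun n : nat => n%:R^-1 * b n x) @ \oo --> l ->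
  exists2 v : 'rV[R]_d, v != 0 & (fun n : nat => n%:R^-1 * ln (nrm (iter n f x) (v *m A n x))) @ \oo --> - l}.
Proof.
have : {ae mu, forall x, forall q : rat,
  (exists2 v : 'rV[R]_d, v != 0 & exists K, forall n,
      nrm (iter n f x) (v *m A n x) <= expR (n%:R * ratr q + K)) \/
  (forall p, - ratr q < p -> ev_below (b^~ x) p)}.
  have H (q : rat) := slow_vector (ratr q).
  apply: negligibleS (negligible_bigcup_countType H) => x /= nx; apply: contrapT => nF.
  by apply: nx => q; apply: contrapT => ne; apply: nF; exists q.
apply: filterS => x Hx l bl.
have Np i y u : u != 0 -> 0 < nrm (iter i f y) (u *m A i y).
  by move=> u0; case: (nrmP (iter i f y)) => _ _; apply; exact: A_inj.
(* The free constant [K] makes these sets linear subspaces, which [slow_until] does not define. *)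
pose W j := [set v | exists K, forall n,
  nrm (iter n f x) (v *m A n x) <= expR (n%:R * (- l + j.+1%:R^-1) + K)].
have [v v0 Wv] : exists2 v, v != 0 & forall j, W j v.
  apply: nested_subspaces.
  - move=> j a u v [K HK] [K' HK'].
    have p0 : 0 < `|a| * expR K + expR K' by rewrite ltr_wpDl ?mulr_ge0 ?expR_gt0// ltW ?expR_gt0.
    exists (ln (`|a| * expR K + expR K')) => n; rewrite expRD lnK ?posrE//.
    have [NZ ND _] := nrmP (iter n f x).
    rewrite mulmxDl -scalemxAl (le_trans (ND _ _))// NZ mulrDr.
    have := HK n; have := HK' n; rewrite !expRD => Hv Hu.
    by rewrite lerD// mulrCA ler_wpM2l.
  - move=> i j ij v [K HK]; exists K => n; apply: le_trans (HK n) _.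
    by rewrite ler_expR lerD2r ler_wpM2l// lerD2l lef_pV2 ?posrE// ler_nat.
  - move=> j.
    have [q /andP[lq ql]] : exists r : rat, (- l < ratr r) && (ratr r < - l + j.+1%:R^-1).
      have lt : - l < - l + j.+1%:R^-1 by rewrite ltrDl invr_gt0.
      by have [r /itvP rin] := rat_in_itvoo lt; exists r; rewrite !rin.
    have [[v v0 [K HK]]|Hev] := Hx q.
      exists v => //; exists K => n; apply: le_trans (HK n) _.
      by rewrite ler_expR lerD2r ler_wpM2l// ltW.
    exfalso; have qm : - ratr q < (l - ratr q) / 2 by lra.
    have [k [m Hk]] := Hev _ qm.
    have d0 : 0 < (l + ratr q) / 2 by lra.
    move/cvgrPdist_lt : bl => /(_ _ d0)[m' _ Hm'].
    have := Hm' (maxn m m').+1 (leqW (leq_maxr _ _)) => /=.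
    have := Hk (maxn m m').+1 (leqW (leq_maxl _ _)).
    have n0 : 0 < (maxn m m').+1%:R :> R by [].
    rewrite -ler_pdivrMl// ltr_norml => H1 /andP[_].
    have : 0 < k.+1%:R^-1 :> R by rewrite invr_gt0.
    by move: H1; move: k.+1%:R^-1 (_ * b _ x) => k1 bn; lra.
exists v => //.
have sg : (fun n : nat => n%:R^-1 * (- b n x)) @ \oo --> - l.
  by under eq_fun do rewrite mulrN; exact: cvgN.
apply: cvg_rate_close sg => e e0.
have e2 : 0 < e / 2 by rewrite divr_gt0.
have [j Hj] := exists_inv_lt e2.
have [K HK] := Wv j; have [K' HK'] := rate_bound_of_cvg e2 bl.
exists (`|K| + K' + `|ln (nrm x v)|) => n; rewrite opprK ler_norml.
have v0p : 0 < nrm x v by case: (nrmP x) => _ _; apply.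
have : ln (nrm x v) <= b n x + ln (nrm (iter n f x) (v *m A n x)).
  rewrite -[X in X + _]expRK -lnM ?posrE ?expR_gt0 ?Np// ler_ln ?posrE//.
  by rewrite mulr_gt0 ?expR_gt0 ?Np.
have : ln (nrm (iter n f x) (v *m A n x)) <= n%:R * (- l + e / 2) + K.
  rewrite -[leRHS]expRK ler_ln ?posrE ?expR_gt0 ?Np//; apply: le_trans (HK n) _.
  by rewrite ler_expR lerD2r ler_wpM2l// lerD2l ltW.
have := HK' n; have := ler_norm (ln (nrm x v)); have := ler_norm (- ln (nrm x v)).
rewrite normrN ler_norml.
have ne0 : 0 <= n%:R * e by rewrite mulr_ge0// ltW.
have K0 : 0 <= K'.
  by have := HK' 0%N; rewrite !mul0r add0r; exact: le_trans.
have := ler_norm K; have : 0 <= `|K| by [].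
move: (ln (nrm x v)) (ln _) (b n x) => u1 u2 u3; lra.
Qed.

End BottomVector.

(** * Derivatives in charts and their operator norms *)

Section MatrixLimits.
Context {R : realType} {T : Type} (F : set_system T) {FF : Filter F}.

Lemma cvg_mx m n (h : T -> 'M[R]_(m, n)) (M : 'M[R]_(m, n)) :
  (forall i j, (fun t => h t i j) @ F --> M i j) -> h @ F --> M.
Proof.
move=> hM A [P MP PA].
have H : \forall t \near F, forall i j, P i j (h t i j).
  by apply: filter_forall => i; apply: filter_forall => j; exact: (hM i j _ (MP i j)).
by apply: filterS H => t Ht; exact: PA.
Qed.

Lemma cvg_coord m n (h : T -> 'M[R]_(m, n)) (M : 'M[R]_(m, n)) i j :
  h @ F --> M -> (fun t => h t i j) @ F --> M i j.
Proof.
move=> hM; apply: (@cvg_comp _ _ _ h (fun N : 'M[R]_(m, n) => N i j) _ (nbhs M)) => //.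
exact: coord_continuous.
Qed.

Lemma cvg_finite_sum (I : Type) (r : seq I) (h : I -> T -> R) (l : I -> R) :
  (forall i, h i @ F --> l i) -> (fun t => \sum_(i <- r) h i t) @ F --> \sum_(i <- r) l i.
Proof.
move=> hl; elim: r => [|i r IH].
  by rewrite big_nil; under eq_fun do rewrite big_nil; exact: cvg_cst.
by rewrite big_cons; under eq_fun do rewrite big_cons; exact: cvgD.
Qed.

Lemma cvg_mulmx m n p (A : T -> 'M[R]_(m, n)) (B : T -> 'M[R]_(n, p))
    (a : 'M[R]_(m, n)) (b : 'M[R]_(n, p)) :
  A @ F --> a -> B @ F --> b -> (fun t => A t *m B t) @ F --> a *m b.
Proof.
move=> Aa Bb; apply: cvg_mx => i j; under eq_fun do rewrite mxE; rewrite mxE.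
by apply: cvg_finite_sum => k; apply: cvgM; exact: cvg_coord.
Qed.

Lemma cvg_trmx m n (A : T -> 'M[R]_(m, n)) (a : 'M[R]_(m, n)) : A @ F --> a -> (fun t => (A t)^T) @ F --> a^T.
Proof.
move=> Aa; apply: cvg_mx => i j; under eq_fun do rewrite mxE; rewrite mxE.
exact: cvg_coord.
Qed.

End MatrixLimits.

Section QuadraticNorm.
Context {R : realType} {d : nat}.
Implicit Types (G : 'M[R]_d) (u v : 'rV[R]_d).

Definition qnorm G v : R := Num.sqrt ((v *m G *m v^T) 0 0).

Definition posdef G := G^T = G /\ forall v, v != 0 -> 0 < (v *m G *m v^T) 0 0.

Lemma posdef_normlike G : posdef G -> normlike (qnorm G).
Proof.
move=> [Gsym Gpos].
pose B u v := (u *m G *m v^T) 0 0.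
have BDl u v w : B (u + v) w = B u w + B v w by rewrite /B !mulmxDl mxE.
have BZl a u v : B (a *: u) v = a * B u v by rewrite /B -!scalemxAl mxE.
have BC u v : B u v = B v u.
  by rewrite /B -[in LHS](trmxK (u *m G *m v^T)) mxE !trmx_mul trmxK Gsym mulmxA.
have BDr u v w : B w (u + v) = B w u + B w v by rewrite BC BDl ![B _ w]BC.
have BZr a u v : B v (a *: u) = a * B v u by rewrite BC BZl BC.
have B0 v : 0 <= B v v.
  have [->|/Gpos/ltW//] := eqVneq v 0.
  by rewrite /B !mul0mx mxE.
have CS u v : B u v ^+ 2 <= B u u * B v v.
  have [->|v0] := eqVneq v 0.
    by rewrite /B trmx0 !mulmx0 mxE expr0n mulr0.
  have Bv : 0 < B v v by exact: Gpos.
  (* Cauchy-Schwarz: the form is nonnegative at this combination. *)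
  have := B0 (B v v *: u + (- B u v) *: v).
  rewrite !(BDl, BDr, BZl, BZr) (BC v u) => H.
  have {H} : 0 <= B v v * (B u u * B v v - B u v ^+ 2) by move: H; rewrite expr2; lra.
  by rewrite pmulr_rge0// subr_ge0.
split=> [a v|u v|v v0].
- by rewrite /qnorm -[_ 0 0]/(B _ _) BZl BZr mulrA -expr2 sqrtrM ?sqr_ge0// sqrtr_sqr.
- rewrite /qnorm -!/(B _ _) -[leRHS]ger0_norm ?addr_ge0// -sqrtr_sqr ler_sqrt ?sqr_ge0//.
  rewrite sqrrD !sqr_sqrtr// BDl !BDr (BC v u).
  have : B u v <= Num.sqrt (B u u) * Num.sqrt (B v v).
    by rewrite -sqrtrM// (le_trans (ler_norm _))// -sqrtr_sqr ler_sqrt// mulr_ge0.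
  lra.
- by rewrite sqrtr_gt0 Gpos.
Qed.

Lemma cvg_qnorm {T : Type} (F : set_system T) {FF : Filter F} (G : T -> 'M[R]_d)
    (v : T -> 'rV[R]_d) (G0 : 'M[R]_d) (v0 : 'rV[R]_d) :
  G @ F --> G0 -> v @ F --> v0 -> (fun t => qnorm (G t) (v t)) @ F --> qnorm G0 v0.
Proof.
move=> GG vv; apply: (@cvg_comp _ _ _ (fun t => (v t *m G t *m (v t)^T) 0 0) Num.sqrt _ (nbhs ((v0 *m G0 *m v0^T) 0 0))); last exact: sqrt_continuous.
by apply: cvg_coord; apply: cvg_mulmx; [exact: cvg_mulmx|exact: cvg_trmx].
Qed.

Lemma qnorm_congr G (J : 'M[R]_d) v : qnorm (J *m G *m J^T) v = qnorm G (v *m J).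
Proof. by rewrite /qnorm trmx_mul !mulmxA. Qed.

End QuadraticNorm.

Section NormEquivalence.
Context {R : realType} {d : nat}.
Implicit Types (N : 'rV[R]_d -> R) (u v : 'rV[R]_d).

Definition unit_sphere : set 'rV[R]_d := [set v | `|v| = 1].

Lemma compact_unit_sphere : compact unit_sphere.
Proof.
apply: bounded_closed_compact.
  by exists 1; split => // x x1 v /= ->; exact: ltW.
by apply: (@preimage_closed _ _ _ [set 1 : R]) => [v _|]; [exact: norm_continuous|exact: closed_eq].
Qed.

Lemma unit_sphere_scale v : v != 0 -> exists2 s, unit_sphere s & exists2 a, 0 < a & v = a *: s.
Proof.
move=> v0; have n0 : 0 < `|v| by rewrite normr_gt0.
exists (`|v|^-1 *: v).
  by rewrite /unit_sphere /= normrZ ger0_norm ?invr_ge0// mulVf// gt_eqF.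
by exists `|v| => //; rewrite scalerA divff ?scale1r// gt_eqF.
Qed.

Lemma coord_le_norm v i : `|v 0 i| <= `|v|.
Proof.
rewrite [leRHS]/Num.norm/= mx_normrE.
exact: (le_bigmax _ (fun i => `|v i.1 i.2|) (0, i)).
Qed.

Lemma normlike_le_norm N : normlike N -> exists2 C, 0 < C & forall v, N v <= C * `|v|.
Proof.
move=> NN; exists (1 + \sum_i N (delta_mx 0 i)).
  by rewrite ltr_pwDl// sumr_ge0// => i _; exact: normlike_ge0.
move=> v; apply: le_trans (normlike_le_sum v NN) _.
rewrite mulrDl mul1r ler_wpDl// mulr_suml; apply: ler_sum => i _.
by rewrite mulrC ler_wpM2l ?normlike_ge0// coord_le_norm.
Qed.

Lemma normlike_dist N u v : normlike N -> `|N u - N v| <= N (u - v).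
Proof.
move=> NN; have [_ ND _] := NN; rewrite ler_norml; apply/andP; split.
  rewrite lerNl opprB lerBlDr -(normlikeN (u - v) NN) opprB.
  by apply: le_trans (ND _ _); rewrite subrK.
by rewrite lerBlDr; apply: le_trans (ND _ _); rewrite subrK.
Qed.

Lemma normlike_continuous N : normlike N -> continuous N.
Proof.
move=> NN v; have [C C0 NC] := normlike_le_norm NN.
apply/(@cvgrPdist_le _ _ _ (nbhs v) (nbhs_filter v)) => e e0; have d0 : 0 < e / C by rewrite divr_gt0.
have := nbhsx_ballx v _ d0; rewrite -ball_normE; apply: filterS => u /= vu.
apply: le_trans (normlike_dist _ _ NN) _; apply: le_trans (NC _) _.
by rewrite mulrC -ler_pdivlMr// ltW.
Qed.

Lemma norm_le_normlike N : normlike N -> exists2 C, 0 < C & forall v, `|v| <= C * N v.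
Proof.
move=> NN; have [NZ _ N0] := NN.
(* The sphere is empty in dimension 0. *)
have [S0|/set0P Sn0] := eqVneq unit_sphere set0.
  exists 1 => // v; have [->|/unit_sphere_scale[s]] := eqVneq v 0.
    by rewrite normr0 mul1r normlike_ge0.
  by rewrite S0.
have [s] := compact_EVT_min Sn0 compact_unit_sphere (continuous_subspaceT (normlike_continuous NN)).
rewrite inE => ss mins.
have Ns : 0 < N s.
  by apply: N0; apply/eqP => s0; move: ss; rewrite /unit_sphere /= s0 normr0 => /eqP; rewrite eq_sym oner_eq0.
exists (N s)^-1; first by rewrite invr_gt0.
move=> v; have [->|/unit_sphere_scale[t tt [a a0 ->]]] := eqVneq v 0.
  by rewrite normr0 normlike0// mulr0.
rewrite NZ normrZ tt mulr1 gtr0_norm// mulrCA; apply: ler_peMr; first exact: ltW.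
by rewrite mulrC ler_pdivlMr// mul1r mins// inE.
Qed.

(** [opnorm] with the norms as parameters, so that it can be read in any pair of charts. *)
Definition opn N1 N2 (B : 'M[R]_d) : R := sup [set N2 (v *m B) | v in [set v | N1 v <= 1]].

Lemma normlike_bounded_mul N1 N2 (B : 'M[R]_d) : normlike N1 -> normlike N2 ->
  exists2 C, 0 <= C & forall v, N2 (v *m B) <= C * N1 v.
Proof.
move=> N1N N2N; have [C C0 HC] := norm_le_normlike N1N.
pose S := \sum_i N2 (delta_mx 0 i *m B).
have S0 : 0 <= S by apply: sumr_ge0 => i _; exact: normlike_ge0.
exists (S * C); first by rewrite mulr_ge0// ltW.
move=> v; have [NZ ND _] := N2N.
apply: le_trans (_ : \sum_i `|v 0 i| * N2 (delta_mx 0 i *m B) <= _).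
  rewrite {1}(row_sum_delta v) mulmx_suml.
  elim/big_ind2: _ => [|x y z w xy zw|i _]; first by rewrite normlike0.
    by rewrite (le_trans (ND _ _))// lerD.
  by rewrite -scalemxAl NZ.
rewrite -mulrA /S mulr_suml ler_sum// => i _; rewrite mulrC ler_wpM2l ?normlike_ge0//.
exact: le_trans (coord_le_norm v i) (HC v).
Qed.

Lemma opn_has_sup N1 N2 B : normlike N1 -> normlike N2 ->
  has_sup [set N2 (v *m B) | v in [set v | N1 v <= 1]].
Proof.
move=> N1N N2N; split; first by exists (N2 (0 *m B)), 0 => //=; rewrite normlike0.
have [C C0 HC] := normlike_bounded_mul B N1N N2N.
exists C => _ [v /= v1 <-]; apply: le_trans (HC v) _.
by rewrite ler_piMr.
Qed.

Lemma opn_ub N1 N2 B v : normlike N1 -> normlike N2 -> N2 (v *m B) <= opn N1 N2 B * N1 v.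
Proof.
move=> N1N N2N; have [->|v0] := eqVneq v 0.
  by rewrite mul0mx !normlike0// mulr0.
have [[N1Z _ N10] [N2Z _ _]] := (N1N, N2N).
have Nv := N10 _ v0.
have iv : 0 <= (N1 v)^-1 by rewrite invr_ge0 ltW.
rewrite -ler_pdivrMr//; apply: sup_upper_bound; first exact: opn_has_sup.
exists ((N1 v)^-1 *: v) => /=.
  by rewrite N1Z ger0_norm// mulVf// gt_eqF.
by rewrite -scalemxAl N2Z ger0_norm// mulrC.
Qed.

Lemma opn_ge0 N1 N2 B : normlike N1 -> normlike N2 -> 0 <= opn N1 N2 B.
Proof.
move=> N1N N2N; apply: le_trans (normlike_ge0 (0 *m B) N2N) _.
apply: sup_upper_bound; first exact: opn_has_sup.
by exists 0 => //=; rewrite normlike0.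
Qed.

Lemma opn_le N1 N2 B s : normlike N1 -> normlike N2 -> 0 <= s ->
  (forall v, N2 (v *m B) <= s * N1 v) -> opn N1 N2 B <= s.
Proof.
move=> N1N N2N s0 H; apply: ge_sup; first by case: (opn_has_sup B N1N N2N).
by move=> _ [v /= v1 <-]; apply: le_trans (H v) _; rewrite ler_piMr.
Qed.

Lemma opn_le_sphere N1 N2 B s : normlike N1 -> normlike N2 -> 0 <= s ->
  (forall v, unit_sphere v -> N2 (v *m B) <= s * N1 v) -> opn N1 N2 B <= s.
Proof.
move=> N1N N2N s0 H; apply: opn_le => // v.
have [->|/unit_sphere_scale[t tt [a a0 ->]]] := eqVneq v 0.
  by rewrite mul0mx !normlike0// mulr0.
have [[N1Z _ N10] [N2Z _ _]] := (N1N, N2N).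
by rewrite -scalemxAl N1Z N2Z mulrCA ler_wpM2l// H.
Qed.

(** The lower bound follows one vector that nearly attains the limit norm. The upper bound has to
    hold for all vectors at once, and compactness of the unit sphere provides the uniformity. *)
Lemma cvg_opn {T : Type} (F : set_system T) {FF : Filter F} (G1 G2 B : T -> 'M[R]_d)
    (g1 g2 b : 'M[R]_d) :
  (\forall t \near F, posdef (G1 t)) -> (\forall t \near F, posdef (G2 t)) ->
  posdef g1 -> posdef g2 -> G1 @ F --> g1 -> G2 @ F --> g2 -> B @ F --> b ->
  (fun t => opn (qnorm (G1 t)) (qnorm (G2 t)) (B t)) @ F --> opn (qnorm g1) (qnorm g2) b.
Proof.
move=> pG1 pG2 /posdef_normlike pg1 /posdef_normlike pg2 Gg1 Gg2 Bb.
set o := opn _ _ b; apply/cvgrPdist_le => e e0.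
have o0 : 0 <= o by exact: opn_ge0.
have cq1 v : (fun t => qnorm (G1 t) v) @ F --> qnorm g1 v by apply: cvg_qnorm => //; exact: cvg_cst.
have cq2 v : (fun t => qnorm (G2 t) (v *m B t)) @ F --> qnorm g2 (v *m b).
  by apply: cvg_qnorm => //; apply: cvg_mulmx => //; exact: cvg_cst.
have low : \forall t \near F, o - e <= opn (qnorm (G1 t)) (qnorm (G2 t)) (B t).
  have [oe|oe] := ltP (o - e) 0.
    near=> t; apply: le_trans (ltW oe) _; apply: opn_ge0; apply: posdef_normlike; near: t => //.
  have [v Hv] : exists v, (o - e) * qnorm g1 v < qnorm g2 (v *m b).
    apply: contrapT => H.
    have : o <= o - e.
      by apply: opn_le => // v; rewrite leNgt; apply/negP => Hv; apply: H; exists v.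
    by move: e0; lra.
  have v0 : v != 0.
    by apply: contraTneq Hv => ->; rewrite mul0mx !normlike0// mulr0 ltxx.
  have Hd : (fun t => qnorm (G2 t) (v *m B t) - (o - e) * qnorm (G1 t) v) @ F -->
      qnorm g2 (v *m b) - (o - e) * qnorm g1 v.
    by apply: cvgB => //; apply: cvgM => //; exact: cvg_cst.
  near=> t.
  have p1 : normlike (qnorm (G1 t)) by apply: posdef_normlike; near: t.
  have p2 : normlike (qnorm (G2 t)) by apply: posdef_normlike; near: t.
  have : 0 < qnorm (G2 t) (v *m B t) - (o - e) * qnorm (G1 t) v.
    by near: t; apply: (cvgr_gt _ Hd); rewrite subr_gt0.
  rewrite subr_gt0 => /lt_le_trans/(_ (opn_ub _ _ p1 p2)).
  rewrite ltr_pM2r; first exact: ltW.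
  by case: p1 => _ _; apply.
have high : \forall t \near F, opn (qnorm (G1 t)) (qnorm (G2 t)) (B t) <= o + e.
  have tube : \forall t \near F, unit_sphere `<=`
      (fun v => qnorm (G2 t) (v *m B t) - (o + e) * qnorm (G1 t) v < 0).
    have /compact_near_coveringP := compact_unit_sphere.
    apply => v sv.
    have v0 : v != 0.
      by apply/eqP => v0; move: sv; rewrite /unit_sphere /= v0 normr0 => /eqP; rewrite eq_sym oner_eq0.
    pose H (p : 'rV[R]_d * T) := qnorm (G2 p.2) (p.1 *m B p.2) - (o + e) * qnorm (G1 p.2) p.1.
    have Hc : H @ filter_prod (nbhs v) F --> qnorm g2 (v *m b) - (o + e) * qnorm g1 v.
      have c1 : fst @ filter_prod (nbhs v) F --> v by exact: cvg_fst.
      have c2 (U : topologicalType) (h : T -> U) (l : U) : h @ F --> l ->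
          (fun p : 'rV[R]_d * T => h p.2) @ filter_prod (nbhs v) F --> l.
        move=> hl A /hl hA; exists (setT, h @^-1` A); last by move=> [? ?] [].
        by split; [exact: filterT|].
      have FP : Filter (filter_prod (nbhs v) F) by apply: filter_prod_filter.
      apply: cvgB; first by apply: (@cvg_qnorm _ _ _ _ FP); [exact: (c2 _ _ _ Gg2)|apply: (@cvg_mulmx _ _ _ FP) => //; exact: (c2 _ _ _ Bb)].
      by apply: cvgM; [exact: cvg_cst|apply: (@cvg_qnorm _ _ _ _ FP) => //; exact: (c2 _ _ _ Gg1)].
    have : \forall p \near filter_prod (nbhs v) F, H p < 0.
      apply: (cvgr_lt _ Hc); rewrite subr_lt0.
      apply: le_lt_trans (opn_ub _ _ pg1 pg2) _; rewrite ltr_pM2r ?ltrDl//.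
      by case: pg1 => _ _; apply.
    by [].
  near=> t.
  have p1 : normlike (qnorm (G1 t)) by apply: posdef_normlike; near: t.
  have p2 : normlike (qnorm (G2 t)) by apply: posdef_normlike; near: t.
  apply: opn_le_sphere => //; first by rewrite addr_ge0// ltW.
  move=> v sv; rewrite -subr_le0 ltW//.
  by move: v sv; near: t.
near=> t; rewrite ler_distlC; apply/andP; split.
  by near: t.
by near: t.
Unshelve. all: by end_near. Qed.

End NormEquivalence.

(** Differentiability and the differential depend only on the germ. This is needed throughout
    because [para i] and [lcoord i] are mutually inverse only on the chart domain and its image. *)
Lemma near_eq_diff (R : realType) (V W : normedModType R) (f h : V -> W) (x : V) :
  (\forall y \near x, f y = h y) -> differentiable f x ->
  differentiable h x /\ 'd h x = 'd f x :> (V -> W).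
Proof.
move=> fh df; have [cf ef] := (diff_locallyP _ _).1 df.
have eh : h \o shift x = cst (h x) + 'd f x +o_ 0 id.
  apply/eqaddoP => e e0; move/eqaddoP : ef => /(_ e e0).
  have fh0 : \forall y \near (0 : V), f (y + x) = h (y + x).
    by move: fh; rewrite (near_shift 0); apply: filterS => y /=; rewrite subr0.
  have <- : f x = h x by exact: nbhs_singleton fh.
  move=> H; near=> y.
  have <- : (f \o shift x - (cst (f x) + 'd f x)) y = (h \o shift x - (cst (f x) + 'd f x)) y.
    rewrite /GRing.add/= /GRing.opp/=; congr (_ - _).
    by near: y.
  by near: y.
have dE := diff_unique cf eh.
split; last exact: dE.
apply/diff_locallyP; rewrite dE; split; [exact: cf|exact: eh].
Unshelve. all: by end_near. Qed.

Lemma near_eq_continuous (T U : topologicalType) (f h : T -> U) (x : T) :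
  (\forall y \near x, f y = h y) -> {for x, continuous f} -> {for x, continuous h}.
Proof.
move=> fh cf; rewrite /prop_for /continuous_at -(nbhs_singleton fh).
by apply: cvg_trans cf; exact: near_eq_cvg.
Qed.

Section Jacobian.
Context {R : realType}.

Lemma mul_jacobian m n (F : 'rV[R]_m -> 'rV[R]_n) p v : v *m 'J F p = 'd F p v.
Proof. by rewrite /jacobian mul_rV_lin1. Qed.

Lemma jacobian_unique m n (F : 'rV[R]_m -> 'rV[R]_n) p (J : 'M[R]_(m, n)) :
  (forall v, 'd F p v = v *m J) -> 'J F p = J.
Proof. by move=> H; apply/row_matrixP => i; rewrite !rowE mul_jacobian H. Qed.

Lemma jacobian_continuous m n (F : 'rV[R]_m -> 'rV[R]_n) p :
  (forall v, {for p, continuous (fun x => 'd F x v)}) -> {for p, continuous (jacobian F)}.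
Proof.
move=> H; apply: (@cvg_mx _ _ (nbhs p)) => i j.
under eq_fun do rewrite /jacobian mxE.
by rewrite /jacobian mxE; apply: (@cvg_coord _ _ (nbhs p)); exact: H.
Qed.

End Jacobian.

Section ChartCalculus.
Context {R : realType} {d : nat} {M : topologicalType} {A : smooth_atlas R d M}.
Implicit Types (i j k : chart A) (x : M) (h : M -> M) (c : R -> M).

Lemma lcoord_continuous_at i x : dom i x -> {for x, continuous (lcoord i)}.
Proof.
move=> ix; have := @lcoord_continuous _ _ _ A i; rewrite continuous_open_subspace; last exact: dom_open.
by apply; rewrite inE.
Qed.

Lemma para_continuous_at i x : dom i x -> {for lcoord i x, continuous (para i)}.
Proof.
move=> ix; have := @para_continuous _ _ _ A i; rewrite continuous_open_subspace; last exact: cod_open.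
by apply; rewrite inE; exists x.
Qed.

Lemma near_chart i x (U : set M) : dom i x -> nbhs x U ->
  \forall p \near lcoord i x, exists y, [/\ p = lcoord i y, para i p = y, dom i y & U y].
Proof.
move=> ix Ux.
have H1 : \forall p \near lcoord i x, (lcoord i @` dom i) p.
  by apply: open_nbhs_nbhs; split; [exact: cod_open|exists x].
have H2 : \forall p \near lcoord i x, U (para i p).
  have := @para_continuous_at i x ix; rewrite /prop_for /continuous_at (lcoordK ix); apply.
  exact: Ux.
near=> p.
have [y iy yp] : (lcoord i @` dom i) p by near: p.
have : U (para i p) by near: p.
by rewrite -yp (lcoordK iy) => Uy; exists y.
Unshelve. all: by end_near. Qed.

(* Sealed: unification must not compare two Jacobians by unfolding them. *)
Lemma dmap_sealed : {D : (M -> M) -> chart A -> chart A -> M -> 'M[R]_d |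
  forall h i j x, D h i j x = 'J (lcoord j \o h \o para i) (lcoord i x)}.
Proof. by exists (fun h i j x => 'J (lcoord j \o h \o para i) (lcoord i x)). Qed.

Definition dmap := sval dmap_sealed.

Lemma dmapE h i j x : dmap h i j x = 'J (lcoord j \o h \o para i) (lcoord i x).
Proof. exact: (svalP dmap_sealed). Qed.

Lemma C1_map_continuous h x : C1_map A h -> {for x, continuous h}.
Proof. by move=> [+ _]; apply. Qed.

Lemma C1_map_differentiable h i j x : C1_map A h -> dom i x -> dom j (h x) ->
  differentiable (lcoord j \o h \o para i) (lcoord i x).
Proof. by move=> [_ /(_ i j)[+ _]] ix jx; apply; exists x. Qed.

Lemma near_dom_preimage h j x : {for x, continuous h} -> dom j (h x) ->
  \forall y \near x, dom j (h y).
Proof. by move=> ch jx; apply: ch; apply: open_nbhs_nbhs; split=> //; exact: dom_open. Qed.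

Lemma dmap_continuous h i j x : C1_map A h -> dom i x -> dom j (h x) ->
  {for x, continuous (dmap h i j)}.
Proof.
move=> Ch ix jx; rewrite (_ : dmap h i j = fun y => 'J (lcoord j \o h \o para i) (lcoord i y)).
  2: by apply/funext => y; exact: dmapE.
apply: (@continuous_comp _ _ _ (lcoord i) (jacobian (lcoord j \o h \o para i))).
  exact: lcoord_continuous_at.
apply: jacobian_continuous => v.
by case: Ch => _ /(_ i j)[_ /(_ v)]; apply; exists x.
Qed.

Lemma dmap_comp_diff h1 h2 i j k x : C1_map A h1 -> C1_map A h2 ->
  dom i x -> dom j (h1 x) -> dom k (h2 (h1 x)) ->
  differentiable (lcoord k \o (h2 \o h1) \o para i) (lcoord i x) /\
  dmap (h2 \o h1) i k x = dmap h1 i j x *m dmap h2 j k (h1 x).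
Proof.
move=> C1 C2 ix jx kx.
pose F1 := lcoord j \o h1 \o para i; pose F2 := lcoord k \o h2 \o para j.
have d1 : differentiable F1 (lcoord i x) by exact: C1_map_differentiable.
have E : F1 (lcoord i x) = lcoord j (h1 x) by rewrite /F1 /= (lcoordK ix).
have d2 : differentiable F2 (F1 (lcoord i x)) by rewrite E; exact: C1_map_differentiable.
have near_eq : \forall p \near lcoord i x, (F2 \o F1) p = (lcoord k \o (h2 \o h1) \o para i) p.
  have := near_chart ix (near_dom_preimage (C1_map_continuous (x := x) C1) jx).
  by apply: filterS => p [y [_ py iy jy]]; rewrite /F1 /F2 /= py (lcoordK jy).
have [dF EF] := near_eq_diff near_eq (differentiable_comp d1 d2).
split; first exact: dF.
rewrite !dmapE; apply: jacobian_unique => v; rewrite EF (diff_comp d1 d2) mulmxA.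
rewrite (mul_jacobian F1) -E (mul_jacobian F2); reflexivity.
Qed.

Lemma dmap_comp h1 h2 i j k x : C1_map A h1 -> C1_map A h2 ->
  dom i x -> dom j (h1 x) -> dom k (h2 (h1 x)) ->
  dmap (h2 \o h1) i k x = dmap h1 i j x *m dmap h2 j k (h1 x).
Proof. by move=> C1 C2 ix jx kx; have [] := dmap_comp_diff C1 C2 ix jx kx. Qed.

Lemma C1_map_id : C1_map A id.
Proof. by split=> [x|i j]; [exact: cvg_id|exact: (@transition_smooth _ _ _ A i j 1)]. Qed.

Lemma C1_map_comp h1 h2 : C1_map A h1 -> C1_map A h2 -> C1_map A (h2 \o h1).
Proof.
move=> C1 C2; split=> [x|i k].
  by apply: continuous_comp; exact: C1_map_continuous.
split=> [_ [x [ix kx] <-]|v _ [x [ix kx] <-]].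
  have jx := dom_chart_at A (h1 x).
  by case: (dmap_comp_diff C1 C2 ix jx kx).
have jx := dom_chart_at A (h1 x); set j := chart_at A (h1 x) in jx.
(* By the chain rule [H] is the differential near the point, and each of its factors is
   continuous. *)
pose H p := v *m (dmap h1 i j (para i p) *m dmap h2 j k (h1 (para i p))).
have near_eq : \forall p \near lcoord i x, H p = 'd (lcoord k \o (h2 \o h1) \o para i) p v.
  have n1 := near_dom_preimage (C1_map_continuous (x := x) C1) jx.
  have n2 : \forall y \near x, dom k (h2 (h1 y)).
    by apply: (near_dom_preimage (h := h2 \o h1)) => //; apply: continuous_comp; exact: C1_map_continuous.
  have n12 : \forall y \near x, dom j (h1 y) /\ dom k (h2 (h1 y)) by exact: filterI.
  have := near_chart ix n12; apply: filterS => p [y [pE py iy [jy ky]]].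
  by rewrite /H py -(dmap_comp C1 C2 iy jy ky) dmapE -pE mul_jacobian.
apply: (near_eq_continuous near_eq).
have cp : para i @ lcoord i x --> x by rewrite -{2}(lcoordK ix); exact: para_continuous_at.
rewrite /prop_for /continuous_at /H (lcoordK ix).
apply: (@cvg_mulmx _ _ (nbhs (lcoord i x))); first exact: cvg_cst.
apply: (@cvg_mulmx _ _ (nbhs (lcoord i x))).
  by apply: (@cvg_comp _ _ _ (para i) (dmap h1 i j) _ _ _ cp); exact: dmap_continuous.
apply: (@cvg_comp _ _ _ (para i) (fun y => dmap h2 j k (h1 y)) _ _ _ cp).
apply: (@continuous_comp _ _ _ h1 (dmap h2 j k)); first exact: C1_map_continuous.
exact: dmap_continuous.
Qed.

Lemma C1_map_iter h n : C1_map A h -> C1_map A (iter n h).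
Proof.
move=> Ch; elim: n => [|n IH]; first exact: C1_map_id.
exact: (C1_map_comp IH Ch).
Qed.

Lemma dmap_id i x : dom i x -> dmap id i i x = 1%:M.
Proof.
move=> ix; rewrite dmapE; apply: jacobian_unique => v.
have near_eq : \forall p \near lcoord i x, id p = (lcoord i \o id \o para i) p.
  have nT : nbhs x [set: M] by exact: filterT.
  have := near_chart ix nT.
  by apply: filterS => p [y [pE py iy _]]; rewrite /= py pE.
have di : differentiable (@id 'rV[R]_d) (lcoord i x) by exact: ex_diff.
have [_ ->] := near_eq_diff near_eq di.
by rewrite mulmx1 diff_val.
Qed.

End ChartCalculus.

(** * Curves and the Riemannian distance *)

Section Curves.
Context {R : realType} {d : nat} {M : topologicalType} {A : smooth_atlas R d M}.
Implicit Types (i j k : chart A) (x : M) (h : M -> M) (c : R -> M).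

(** Velocity read in one fixed chart; [speed] uses a chart that varies with the point, which hides
    continuity. *)
Definition cvel i c t : 'rV[R]_d := 'D_1 (lcoord i \o c) t.

Lemma C1_curve_diff i c t : C1_curve A c -> dom i (c t) -> differentiable (lcoord i \o c) t.
Proof. by move=> [_ /(_ i)[+ _]] it; apply. Qed.

Lemma cvelE i c t : C1_curve A c -> dom i (c t) -> cvel i c t = 'd (lcoord i \o c) t 1.
Proof. by move=> Cc it; rewrite /cvel deriveE//; exact: C1_curve_diff. Qed.

Lemma near_dom_curve i c t : C1_curve A c -> dom i (c t) -> \forall s \near t, dom i (c s).
Proof.
move=> [cc _] it; have := cc t; apply; apply: open_nbhs_nbhs.
by split=> //; exact: dom_open.
Qed.

Lemma cvel_continuous i c t : C1_curve A c -> dom i (c t) -> {for t, continuous (cvel i c)}.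
Proof.
move=> Cc it; apply: (@near_eq_continuous _ _ (fun s => 'd (lcoord i \o c) s 1)).
  by apply: filterS (near_dom_curve Cc it) => s is_; rewrite cvelE.
by case: Cc => _ /(_ i)[_ /(_ 1)]; apply.
Qed.

Lemma map_curve_diff h c i j t : C1_map A h -> C1_curve A c ->
  dom i (c t) -> dom j (h (c t)) ->
  differentiable (lcoord j \o (h \o c)) t /\
  forall v, 'd (lcoord j \o (h \o c)) t v = 'd (lcoord i \o c) t v *m dmap h i j (c t).
Proof.
move=> Ch Cc it jt.
pose F := lcoord j \o h \o para i.
have d1 : differentiable (lcoord i \o c) t by exact: C1_curve_diff.
have d2 : differentiable F ((lcoord i \o c) t) by exact: C1_map_differentiable.
have near_eq : \forall s \near t, (F \o (lcoord i \o c)) s = (lcoord j \o (h \o c)) s.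
  apply: filterS (near_dom_curve Cc it) => s is_.
  by rewrite /F /= (lcoordK is_).
have [dF EF] := near_eq_diff near_eq (differentiable_comp d1 d2).
split; first exact: dF.
move=> v; have := congr1 (fun u => u v) EF; have := congr1 (fun u => u v) (diff_comp d1 d2).
move=> E1 E2; rewrite dmapE; apply: (etrans E2); apply: (etrans E1).
have E := mul_jacobian F (lcoord i (c t)) ('d (lcoord i \o c) t v). exact: (esym E).
Qed.

Lemma cvel_map h c i j t : C1_map A h -> C1_curve A c ->
  dom i (c t) -> dom j (h (c t)) -> cvel j (h \o c) t = cvel i c t *m dmap h i j (c t).
Proof.
move=> Ch Cc it jt; have [dF EF] := map_curve_diff Ch Cc it jt.
by rewrite /cvel deriveE// EF -(cvelE Cc it).
Qed.

Lemma C1_curve_map h c : C1_map A h -> C1_curve A c -> C1_curve A (h \o c).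
Proof.
move=> Ch Cc; split.
  by move=> t; apply: continuous_comp; [case: Cc => cc _; exact: cc|exact: C1_map_continuous Ch].
move=> j; split=> [t jt|v t jt].
  by case: (map_curve_diff Ch Cc (dom_chart_at A (c t)) jt).
have it := dom_chart_at A (c t); set i := chart_at A (c t) in it.
have ct : {for t, continuous c} by case: Cc => cc _; exact: cc.
apply: (@near_eq_continuous _ _ (fun s => 'd (lcoord i \o c) s v *m dmap h i j (c s))).
  have nj : \forall s \near t, dom j (h (c s)).
    apply: (ct (fun y => dom j (h y))); apply: near_dom_preimage => //.
    exact: C1_map_continuous Ch.
  near=> s.
  have is_ : dom i (c s) by near: s; exact: near_dom_curve.
  have js : dom j (h (c s)) by near: s.
  have [_ E] := map_curve_diff Ch Cc is_ js; exact: (esym (E v)).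
apply: (@cvg_mulmx _ _ (nbhs t)).
  by case: Cc => _ /(_ i)[_ /(_ v)]; apply.
apply: (@continuous_comp _ _ _ c (dmap h i j)) => //.
exact: dmap_continuous.
Unshelve. all: by end_near. Qed.

End Curves.

Section Metric.
Context {R : realType} {d : nat} {M : topologicalType} {A : smooth_atlas R d M}.
Context (g : riemannian A).
Implicit Types (i j k : chart A) (x : M) (h : M -> M) (c : R -> M).

Lemma gram_posdef i x : dom i x -> posdef (gram g i x).
Proof. by move=> ix; split; [exact: gram_sym|exact: gram_pos]. Qed.

Lemma gram_normlike i x : dom i x -> normlike (qnorm (gram g i x)).
Proof. by move=> ix; apply: posdef_normlike; exact: gram_posdef. Qed.

Lemma gram_continuous i x : dom i x -> {for x, continuous (gram g i)}.
Proof.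
move=> ix; apply: (@near_eq_continuous _ _ ((gram g i \o para i) \o lcoord i)).
  have : \forall y \near x, dom i y by apply: open_nbhs_nbhs; split=> //; exact: dom_open.
  by apply: filterS => y iy; rewrite /= (lcoordK iy).
apply: continuous_comp; first exact: lcoord_continuous_at.
by apply: (@gram_smooth _ _ _ _ g i 0); exists x.
Qed.

Lemma gram_change i j x v : dom i x -> dom j x ->
  qnorm (gram g i x) v = qnorm (gram g j x) (v *m dmap id i j x).
Proof. by move=> ix jx; rewrite (gram_compat g ix jx) qnorm_congr dmapE. Qed.

Lemma tnormE i x v : dom i x -> tnorm g x v = qnorm (gram g i x) (v *m dmap id (chart_at A x) i x).
Proof. by move=> ix; rewrite -gram_change//; exact: dom_chart_at. Qed.

Lemma tnorm_normlike x : normlike (tnorm g x).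
Proof. exact/gram_normlike/dom_chart_at. Qed.

Lemma dmap_id_inv i j x : dom i x -> dom j x -> dmap id i j x *m dmap id j i x = 1%:M.
Proof.
move=> ix jx; have := dmap_comp (@C1_map_id _ _ _ A) (@C1_map_id _ _ _ A) ix jx ix.
by move=> <-; exact: dmap_id.
Qed.

Lemma DmxE h x : Dmx A h x = dmap h (chart_at A x) (chart_at A (h x)) x.
Proof. by rewrite dmapE. Qed.

Lemma opmap_sealed : {o : (M -> M) -> M -> R |
  forall h x, o h x = opn (tnorm g x) (tnorm g (h x)) (Dmx A h x)}.
Proof. by exists (fun h x => opn (tnorm g x) (tnorm g (h x)) (Dmx A h x)). Qed.

Definition opmap := sval opmap_sealed.

Lemma opmap_opn h x : opmap h x = opn (tnorm g x) (tnorm g (h x)) (Dmx A h x).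
Proof. exact: (svalP opmap_sealed). Qed.

Lemma opmap_opnorm h x : opmap h x = opnorm g x (h x) (Dmx A h x).
Proof. exact: opmap_opn. Qed.

(** Changes of charts are isometries for the Gram norms and intertwine the two matrices. Without
    this freedom continuity in [x] is out of reach, since preferred charts may jump. *)
Lemma opmapE h i j x : C1_map A h -> dom i x -> dom j (h x) ->
  opmap h x = opn (qnorm (gram g i x)) (qnorm (gram g j (h x))) (dmap h i j x).
Proof.
move=> Ch ix jx; have C1 := @C1_map_id _ _ _ A.
have ax := dom_chart_at A x; have bx := dom_chart_at A (h x).
set a := chart_at A x in ax; set b := chart_at A (h x) in bx.
have N1 := gram_normlike ix; have N2 := gram_normlike jx.
have Na := tnorm_normlike x; have Nb := tnorm_normlike (h x).
have E : dmap h a b x *m dmap id b j (h x) = dmap id a i x *m dmap h i j x.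
  have E1 : dmap h a j x = dmap h a b x *m dmap id b j (h x) := dmap_comp Ch C1 ax bx jx.
  have E2 : dmap h a j x = dmap id a i x *m dmap h i j x := dmap_comp C1 Ch ax ix jx.
  exact: (etrans (esym E1) E2).
have DE : Dmx A h x = dmap h a b x := DmxE h x.
have tx v := tnormE v ix; have ty v := tnormE v jx.
rewrite -/a in tx; rewrite -/b in ty.
rewrite opmap_opn DE; apply/eqP; rewrite eq_le; apply/andP; split.
  apply: (opn_le Na Nb); first exact: (opn_ge0 _ N1 N2).
  move=> v; rewrite tx ty -mulmxA E mulmxA.
  exact: (opn_ub _ _ N1 N2).
apply: (opn_le N1 N2); first exact: (opn_ge0 _ Na Nb).
move=> v; have := opn_ub (dmap h a b x) (v *m dmap id i a x) Na Nb.
have E3 : v *m dmap id i a x *m dmap id a i x = v.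
  by rewrite -mulmxA (dmap_id_inv ix ax) mulmx1.
have E4 : v *m dmap id i a x *m dmap h a b x *m dmap id b j (h x) = v *m dmap h i j x.
  rewrite -(mulmxA (v *m dmap id i a x)). rewrite E. rewrite (mulmxA (v *m dmap id i a x)). rewrite E3. reflexivity.
by rewrite tx ty E3 E4.
Qed.

Lemma opmap_ub h x v : tnorm g (h x) (v *m Dmx A h x) <= opmap h x * tnorm g x v.
Proof. by rewrite opmap_opn; apply: opn_ub; exact: tnorm_normlike. Qed.

Lemma opmap_le h x s : 0 <= s ->
  (forall v, tnorm g (h x) (v *m Dmx A h x) <= s * tnorm g x v) -> opmap h x <= s.
Proof. by move=> s0 H; rewrite opmap_opn; apply: opn_le => //; exact: tnorm_normlike. Qed.

Lemma opmap_ge0 h x : 0 <= opmap h x.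
Proof. by rewrite opmap_opn; apply: opn_ge0; exact: tnorm_normlike. Qed.

Lemma Dmx_comp h1 h2 x : C1_map A h1 -> C1_map A h2 ->
  Dmx A (h2 \o h1) x = Dmx A h1 x *m Dmx A h2 (h1 x).
Proof. by move=> C1 C2; rewrite !DmxE; apply: dmap_comp => //; exact: dom_chart_at. Qed.

Lemma opmap_comp h1 h2 x : C1_map A h1 -> C1_map A h2 ->
  opmap (h2 \o h1) x <= opmap h1 x * opmap h2 (h1 x).
Proof.
move=> C1 C2; apply: opmap_le; first by rewrite mulr_ge0// opmap_ge0.
move=> v; rewrite (Dmx_comp x C1 C2) mulmxA.
apply: (le_trans (opmap_ub h2 (h1 x) (v *m Dmx A h1 x))).
rewrite (mulrC (opmap h1 x)) -mulrA.
exact: (ler_wpM2l (opmap_ge0 h2 (h1 x)) (opmap_ub h1 x v)).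
Qed.

Lemma opmap_continuous h : C1_map A h -> continuous (opmap h).
Proof.
move=> Ch x; have ix := dom_chart_at A x; have jx := dom_chart_at A (h x).
set i := chart_at A x in ix; set j := chart_at A (h x) in jx.
have ni : \forall y \near x, dom i y by apply: open_nbhs_nbhs; split=> //; exact: dom_open.
have ch : {for x, continuous h} by exact: C1_map_continuous Ch.
have nj : \forall y \near x, dom j (h y) by exact: near_dom_preimage.
(* Freeze the charts chosen at [x] and at [h x]. *)
apply: (@near_eq_continuous _ _
    (fun y => opn (qnorm (gram g i y)) (qnorm (gram g j (h y))) (dmap h i j y))).
  near=> y; rewrite (opmapE (i := i) (j := j))//; near: y => //.
apply: (@cvg_opn _ _ _ (nbhs x)).
- by apply: filterS ni => y; exact: gram_posdef.
- by apply: filterS nj => y; exact: gram_posdef.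
- exact: gram_posdef.
- exact: gram_posdef.
- exact: gram_continuous.
- by apply: (@continuous_comp _ _ _ h (gram g j)) => //; exact: gram_continuous.
- exact: dmap_continuous.
Unshelve. all: by end_near. Qed.

Lemma speedE i c t : C1_curve A c -> dom i (c t) ->
  speed g c t = qnorm (gram g i (c t)) (cvel i c t).
Proof.
move=> Cc it; have at_ := dom_chart_at A (c t).
rewrite /speed (tnormE _ it) -/(cvel (chart_at A (c t)) c t).
by rewrite -(cvel_map (@C1_map_id _ _ _ A) Cc at_ it).
Qed.

Lemma speed_continuous c : C1_curve A c -> continuous (speed g c).
Proof.
move=> Cc t; have it := dom_chart_at A (c t); set i := chart_at A (c t) in it.
apply: (@near_eq_continuous _ _ (fun s => qnorm (gram g i (c s)) (cvel i c s))).
  by apply: filterS (near_dom_curve Cc it) => s is_; rewrite (speedE Cc is_).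
apply: (@cvg_qnorm _ _ _ (nbhs t)); last exact: cvel_continuous.
apply: (@continuous_comp _ _ _ c (gram g i)); last exact: gram_continuous.
by case: Cc => cc _; exact: cc.
Qed.

Lemma speed_ge0 c t : 0 <= speed g c t.
Proof. exact: normlike_ge0 (tnorm_normlike _). Qed.

Lemma speed_map h c t : C1_map A h -> C1_curve A c ->
  speed g (h \o c) t <= opmap h (c t) * speed g c t.
Proof.
move=> Ch Cc; have it := dom_chart_at A (c t); have jt := dom_chart_at A (h (c t)).
rewrite (speedE (C1_curve_map Ch Cc) jt) (speedE Cc it) (cvel_map Ch Cc it jt).
by have := opmap_ub h (c t) (cvel (chart_at A (c t)) c t); rewrite DmxE.
Qed.

End Metric.

Section Length.
Context {R : realType} {d : nat} {M : topologicalType} {A : smooth_atlas R d M}.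
Context (g : riemannian A).
Implicit Types (i j : chart A) (x : M) (h : M -> M) (c : R -> M).

Lemma speed_integrable c (s : R) : C1_curve A c ->
  lebesgue_measure.-integrable `[0, s]%classic (EFin \o speed g c).
Proof.
move=> Cc; apply: continuous_compact_integrable; first exact: segment_compact.
by apply: continuous_subspaceT; exact: speed_continuous.
Qed.

Lemma speed_integrableZ c (s a : R) : C1_curve A c ->
  lebesgue_measure.-integrable `[0, s]%classic (EFin \o (fun t => a * speed g c t)).
Proof.
move=> Cc; have := integrableZl _ (a : R) (speed_integrable s Cc).
by move=> /(_ (measurable_itv _)); apply: eq_integrable => // t _ /=; rewrite EFinM.
Qed.

Lemma curve_length_ge0 c : 0 <= curve_length g c.
Proof. by apply: Rintegral_ge0 => t _; exact: speed_ge0. Qed.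

Lemma curve_length_map h c (lam : R) : C1_map A h -> C1_curve A c ->
  (forall t, 0 <= t <= 1 -> opmap g h (c t) <= lam) ->
  curve_length g (h \o c) <= lam * curve_length g c.
Proof.
move=> Ch Cc Hlam; rewrite /curve_length -RintegralZl//; last exact: speed_integrable.
apply: le_Rintegral => //.
- by apply: speed_integrable; exact: C1_curve_map.
- exact: speed_integrableZ.
- move=> t; rewrite /= in_itv/= => t01; apply: le_trans (speed_map g t Ch Cc) _.
  by rewrite ler_wpM2r ?speed_ge0// Hlam.
Qed.

Lemma Rintegral_speed_le c (s : R) : C1_curve A c -> 0 <= s <= 1 ->
  Rintegral lebesgue_measure `[0, s] (speed g c) <= curve_length g c.
Proof.
move=> Cc /andP[s0 s1]; rewrite /curve_length /Rintegral fine_le//.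
- by apply: integrable_fin_num => //; exact: speed_integrable.
- by apply: integrable_fin_num => //; exact: speed_integrable.
apply: ge0_subset_integral => //.
- have /integrableP[] := speed_integrable 1 Cc; by [].
- by move=> t _; rewrite lee_fin speed_ge0.
- by apply: subset_itvl; rewrite bnd_simp.
Qed.

Lemma row_norm_le (v : 'rV[R]_d) (r : R) : 0 <= r -> (forall k, `|v 0 k| <= r) -> `|v| <= r.
Proof.
move=> r0 H; rewrite [leLHS]/Num.norm/= mx_normrE (bigmax_le _ r0)// => -[a b] _ /=.
by rewrite (ord1 a).
Qed.

(** The norm on row vectors is the sup norm, so it suffices to integrate each coordinate of the
    velocity. The time [s] is free because the lemma is applied before the curve is known to stay in
    the chart up to time 1. *)
Lemma curve_displacement c i (C s : R) : C1_curve A c -> 0 <= C -> 0 <= s <= 1 ->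
  (forall t : R, 0 <= t <= s -> dom i (c t) /\
     forall v : 'rV[R]_d, `|v| <= C * qnorm (gram g i (c t)) v) ->
  `|lcoord i (c s) - lcoord i (c 0)| <= C * curve_length g c.
Proof.
move=> Cc C0 s01 HC; have /andP[s0 s1] := s01.
have [->|sn0] := eqVneq s 0.
  by rewrite subrr normr0 mulr_ge0// curve_length_ge0.
have sp : 0 < s by rewrite lt_neqAle eq_sym sn0.
apply: row_norm_le => [|k]; first by rewrite mulr_ge0// curve_length_ge0.
pose F (t : R) : R := lcoord i (c t) 0 k.
pose f (t : R) : R := cvel i c t 0 k.
have Fd (t : R) : 0 <= t <= s -> derivable F t 1 /\ derive1 F t = f t.
  move=> ts; have [it _] := HC t ts.
  have dl : derivable (lcoord i \o c) t 1.
    exact/diff_derivable/C1_curve_diff.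
  split; first by have /derivable_mxP/(_ 0 k) := dl.
  by rewrite derive1E /f /cvel derive_mx// mxE.
have Fc (t : R) : 0 <= t <= s -> {for t, continuous F}.
  by move=> /Fd[+ _] => /derivable1_diffP/differentiable_continuous.
have fc : {within `[0, s], continuous f}.
  apply: continuous_in_subspaceT => t; rewrite inE/= in_itv/= => ts.
  have [it _] := HC t ts; apply: (@cvg_coord _ _ (nbhs t)); exact: cvel_continuous.
have fint : lebesgue_measure.-integrable `[0, s]%classic (EFin \o f).
  by apply: continuous_compact_integrable => //; exact: segment_compact.
have FLR : derivable_oo_LRcontinuous F 0 s.
  split.
  - by move=> t; rewrite in_itv/= => /andP[/ltW t0 /ltW ts]; have [] := Fd t; rewrite ?t0.
  - by apply: cvg_at_right_filter; apply: Fc; rewrite lexx.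
  - by apply: cvg_at_left_filter; apply: Fc; rewrite s0 lexx.
have := continuous_FTC2 sp fc FLR.
have /[swap]/[apply] : {in `]0, s[, derive1 F =1 f}.
  by move=> t; rewrite in_itv/= => /andP[/ltW t0 /ltW ts]; have [] := Fd t; rewrite ?t0.
move=> FTC.
have {}FTC : Rintegral lebesgue_measure `[0, s] f = F s - F 0 by rewrite /Rintegral FTC.
rewrite !mxE -[X in `|X|]/(F s - F 0) -FTC.
apply: le_trans (le_normr_Rintegral _ _) _ => //.
apply: le_trans (_ : C * Rintegral lebesgue_measure `[0, s] (speed g c) <= _).
  rewrite -RintegralZl//; last exact: speed_integrable.
  apply: le_Rintegral => //.
  - exact: (integrable_norm fint).
  - exact: speed_integrableZ.
  - move=> t; rewrite /= in_itv/= => ts; have [it Hit] := HC t ts.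
    apply: le_trans (coord_le_norm _ _) _; apply: le_trans (Hit _) _.
    by rewrite -(speedE g Cc it).
by rewrite ler_wpM2l// Rintegral_speed_le.
Qed.

(** On such a closed coordinate ball, lengths of curves and coordinate distances bound each other up
    to [C]. *)
Definition good_ball i z (r C : R) := [/\ dom i z, 0 < r, 0 < C &
  forall p, `|p - lcoord i z| <= r -> (lcoord i @` dom i) p /\
    forall v : 'rV[R]_d, `|v| <= C * qnorm (gram g i (para i p)) v /\
                         qnorm (gram g i (para i p)) v <= C * `|v|].

Lemma good_ball_shrink i z (r r' C : R) : 0 < r' <= r -> good_ball i z r C -> good_ball i z r' C.
Proof. by move=> /andP[r0 rr] [iz r0' C0 H]; split=> // p pr; apply: H; exact: le_trans rr. Qed.

Lemma near_good_ball i z (U : set M) : dom i z -> nbhs z U ->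
  exists r C, good_ball i z r C /\
    forall p, `|p - lcoord i z| <= r -> U (para i p).
Proof.
move=> iz Uz.
(* The standard Euclidean norm is a fixed reference: the operator norms of the identity to and from
   it vary continuously by [cvg_opn]. *)
have p1 : posdef (1%:M : 'M[R]_d).
  split=> [|v v0]; first exact: trmx1.
  rewrite mulmx1 mxE lt_neqAle eq_sym; under eq_bigr do rewrite mxE -expr2.
  rewrite sumr_ge0 ?andbT; last by move=> k _; exact: sqr_ge0.
  apply: contra v0; rewrite psumr_eq0; last by move=> k _; exact: sqr_ge0.
  move=> /allP H; apply/eqP/rowP => k; rewrite mxE; apply/eqP.
  by have := H k; rewrite mem_index_enum sqrf_eq0; apply.
have N1 := posdef_normlike p1.
have [a a0 Ha] := normlike_le_norm N1; have [b b0 Hb] := norm_le_normlike N1.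
have Nz : \forall y \near z, dom i y by apply: open_nbhs_nbhs; split=> //; exact: dom_open.
have Pz : \forall y \near z, posdef (gram g i y) by apply: filterS Nz => y; exact: gram_posdef.
have c1 : (fun y => opn (qnorm 1%:M) (qnorm (gram g i y)) 1%:M) @ z -->
    opn (qnorm 1%:M) (qnorm (gram g i z)) 1%:M.
  apply: (@cvg_opn _ _ _ (nbhs z)) => //; do ?exact: cvg_cst.
  - exact: nearW.
  - exact: gram_posdef.
  - exact: gram_continuous.
have c2 : (fun y => opn (qnorm (gram g i y)) (qnorm 1%:M) 1%:M) @ z -->
    opn (qnorm (gram g i z)) (qnorm 1%:M) 1%:M.
  apply: (@cvg_opn _ _ _ (nbhs z)) => //; do ?exact: cvg_cst.
  - exact: nearW.
  - exact: gram_posdef.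
  - exact: gram_continuous.
set o1 := opn (qnorm 1%:M) (qnorm (gram g i z)) 1%:M in c1.
set o2 := opn (qnorm (gram g i z)) (qnorm 1%:M) 1%:M in c2.
have o10 : 0 <= o1 by apply: opn_ge0 => //; exact: gram_normlike.
have o20 : 0 <= o2 by apply: opn_ge0 => //; exact: gram_normlike.
pose C := (o1 + 1) * a + (o2 + 1) * b.
have C0 : 0 < C by rewrite addr_gt0// mulr_gt0// ltr_wpDl.
have good : \forall y \near z, U y /\ forall v : 'rV[R]_d,
    `|v| <= C * qnorm (gram g i y) v /\ qnorm (gram g i y) v <= C * `|v|.
  near=> y; split; first by near: y.
  have Ny : normlike (qnorm (gram g i y)) by apply: posdef_normlike; near: y.
  have Hc1 : opn (qnorm 1%:M) (qnorm (gram g i y)) 1%:M <= o1 + 1.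
    by near: y; apply: (cvgr_le _ c1); rewrite ltrDl.
  have Hc2 : opn (qnorm (gram g i y)) (qnorm 1%:M) 1%:M <= o2 + 1.
    by near: y; apply: (cvgr_le _ c2); rewrite ltrDl.
  move=> v; have := opn_ub 1%:M v N1 Ny; have := opn_ub 1%:M v Ny N1.
  rewrite !mulmx1 => Hv2 Hv1; split.
    apply: le_trans (Hb v) _; apply: (@le_trans _ _ (b * ((o2 + 1) * qnorm (gram g i y) v))).
      rewrite ler_wpM2l ?(ltW b0)// (le_trans Hv2)// ler_wpM2r// normlike_ge0//.
    rewrite mulrA ler_wpM2r ?normlike_ge0// mulrC /C lerDr mulr_ge0 ?(ltW a0)// addr_ge0//.
  apply: le_trans Hv1 _; apply: (@le_trans _ _ ((o1 + 1) * (a * `|v|))).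
    by rewrite ler_pM ?opn_ge0 ?normlike_ge0.
  rewrite mulrA ler_wpM2r// /C lerDl mulr_ge0 ?(ltW b0)// addr_ge0//.
have := near_chart iz good => /nbhs_ballP[r r0 Hr].
exists (r / 2), C; split.
  split=> //; first by rewrite divr_gt0.
  move=> p pr; have [|y [-> -> iy [_ Hy]]] := Hr p.
    by rewrite -ball_normE /= distrC (le_lt_trans pr)// ltr_pdivrMr// ltr_pMr// ltr1n.
  by split => //; exists y.
move=> p pr; have [|y [_ -> _ [Uy _]]] := Hr p => //.
by rewrite -ball_normE /= distrC (le_lt_trans pr)// ltr_pdivrMr// ltr_pMr// ltr1n.
Unshelve. all: by end_near. Qed.

End Length.

(** * Short curves in chart balls and uniform continuity along them *)

Section ShortCurves.
Context {R : realType} {d : nat} {M : topologicalType} {A : smooth_atlas R d M}.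
Context (g : riemannian A) (hM : hausdorff_space M).
Implicit Types (i j : chart A) (x : M) (h : M -> M) (c : R -> M).

Lemma closed_chart_ball i z (r r' C : R) : good_ball g i z r C -> r' <= r ->
  closed (para i @` [set p | `|p - lcoord i z| <= r']).
Proof.
move=> [iz r0 C0 H] rr; apply: compact_closed => //; apply: continuous_compact.
  apply: continuous_in_subspaceT => p; rewrite inE/= => /le_trans/(_ rr)/H[[y iy <-] _].
  exact: para_continuous_at.
apply: bounded_closed_compact.
  exists (r' + `|lcoord i z|); split; first exact: num_real.
  move=> s rs p /= pr; apply: ltW.
  by apply: le_lt_trans rs; rewrite -lerBlDr (le_trans (lerB_dist _ _)).
have cn : continuous (fun p : 'rV[R]_d => `|p - lcoord i z|).
  move=> p; apply: (@cvg_norm _ _ _ (nbhs p)).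
  by apply: (@cvgB _ _ _ (nbhs p)); [exact: cvg_id|exact: cvg_cst].
by apply: (@preimage_closed _ _ _ [set s : R | s <= r']) => [p _|]; [exact: cn|exact: closed_le].
Qed.

(** Continuity argument on the largest time before leaving the ball: up to then the displacement is
    at most [C] times the length, which keeps the curve strictly inside, so it cannot leave. *)
Lemma short_curve_stays c i z (r r0 C : R) : good_ball g i z r C -> C1_curve A c ->
  dom i (c 0) -> `|lcoord i (c 0) - lcoord i z| <= r0 ->
  r0 + C * curve_length g c < r ->
  forall t, 0 <= t <= 1 ->
    dom i (c t) /\ `|lcoord i (c t) - lcoord i (c 0)| <= C * curve_length g c.
Proof.
move=> gb Cc ic0 c0r0 lt; have [iz rp Cp H] := gb.
set l := C * _ in lt *.
have l0 : 0 <= l by rewrite mulr_ge0 ?curve_length_ge0// ltW.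
have r00 : 0 <= r0 by apply: le_trans c0r0.
pose Q y := dom i y /\ `|lcoord i y - lcoord i z| < r.
pose S := [set s : R | 0 <= s <= 1 /\ forall t, 0 <= t <= s -> Q (c t)].
have disp s : S s -> `|lcoord i (c s) - lcoord i (c 0)| <= l.
  move=> [s01 HQ]; apply: (@curve_displacement _ _ _ _ g c i C s) => //; first exact: ltW.
  move=> t /HQ[it tr]; split=> // v.
  by have [_ /(_ v)[]] := H (lcoord i (c t)) (ltW tr); rewrite (lcoordK it).
have Sle s t : S s -> 0 <= t <= s -> S t.
  move=> [/andP[s0 s1] HQ] /andP[t0 ts]; split; first by rewrite t0 (le_trans ts).
  by move=> u /andP[u0 ut]; apply: HQ; rewrite u0 (le_trans ut).
have S0 : S 0.
  split; first by rewrite lexx ler01.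
  move=> t; rewrite -eq_le => /eqP <-; split=> //.
  by apply: le_lt_trans c0r0 _; apply: le_lt_trans lt; rewrite lerDl.
have ubS : ubound S 1 by move=> s [/andP[]].
have supS : has_sup S by split; [exists 0|exists 1].
set s := sup S.
have s0 : 0 <= s by exact: sup_upper_bound.
have s1 : s <= 1 by apply: ge_sup => //; exists 0.
have inK t : S t -> `|lcoord i (c t) - lcoord i z| <= r0 + l.
  move=> St; rewrite -(subrK (lcoord i (c 0)) (lcoord i (c t))) -addrA.
  by apply: le_trans (ler_normD _ _) _; rewrite [leRHS]addrC lerD// disp.
(* The limit point lies in the closed ball of radius [r0 + l], smaller than [r]; Hausdorffness makes
   its image in [M] closed. *)
have Qs : Q (c s).
  have [s00|sn0] := eqVneq s 0; first by rewrite s00; case: S0 => _; apply; rewrite lexx.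
  have sp : 0 < s by rewrite lt_neqAle eq_sym sn0.
  have ltS t : 0 <= t -> t < s -> S t.
    move=> t0 ts; have st0 : 0 < s - t by rewrite subr_gt0.
    have [u Su] := sup_adherent st0 supS; rewrite subKr => tu.
    by apply: Sle Su _; rewrite t0 ltW.
  have := @closed_cvg _ _ (s^'-) _ c (para i @` [set p | `|p - lcoord i z| <= r0 + l])
    (closed_chart_ball gb (ltW lt)).
  have near_left : \forall t \near s^'-, (para i @` [set p | `|p - lcoord i z| <= r0 + l]) (c t).
    near=> t.
    have St : S t.
      apply: ltS; near: t; last exact: nbhs_left_lt.
      by apply: filterS (nbhs_left_gt sp) => u /ltW.
    have [it _] : Q (c t) by case: (St) => _; apply; rewrite lexx andbT; case: St => /andP[].
    by exists (lcoord i (c t)); [exact: inK|exact: lcoordK].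
  move=> /(_ _ near_left (c s)) [].
    by apply: cvg_at_left_filter; case: Cc => cc _; exact: cc.
  move=> p /= pr <-; have [[y iy yp] _] := H p (le_trans pr (ltW lt)).
  by rewrite -yp (lcoordK iy); split=> //; rewrite yp (le_lt_trans pr).
have Ss : S s.
  split; first by rewrite s0 s1.
  move=> t /andP[t0]; rewrite le_eqVlt => /orP[/eqP -> //|ts].
  have st0 : 0 < s - t by rewrite subr_gt0.
  have [u Su] := sup_adherent st0 supS; rewrite subKr => tu.
  by case: Su => _; apply; rewrite t0 ltW.
(* The condition [Q] is open, so the stay could be prolonged beyond [s]. *)
have s_1 : s = 1.
  apply/eqP; rewrite eq_le s1 leNgt; apply/negP => slt1.
  have nearQ : \forall t \near s, Q (c t).
    have [is_ sr] := Qs.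
    apply: filterI; first exact: near_dom_curve.
    have cl : {for s, continuous (fun t => `|lcoord i (c t) - lcoord i z|)}.
      apply: (@cvg_norm _ _ _ (nbhs s)); apply: (@cvgB _ _ _ (nbhs s)); last exact: cvg_cst.
      apply: (@continuous_comp _ _ _ c (lcoord i)); last exact: lcoord_continuous_at.
      by case: Cc => cc _; exact: cc.
    by apply: (cvgr_lt _ cl).
  move/nbhs_ballP : nearQ => [e e0 He].
  pose u := Num.min (s + e / 2) 1.
  have su : s < u by rewrite lt_min slt1 andbT ltrDl divr_gt0.
  suff : S u by move=> /(sup_upper_bound supS); rewrite leNgt su.
  split; first by rewrite (le_trans s0 (ltW su)) ge_min lexx orbT.
  move=> t /andP[t0 tu]; have [ts|st] := leP t s; first by case: Ss => _; apply; rewrite t0.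
  apply: He; rewrite /ball /= ltr0_norm ?subr_lt0// opprB ltrBlDl.
  apply: le_lt_trans tu _; rewrite gt_min; apply/orP; left.
  by rewrite ltrD2l ltr_pdivrMr// ltr_pMr// ltr1n.
rewrite s_1 in Ss => t t01; have St := Sle _ _ Ss t01.
by split; [case: Ss => _ /(_ _ t01)[]|exact: disp].
Unshelve. all: by end_near. Qed.

Lemma chart_curve i (p : R -> 'rV[R]_d) : (forall t, differentiable p t) ->
  (forall v, continuous (fun t => 'd p t v)) -> (forall t, (lcoord i @` dom i) (p t)) ->
  C1_curve A (para i \o p) /\ forall t, cvel i (para i \o p) t = 'D_1 p t.
Proof.
move=> dp cp ip.
have C1 := @C1_map_id _ _ _ A.
have cpara t : {for t, continuous (para i \o p)}.
  apply: (@continuous_comp _ _ _ p (para i)); first exact: differentiable_continuous.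
  by have [y iy <-] := ip t; exact: para_continuous_at.
have D j t : dom j (para i (p t)) -> differentiable (lcoord j \o (para i \o p)) t /\
    forall v, 'd (lcoord j \o (para i \o p)) t v = 'd p t v *m dmap id i j (para i (p t)).
  move=> jt; have [y iy yp] := ip t.
  have yE : para i (p t) = y by rewrite -yp (lcoordK iy).
  have jy : dom j (id y) by rewrite -yE.
  pose F := lcoord j \o id \o para i.
  have dF : differentiable F (p t) by rewrite -yp; exact: (C1_map_differentiable C1 iy jy).
  split; first exact: (differentiable_comp (dp t) dF).
  move=> v; have := congr1 (fun u => u v) (diff_comp (dp t) dF) => E1.
  rewrite yE dmapE yp; apply: (etrans E1).
  by have E := mul_jacobian F (p t) ('d p t v); exact: (esym E).
split; last first.
  move=> t; rewrite /cvel (_ : lcoord i \o (para i \o p) = p)//.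
  by apply/funext => s /=; have [y iy <-] := ip s; rewrite (lcoordK iy).
split; first exact: cpara.
move=> j; split=> [t jt|v t jt]; first by have [dj _] := D j t jt; exact: dj.
apply: (@near_eq_continuous _ _ (fun s => 'd p s v *m dmap id i j (para i (p s)))).
  have nj : \forall s \near t, dom j (para i (p s)).
    by apply: (cpara t); apply: open_nbhs_nbhs; split => //; exact: dom_open.
  by apply: filterS nj => s js; have [_ E] := D j s js; exact: (esym (E v)).
apply: (@cvg_mulmx _ _ (nbhs t)); first exact: cp.
apply: (@continuous_comp _ _ _ (para i \o p) (dmap id i j)); first exact: cpara.
have [y iy yp] := ip t.
by apply: dmap_continuous; rewrite //= -yp (lcoordK iy).
Qed.

(** A curve must be C^1 on the whole line and the segment must stay in its ball at all times: [ramp]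
    is smooth, never leaves the unit interval and takes 0 to 0 and 1 to 1. Its slope is at most 2,
    whence the 2 in [segment_curve]. *)
Definition ramp (t : R) : R := (1 - cos (pi * t)) / 2.

Lemma is_derive_ramp (t : R) : is_derive t 1 ramp (pi / 2 * sin (pi * t)).
Proof.
rewrite /ramp; apply: is_derive_eq.
by rewrite /GRing.scale/=; lra.
Qed.

Lemma ramp_slope_le (t : R) : `|pi / 2 * sin (pi * t)| <= 2.
Proof.
have [/andP[pi0 pi2] _] := pihalf_02_cos_pihalf R.
rewrite normrM (ger0_norm pi0) -[leRHS]mulr1 ler_pM//.
by rewrite ler_norml sin_le1 sin_geN1.
Qed.

Lemma ramp_range t : 0 <= ramp t <= 1.
Proof. by have := cos_le1 (pi * t); have := cos_geN1 (pi * t); rewrite /ramp; lra. Qed.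

Lemma ramp0 : ramp 0 = 0.
Proof. by rewrite /ramp mulr0 cos0 subrr mul0r. Qed.

Lemma ramp1 : ramp 1 = 1.
Proof. by rewrite /ramp mulr1 cospi; lra. Qed.

Lemma segment_curve i z (r C : R) p0 p1 : good_ball g i z r C ->
  `|p0 - lcoord i z| <= r -> `|p1 - lcoord i z| <= r ->
  exists c, [/\ C1_curve A c, c 0 = para i p0, c 1 = para i p1,
    forall t, exists2 p, `|p - lcoord i z| <= r & c t = para i p &
    curve_length g c <= 2 * C * `|p1 - p0|].
Proof.
move=> gb p0r p1r; have [iz r0 C0 H] := gb.
pose w := p1 - p0; pose p t := p0 + ramp t *: w.
have pr t : `|p t - lcoord i z| <= r.
  have -> : p t - lcoord i z = (1 - ramp t) *: (p0 - lcoord i z) + ramp t *: (p1 - lcoord i z).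
    rewrite /p /w; move: (ramp t) (lcoord i z) => a q.
    by apply/rowP => k; rewrite !mxE; ring.
  have /andP[a0 a1] := ramp_range t.
  apply: le_trans (ler_normD _ _) _; rewrite !normrZ !ger0_norm ?subr_ge0//.
  have -> : r = (1 - ramp t) * r + ramp t * r by ring.
  by rewrite lerD// ler_wpM2l// subr_ge0.
have pd t : derivable p t 1 /\ 'D_1 p t = (pi / 2 * sin (pi * t)) *: w.
  have pk k : is_derive t 1 (fun s => p s 0 k) (pi / 2 * sin (pi * t) * w 0 k).
    rewrite (_ : (fun s => p s 0 k) = (fun s => p0 0 k + ramp s * w 0 k)); last first.
      by apply/funext => s; rewrite /p !mxE.
    have := is_derive_ramp t => ?; apply: is_derive_eq.
    by rewrite /GRing.scale/=; ring.
  have dp : derivable p t 1.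
    by apply/derivable_mxP => a k; rewrite (ord1 a); case: (pk k).
  split=> //; rewrite derive_mx//; apply/rowP => k; rewrite [LHS]mxE [RHS]mxE.
  by have [_ E] := pk k.
have pdiff t : differentiable p t by apply/derivable1_diffP; case: (pd t).
have pdE t v : 'd p t v = (v * (pi / 2 * sin (pi * t))) *: w.
  have E := congr1 (fun u => u v) (diff1E (pdiff t)); apply: (etrans E) => /=.
  by rewrite derive1E; case: (pd t) => _ ->; rewrite scalerA.
have [||Cc cv] := @chart_curve i p pdiff.
- move=> v t; rewrite (_ : (fun _ => _) = (fun s => (v * (pi / 2 * sin (pi * s))) *: w)); last first.
    by apply/funext => s; exact: pdE.
  apply: (@cvgZr_tmp _ _ _ (nbhs t)).
  apply: (@cvgM _ _ (nbhs t)); first exact: cvg_cst.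
  apply: (@cvgM _ _ (nbhs t)); first exact: cvg_cst.
  apply: (@continuous_comp _ _ _ (fun s : R => pi * s) sin); last exact: continuous_sin.
  by apply: (@cvgM _ _ (nbhs t)); [exact: cvg_cst|exact: cvg_id].
- by move=> t; case: (H (p t) (pr t)).
exists (para i \o p); split=> //.
- by rewrite /= /p ramp0 scale0r addr0.
- by rewrite /= /p ramp1 scale1r /w addrC subrK.
- by move=> t; exists (p t).
rewrite /curve_length.
have -> : 2 * C * `|p1 - p0| = \int[lebesgue_measure]_(t in `[0%R, 1%R]) (2 * C * `|p1 - p0|).
  rewrite Rintegral_cst// -[X in fine X]/(lebesgue_measure _) lebesgue_measure_itv/= lte_fin ltr01.
  by rewrite oppr0 adde0 mulr1.
apply: le_Rintegral => //.
- exact: speed_integrable.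
- apply: continuous_compact_integrable; first exact: segment_compact.
  by apply: continuous_subspaceT => t; exact: cvg_cst.
move=> t _; have [[y iy yp] Hn] := H (p t) (pr t).
have it : dom i ((para i \o p) t) by rewrite /= -yp (lcoordK iy).
have E := speedE g Cc it; rewrite cv in E; rewrite [leLHS]E; case: (pd t) => _ ->.
have [_ Hw] := Hn ((pi / 2 * sin (pi * t)) *: w); apply: le_trans Hw _.
rewrite normrZ -/w mulrA [2 * C]mulrC; apply: (ler_wpM2r (normr_ge0 w)).
exact: (ler_wpM2l (ltW C0) (ramp_slope_le t)).
Qed.

(** Uniform continuity in which closeness of two points is replaced by a short curve joining them.
    Locally a short curve cannot leave a small chart ball; compactness then gives one [rho]. *)
Lemma uniform_along_curves (cM : compact [set: M]) (b : M -> R) (del : R) :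
  continuous b -> 0 < del ->
  exists2 rho, 0 < rho & forall c, C1_curve A c -> curve_length g c < rho ->
    forall t, 0 <= t <= 1 -> `|b (c t) - b (c 0)| < del.
Proof.
move=> cb del0.
pose P (rho : R) (x : M) := forall c, C1_curve A c -> c 0 = x -> curve_length g c < rho ->
    forall t, 0 <= t <= 1 -> `|b (c t) - b (c 0)| < del.
suff : \forall rho \near 0^'+, [set: M] `<=` P rho.
  move=> H; near (0 : R)^'+ => rho; exists rho => // c Cc cl.
  by have : [set: M] `<=` P rho by [near: rho]; move=> /(_ (c 0) I c Cc erefl cl).
move/compact_near_coveringP : cM; apply => z _.
have iz := dom_chart_at A z; set i := chart_at A z in iz.
have Uz : \forall y \near z, `|b y - b z| < del / 2.
  have d2 : 0 < del / 2 by rewrite divr_gt0.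
  by have /cvgrPdist_lt/(_ _ d2) := cb z; apply: filterS => y; rewrite distrC.
have [r [C [gb Ub]]] := near_good_ball g iz Uz; have [_ r0 C0 H] := gb.
have near_z : \forall y \near z, dom i y /\ `|lcoord i y - lcoord i z| < r / 2.
  apply: filterI; first by apply: open_nbhs_nbhs; split => //; exact: dom_open.
  have r2 : 0 < r / 2 by rewrite divr_gt0.
  have /cvgrPdist_lt/(_ _ r2) := @lcoord_continuous_at _ _ _ _ i z iz.
  by apply: filterS => y; rewrite distrC.
have near_rho : \forall rho \near (0 : R)^'+, C * rho < r / 2.
  have : 0 < r / (2 * C) by rewrite divr_gt0// mulr_gt0.
  move=> /nbhs_right_lt; apply: filterS => rho.
  by rewrite ltr_pdivlMr ?mulr_gt0//; lra.
exists ([set y | dom i y /\ `|lcoord i y - lcoord i z| < r / 2], [set rho | C * rho < r / 2]) => //.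
move=> [y rho] [/= [iy yr] Crho] c Cc c0 cl t t01.
have stay : forall t, 0 <= t <= 1 -> `|b (c t) - b z| < del / 2.
  move=> s s01; have ic0 : dom i (c 0) by rewrite c0.
  have Cl : C * curve_length g c < r / 2.
    by apply: le_lt_trans Crho; rewrite ler_wpM2l ?(ltW C0)// ltW.
  have cr : `|lcoord i (c 0) - lcoord i z| <= r / 2 by rewrite c0 ltW.
  have lt : r / 2 + C * curve_length g c < r by lra.
  have [is_ sr] := short_curve_stays gb Cc ic0 cr lt s01.
  rewrite -(lcoordK is_); apply: Ub.
  rewrite -(subrK (lcoord i (c 0)) (lcoord i (c s))) -addrA.
  apply: le_trans (ler_normD _ _) _; apply: ltW; lra.
have h0 : `|b (c 0) - b z| < del / 2 by apply: stay; rewrite lexx ler01.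
have ht := stay t t01; apply: le_lt_trans (ler_distD (b z) _ _) _.
by rewrite (distrC (b z)); lra.
Unshelve. all: by end_near. Qed.

End ShortCurves.

Lemma distr_le_double (R : realType) (V : normedModType R) (u v w : V) (r : R) :
  `|u - w| <= r -> `|v - w| <= r -> `|v - u| <= 2 * r.
Proof. by have := ler_distD w v u; rewrite (distrC w); lra. Qed.

Lemma add_eighth_lt (R : realFieldType) (a b r s : R) :
  a <= 8^-1 * b -> b <= 2 * r -> 2 * r < s -> 0 < r -> r + a < s.
Proof. lra. Qed.

(** * A strongly contracting map that sends a point of a chart ball back near the centre *)

Section Trapping.
Context {R : realType} {d : nat} {M : topologicalType} {A : smooth_atlas R d M}.
Context (g : riemannian A) (hM : hausdorff_space M).
Context (G : M -> M) (i : chart A) (z x : M) (s r C lam : R).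
Hypothesis C1G : C1_map A G.
Hypothesis gb : good_ball g i z s C.
Hypothesis r0 : 0 < r.
(** Two points of the [r]-ball are at distance at most [4 * C * r]. A curve of at most twice that
    length moves by at most [8 * C ^+ 2 * r] in coordinates and must stay in the [s]-ball; [3 * r]
    leaves room for a ball of radius [2 * r] around the fixed point. *)
Hypothesis rs : r * (3 + 8 * C ^+ 2) < s.
Hypothesis G_small : forall p, `|p - lcoord i z| <= s -> opmap g G (para i p) <= lam.
(** It implies both [lam * (16 * C ^+ 2) <= 1], for contraction by [1/8] in coordinates, and
    [lam * 16 <= 1], for contraction of the distance. *)
Hypothesis lam_small : lam * (16 * (1 + C) ^+ 2) <= 1.
Hypothesis lam0 : 0 <= lam.
Hypothesis ix : dom i x.
Hypothesis xr : `|lcoord i x - lcoord i z| <= r.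
Hypothesis iGx : dom i (G x).
Hypothesis Gxr : `|lcoord i (G x) - lcoord i z| <= r / 2.

Let C0 : 0 < C. Proof. by case: gb. Qed.

Let C2 : 0 <= C ^+ 2. Proof. exact: sqr_ge0. Qed.

Let rs3 : 3 * r < s.
Proof.
apply: le_lt_trans rs; rewrite mulrC ler_wpM2l ?(ltW r0)// lerDl mulr_ge0//.
Qed.

Let rs2 : 2 * r < s.
Proof. by apply: lt_trans rs3; rewrite ltr_pM2r// ltr_nat. Qed.

Let rs' : r < s.
Proof. by apply: lt_trans rs2; rewrite ltr_pMl// ltr1n. Qed.

Let lamC : lam * (16 * C ^+ 2) <= 1.
Proof.
apply: le_trans lam_small; rewrite ler_wpM2l// ler_wpM2l//.
by rewrite sqrrD expr1n mul1r addrC lerDl addr_ge0// mulrn_wge0// ltW.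
Qed.

Let lam16 : lam * 16 <= 1.
Proof.
apply: le_trans lam_small; rewrite ler_wpM2l// ler_peMr// exprn_ege1// lerDl ltW//.
Qed.

Let gbr : good_ball g i z r C.
Proof. by apply: good_ball_shrink gb; rewrite r0 ltW. Qed.

Definition chart_repr (p : 'rV[R]_d) := lcoord i (G (para i p)).

(** Knowledge about one endpoint is enough: the image of the segment is a short curve starting in
    the ball, so it stays in the chart. It is used first with [p] the coordinates of [x], and only
    afterwards for arbitrary pairs. *)
Lemma image_of_segment p q : `|p - lcoord i z| <= r -> `|q - lcoord i z| <= r ->
  dom i (G (para i p)) -> `|chart_repr p - lcoord i z| <= r ->
  dom i (G (para i q)) /\ `|chart_repr q - chart_repr p| <= 8^-1 * `|q - p|.
Proof.
move=> pr qr ip Gp.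
have [c [Cc c0 c1 cr cl]] := segment_curve gbr pr qr.
have CGc : C1_curve A (G \o c) := C1_curve_map C1G Cc.
have lGc : curve_length g (G \o c) <= lam * (2 * C * `|q - p|).
  apply: (@le_trans _ _ (lam * curve_length g c)); last by rewrite ler_wpM2l.
  apply: (curve_length_map C1G Cc) => t _; have [p' p'r ->] := cr t.
  by apply: G_small; exact: le_trans p'r (ltW rs').
have lGc' : C * curve_length g (G \o c) <= 8^-1 * `|q - p|.
  apply: (@le_trans _ _ (C * (lam * (2 * C * `|q - p|)))); first by rewrite ler_wpM2l// ltW.
  have -> : C * (lam * (2 * C * `|q - p|)) = (lam * (16 * C ^+ 2)) * (8^-1 * `|q - p|).
    by field.
  by rewrite ler_piMl// mulr_ge0.
have qp : `|q - p| <= 2 * r := distr_le_double pr qr.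
have ic0 : dom i ((G \o c) 0) by rewrite /= c0.
have c0r : `|lcoord i ((G \o c) 0) - lcoord i z| <= r by rewrite /= c0.
have lt : r + C * curve_length g (G \o c) < s.
  exact: add_eighth_lt lGc' qp rs2 r0.
have one : 0 <= (1 : R) <= 1 by rewrite ler01 lexx.
have [i1 H1] := short_curve_stays hM gb CGc ic0 c0r lt one.
move: i1 H1; rewrite /= c0 c1 => i1 H1; split=> //.
exact: le_trans H1 lGc'.
Qed.

Lemma chart_repr_trapped q : `|q - lcoord i z| <= r ->
  dom i (G (para i q)) /\ `|chart_repr q - lcoord i z| < r.
Proof.
move=> qr.
have Gx : chart_repr (lcoord i x) = lcoord i (G x) by rewrite /chart_repr (lcoordK ix).
have iGx' : dom i (G (para i (lcoord i x))) by rewrite (lcoordK ix).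
have Gxr' : `|chart_repr (lcoord i x) - lcoord i z| <= r.
  by rewrite Gx (le_trans Gxr)// ler_pdivrMr// ler_peMr ?ler1n// ltW.
have [iGq H] := image_of_segment xr qr iGx' Gxr'; split=> //.
have qx := distr_le_double xr qr.
apply: le_lt_trans (ler_distD (chart_repr (lcoord i x)) _ _) _.
apply: le_lt_trans (lerD H (_ : _ <= r / 2)) _; first by rewrite Gx.
apply: le_lt_trans (lerD (ler_wpM2l _ qx) (lexx _)) _ => //.
(* A quarter of [r] for the distance to the image of [x], half of [r] for that image itself. *)
have -> : 8^-1 * (2 * r) + r / 2 = (3 / 4) * r by field.
by rewrite gtr_pMl//; lra.
Qed.

Lemma chart_repr_contraction p q : `|p - lcoord i z| <= r -> `|q - lcoord i z| <= r ->
  `|chart_repr q - chart_repr p| <= 8^-1 * `|q - p|.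
Proof.
move=> pr qr; have [ip Gp] := chart_repr_trapped pr.
by have [] := image_of_segment pr qr ip (ltW Gp).
Qed.

(** The displacement attains its minimum on the compact ball, and applying the map divides it by at
    least 8, so the minimum is 0. *)
Lemma chart_repr_fixpoint : exists2 p, `|p - lcoord i z| < r & chart_repr p = p.
Proof.
pose K := [set p : 'rV[R]_d | `|p - lcoord i z| <= r].
have cK : compact K.
  apply: bounded_closed_compact.
    exists (r + `|lcoord i z|); split; first exact: num_real.
    move=> u ru p /= pr; apply: ltW.
    by apply: le_lt_trans ru; rewrite -lerBlDr (le_trans (lerB_dist _ _)).
  have cn : continuous (fun p : 'rV[R]_d => `|p - lcoord i z|).
    move=> p; apply: (@cvg_norm _ _ _ (nbhs p)).
    by apply: (@cvgB _ _ _ (nbhs p)); [exact: cvg_id|exact: cvg_cst].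
  by apply: (@preimage_closed _ _ _ [set u : R | u <= r]) => [p _|]; [exact: cn|exact: closed_le].
have K0 : K !=set0 by exists (lcoord i x).
pose D p := `|chart_repr p - p|.
have Dlip p q : K p -> K q -> `|D p - D q| <= 2 * `|p - q|.
  move=> pr qr; apply: le_trans (ler_dist_dist _ _) _.
  have -> : chart_repr p - p - (chart_repr q - q) = (chart_repr p - chart_repr q) - (p - q).
    by rewrite !opprB (addrC q) (addrC q) addrACA.
  apply: le_trans (ler_normB _ _) _.
  have H := chart_repr_contraction qr pr; have := normr_ge0 (p - q).
  by move: H; move: `|_| `|p - q| => u v; lra.
have cD : {within K, continuous D}.
  apply/subspace_continuousP => p pK; apply/cvgrPdist_lt => e e0.
  have e2 : 0 < e / 2 by rewrite divr_gt0.
  have nb : \forall q \near p, `|p - q| < e / 2.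
    by have := nbhsx_ballx p _ e2; rewrite -ball_normE.
  rewrite near_withinE; apply: filterS nb => q pq qK.
  by apply: le_lt_trans (Dlip _ _ pK qK) _; lra.
have [p] := compact_EVT_min K0 cK cD; rewrite inE => pK minp.
have [iGp Gpr] := chart_repr_trapped pK.
have pp : chart_repr p = p.
  apply/eqP; rewrite -subr_eq0 -normr_eq0 -/(D p).
  have := minp (chart_repr p); rewrite inE => /(_ (ltW Gpr)) Dp.
  have := le_trans Dp (chart_repr_contraction pK (ltW Gpr)); rewrite -/(D p) => H.
  by rewrite eq_le normr_ge0 andbT; move: H; move: (D p) => u; lra.
by exists p => //; rewrite -pp.
Qed.

Let curves (y y' : M) := [set curve_length g c | c in
  [set c | [/\ C1_curve A c, c 0 = y & c 1 = y']]].

Let curves_lb y y' : lbound (curves y y') 0.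
Proof. by move=> _ [c _ <-]; exact: curve_length_ge0. Qed.

Let rdist_le y y' c : C1_curve A c -> c 0 = y -> c 1 = y' -> rdist g y y' <= curve_length g c.
Proof.
move=> Cc c0 c1; apply: ge_inf; first by exists 0; exact: curves_lb.
by exists c.
Qed.

(** Push forward a curve whose length is less than twice the distance. It may leave the [r]-ball but
    not the [s]-ball, where the derivative is bounded by [lam]. *)
Lemma rdist_contraction p q : `|p - lcoord i z| <= r -> `|q - lcoord i z| <= r -> p != q ->
  rdist g (G (para i p)) (G (para i q)) < 2^-1 * rdist g (para i p) (para i q).
Proof.
move=> pr qr pq.
have [_ _ _ H] := gb.
have [ip Ep] : dom i (para i p) /\ lcoord i (para i p) = p.
  by have [[y iy <-] _] := H p (le_trans pr (ltW rs')); rewrite (lcoordK iy).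
have [iq Eq] : dom i (para i q) /\ lcoord i (para i q) = q.
  by have [[y iy <-] _] := H q (le_trans qr (ltW rs')); rewrite (lcoordK iy).
have [c [Cc c0 c1 cr cl]] := segment_curve gbr pr qr.
pose D := rdist g (para i p) (para i q).
have Dle : D <= 2 * C * (2 * r).
  apply: le_trans (rdist_le Cc c0 c1) _; apply: le_trans cl _.
  by rewrite ler_wpM2l ?mulr_ge0 ?(ltW C0)//; exact: distr_le_double pr qr.
have hinf : has_inf (curves (para i p) (para i q)).
  by split; [exists (curve_length g c), c|exists 0; exact: curves_lb].
have qp0 : 0 < `|q - p| by rewrite normr_gt0 subr_eq0 eq_sym.
(* Needed for the strict inequality and to choose the curve: a curve joining the points either has
   length at least [r / C] or stays in the chart and covers the coordinate distance. *)
have D0 : 0 < D.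
  have m0 : 0 < Num.min r `|q - p| / C by rewrite divr_gt0// lt_min r0.
  apply: lt_le_trans m0 _; apply: lb_le_inf; first by case: hinf.
  move=> _ [e [Ce e0 e1] <-]; rewrite ler_pdivrMr// mulrC ge_min.
  have [//|lr] := leP r (C * curve_length g e).
  have ie0 : dom i (e 0) by rewrite e0.
  have er : `|lcoord i (e 0) - lcoord i z| <= r by rewrite e0 Ep.
  have lt : r + C * curve_length g e < s.
    by apply: lt_trans rs2; rewrite mulr_natl mulr2n ltrD2l.
  have one : 0 <= (1 : R) <= 1 by rewrite ler01 lexx.
  have [_ +] := short_curve_stays hM gb Ce ie0 er lt one.
  by rewrite e0 e1 Ep Eq => ->; rewrite orbT.
have [_ [e [Ce e0 e1] <-] eD] := inf_adherent D0 hinf.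
have ie0 : dom i (e 0) by rewrite e0.
have er : `|lcoord i (e 0) - lcoord i z| <= r by rewrite e0 Ep.
have Ce8 : C * curve_length g e <= r * (8 * C ^+ 2).
  apply: (@le_trans _ _ (C * (2 * (2 * C * (2 * r))))); last first.
    by have -> : C * (2 * (2 * C * (2 * r))) = r * (8 * C ^+ 2) by ring.
  apply: (ler_wpM2l (ltW C0)); apply: le_trans (ltW eD) _.
  by rewrite -[inf _]/D mulr_natl mulr2n lerD.
have lt : r + C * curve_length g e < s.
  apply: le_lt_trans rs; rewrite mulrDr lerD// ler_peMr ?ler1n// ltW//.
have eG t : 0 <= t <= 1 -> opmap g G (e t) <= lam.
  move=> t01; have [it Ht] := short_curve_stays hM gb Ce ie0 er lt t01.
  rewrite -(lcoordK it); apply: G_small; apply: le_trans (ltW lt).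
  by apply: le_trans (ler_distD (lcoord i (e 0)) _ _) _; rewrite addrC lerD.
apply: le_lt_trans (rdist_le (C1_curve_map C1G Ce) _ _) _; rewrite /= ?e0 ?e1//.
apply: le_lt_trans (curve_length_map C1G Ce eG) _; rewrite -/D.
have eD2 : curve_length g e <= 2 * D by rewrite mulr_natl mulr2n; exact: ltW eD.
apply: le_lt_trans (ler_wpM2l lam0 eD2) _.
rewrite mulrA ltr_pM2r//; have -> : lam * 2 = (lam * 16) * 8^-1 by field.
by apply: (@le_lt_trans _ _ 8^-1); [rewrite ler_piMl|rewrite ltf_pV2 ?posrE// ltr_nat].
Qed.

End Trapping.

(** * Attracting orbits from contraction on a set of positive measure *)

Section Borel.
Context {M : ptopologicalType} {R : realType}.

Lemma open_borel (U : set M) : open U -> measurable (U : set (borel M)).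
Proof. by move=> oU; exact: sub_gen_smallest. Qed.

Lemma closed_borel (U : set M) : closed U -> measurable (U : set (borel M)).
Proof. by move=> cU; rewrite -[U]setCK; apply: measurableC; apply: open_borel; exact: closed_openC. Qed.

Lemma continuous_borel (f : M -> M) : continuous f ->
  measurable_fun setT (f : borel M -> borel M).
Proof.
move=> cf; apply: (@measurability _ _ (borel M) (borel M) setT (f : borel M -> borel M) (@open M)) => //.
by move=> _ [U oU <-]; rewrite setTI; apply: open_borel; exact: open_comp.
Qed.

Lemma continuous_borel_real (b : M -> R) : continuous b ->
  measurable_fun setT (b : borel M -> R).
Proof.
move=> cb; apply: (measurability _ (RGenOInfty.measurableE R)).
move=> _ [_ [a ->] <-]; rewrite setTI; apply: open_borel.
by apply: open_comp => //; exact: interval_open.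
Qed.

(** If every point had a neighbourhood meeting [H] in a null set, finitely many of them would cover
    [M] and [H] would be null. *)
Lemma support_point (mu : {measure set (borel M) -> \bar R}) (H : set (borel M)) :
  compact [set: M] -> measurable H -> (0 < mu H)%E ->
  exists z : M, forall U : set M, open U -> U z -> (0 < mu (U `&` H))%E.
Proof.
move=> cM mH H0; apply: contrapT => nz.
have Hz (z : M) : exists U : set M, [/\ open U, U z & mu (U `&` H) = 0%E].
  apply: contrapT => nU; apply: nz; exists z => U oU Uz.
  by rewrite lt0e measure_ge0 andbT; apply/negP => /eqP UH; apply: nU; exists U.
have [f Hf] := choice Hz.
move: cM; rewrite compact_cover => /(_ M setT f).
move=> covf.
have [D finD HD] : exists2 D : set M, finite_set D & [set: M] `<=` cover D f.
  case: covf => [z _|x _|D _ HD]; [by case: (Hf z)|by exists x => //; case: (Hf x)|].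
  by eexists; last exact: HD; exact: finite_fset.
suff : (mu H <= 0)%E by rewrite leNgt H0.
have mf z : measurable (f z `&` H : set (borel M)).
  by apply: measurableI => //; apply: open_borel; case: (Hf z).
have := @content_sub_fsum _ _ _ mu M D H (fun z => f z `&` H).
rewrite fsbig1; last by move=> z _; case: (Hf z).
apply => //.
by move=> x Hx; have [z zD fz] := HD x I; exists z.
Qed.

End Borel.

Section OrbitContraction.
Context {R : realType} {d : nat} {M : ptopologicalType} {A : smooth_atlas R d M}.
Context (g : riemannian A) (hM : hausdorff_space M) (cM : compact [set: M]).

Lemma opmap_id_le1 x : opmap g id x <= 1.
Proof.
apply: opmap_le => // v; rewrite mul1r DmxE dmap_id ?mulmx1//.
exact: dom_chart_at.
Qed.

Lemma opmap_iter_sum F n x : C1_map A F -> (forall y, 0 < opmap g F y) ->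
  opmap g (iter n F) x <= expR (\sum_(k < n) ln (opmap g F (iter k F x))).
Proof.
move=> CF pF; elim: n => [|n IH]; first by rewrite big_ord0 expR0; exact: opmap_id_le1.
rewrite big_ord_recr/= expRD lnK ?posrE//.
apply: (le_trans (opmap_comp g x (C1_map_iter n CF) CF)).
exact: (ler_wpM2r (ltW (pF _)) IH).
Qed.

Lemma opmap_bounded h : C1_map A h -> exists2 C, 0 <= C & forall x, opmap g h x <= expR C.
Proof.
move=> Ch; have T0 : [set: M] !=set0 by exists point.
have [x _ Hx] := compact_EVT_max T0 cM (continuous_subspaceT (opmap_continuous (g := g) Ch)).
exists (opmap g h x); first exact: opmap_ge0.
move=> y; have := Hx y; rewrite inE => /(_ I)/le_trans; apply.
by apply: le_trans (expR_ge1Dx _); rewrite lerDr.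
Qed.

Lemma opmap_iter_bounded h C n x : C1_map A h -> (forall x, opmap g h x <= expR C) ->
  opmap g (iter n h) x <= expR (n%:R * C).
Proof.
move=> Ch HC; elim: n => [|n IH]; first by rewrite mul0r expR0; exact: opmap_id_le1.
apply: (le_trans (opmap_comp g x (C1_map_iter n Ch) Ch)).
rewrite -natr1 mulrDl mul1r expRD.
exact: (ler_pM (opmap_ge0 _ _ _) (opmap_ge0 _ _ _) IH (HC _)).
Qed.

Lemma ln_opmap_continuous F : C1_map A F -> (forall y, 0 < opmap g F y) ->
  continuous (fun y => ln (opmap g F y)).
Proof.
move=> CF pF y; apply: (@continuous_comp _ _ _ (opmap g F) (@ln R)).
  exact: opmap_continuous.
exact: continuous_ln.
Qed.

(* Along an orbit that contracts at all times, short curves shrink as well: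
   the loss c'/2 at each step is absorbed by half of the contraction rate. *)
Lemma tracking F x (c' rho : R) (c : R -> M) :
  C1_map A F -> (forall y, 0 < opmap g F y) -> 0 < c' ->
  (forall n, \sum_(k < n) ln (opmap g F (iter k F x)) <= - (n%:R * c')) ->
  (forall e, C1_curve A e -> curve_length g e < rho -> forall t, 0 <= t <= 1 ->
     `|ln (opmap g F (e t)) - ln (opmap g F (e 0))| < c' / 2) ->
  C1_curve A c -> c 0 = x -> curve_length g c < rho ->
  forall n t, 0 <= t <= 1 -> opmap g (iter n F) (c t) <= expR (- (n%:R * (c' / 2))).
Proof.
move=> CF pF c0 Hx Hu Cc cx cl; elim/ltn_ind => n IH t t01.
have close k : (k < n)%N ->
    ln (opmap g F (iter k F (c t))) <= ln (opmap g F (iter k F x)) + c' / 2.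
  move=> kn.
  (* The contraction already known at time [k] keeps the image curve short, so the oscillation bound
     still applies to it. *)
  have len : curve_length g (iter k F \o c) < rho.
    apply: le_lt_trans cl; rewrite -[leRHS]mul1r.
    apply: (curve_length_map (C1_map_iter k CF) Cc) => s s01.
    apply: (le_trans (IH k kn s s01)); rewrite -[leRHS]expR0 ler_expR oppr_le0.
    by rewrite mulr_ge0// divr_ge0// ltW.
  have := Hu _ (C1_curve_map (C1_map_iter k CF) Cc) len t t01.
  by rewrite /= cx ltr_distl => /andP[_ /ltW].
apply: (le_trans (opmap_iter_sum n (c t) CF pF)); rewrite ler_expR.
apply: (@le_trans _ _ (\sum_(k < n) (ln (opmap g F (iter k F x)) + c' / 2))).
  by apply: ler_sum => k _; exact: close.
rewrite big_split/= sumr_const card_ord -mulr_natl.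
by have := Hx n; move: (\sum_(_ < n) _) => S; lra.
Qed.

(** [G] iterated [j] times sends the ball into the ball of radius [8^-1 ^+ j * (2 * r)] around [p].
    By invariance each of these has at least the mass of the original ball, and they shrink to one
    point. *)
Lemma trapped_measure (mu : probability (borel M) R) (G : M -> M) i z x (s r C lam : R) p :
  C1_map A G -> good_ball g i z s C -> 0 < r -> r * (3 + 8 * C ^+ 2) < s ->
  (forall p, `|p - lcoord i z| <= s -> opmap g G (para i p) <= lam) ->
  lam * (16 * (1 + C) ^+ 2) <= 1 -> 0 <= lam -> dom i x -> `|lcoord i x - lcoord i z| <= r ->
  dom i (G x) -> `|lcoord i (G x) - lcoord i z| <= r / 2 ->
  (forall B : set (borel M), measurable B -> mu (G @^-1` B) = mu B) ->
  `|p - lcoord i z| <= r -> chart_repr G i p = p ->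
  (mu (para i @` [set q | (`|q - lcoord i z| <= r)%R]) <= mu [set para i p])%E.
Proof.
move=> CG gb r0 rs Gs lams lam0 ix xr iGx Gxr Ginv pr pp.
have trap := chart_repr_trapped hM CG gb r0 rs Gs lams lam0 ix xr iGx Gxr.
have contr := chart_repr_contraction hM CG gb r0 rs Gs lams lam0 ix xr iGx Gxr.
have [iz s0 C0 H] := gb.
have r3 : 3 * r < s.
  apply: le_lt_trans rs; rewrite mulrC (ler_wpM2l (ltW r0))// lerDl mulr_ge0//.
  exact: sqr_ge0.
have rs' : r < s by apply: lt_trans r3; rewrite ltr_pMl// ltr1n.
have sr0 : 0 < s - r by rewrite subr_gt0.
have [[y iy yp] _] := H p (le_trans pr (ltW rs')).
have pE : para i p = y by rewrite -yp (lcoordK iy).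
have inball q : `|q - p| <= s - r -> `|q - lcoord i z| <= s.
  move=> qp; apply: le_trans (ler_distD p _ _) _.
  by rewrite -[leRHS](subrK r) lerD.
have gbp : good_ball g i y (s - r) C.
  by split=> // q; rewrite yp => /inball/H.
have K_inv q : `|q - lcoord i z| <= r -> forall j,
    exists u, [/\ `|u - lcoord i z| <= r, iter j G (para i q) = para i u &
      `|u - p| <= 8^-1 ^+ j * (2 * r)].
  move=> qr; elim=> [|j [u [ur uE up]]].
    by exists q; split=> //; rewrite expr0 mul1r; exact: distr_le_double pr qr.
  have [iGu Gur] := trap u ur; exists (chart_repr G i u); split.
  - exact: ltW.
  - by rewrite iterS uE /chart_repr (lcoordK iGu).
  - rewrite -[X in _ - X]pp; apply: (le_trans (contr p u pr ur)).
    by rewrite exprS -mulrA ler_wpM2l.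
pose rad j : R := 8^-1 ^+ j * (2 * r).
have rad_le j : rad j <= s - r.
  apply: (@le_trans _ _ (2 * r)).
    rewrite ler_piMl ?mulr_ge0 ?(ltW r0)// exprn_ile1// invf_le1// ler1n//.
  by rewrite lerBrDr; have := r3; rewrite !mulr_natl mulr2n mulrSr mulr2n => /ltW.
pose B j : set (borel M) := para i @` [set q | `|q - p| <= rad j].
have mB j : measurable (B j).
  apply: closed_borel; rewrite /B -yp; exact: (closed_chart_ball hM gbp).
have decr : {homo B : m n / (m <= n)%N >-> (n <= m)%O}.
  move=> m n mn; apply/subsetPset => _ [q /= qn <-]; exists q => //=.
  apply: le_trans qn _; rewrite /rad ler_wpM2r ?mulr_ge0 ?(ltW r0)//.
  by rewrite ler_wiXn2l// invf_le1// ler1n.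
have capB : \bigcap_j B j = [set para i p].
  apply/seteqP; split=> [w Hw|w ->]; last first.
    by move=> j _; exists p => //=; rewrite subrr normr0 mulr_ge0 ?mulr_ge0 ?exprn_ge0 ?invr_ge0 ?(ltW r0).
  have [q0 /= q0r q0w] := Hw 0%N I.
  have [[w0 iw0 w0q] _] := H q0 (inball _ (le_trans q0r (rad_le 0%N))).
  have E0 : w = w0 by rewrite -q0w -w0q (lcoordK iw0).
  suff -> : p = q0 by rewrite -q0w.
  apply/eqP; rewrite eq_sym -subr_eq0 -normr_le0; apply/ler_addgt0Pr => e e0; rewrite add0r.
  have [j Hj] : exists j, rad j <= e.
    have [m Hm] := exists_nat_ge (2 * r) e0.
    exists m; rewrite /rad exprVn ler_pdivrMl ?exprn_gt0//.
    apply: le_trans (Hm m (leqnn _)) _; rewrite ler_wpM2r ?(ltW e0)//.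
    by rewrite -natrX ler_nat ltnW// ltn_expl.
  have [q /= qr qw] := Hw j I.
  have [[w1 iw1 w1q] _] := H q (inball _ (le_trans qr (rad_le j))).
  have E1 : w = w1 by rewrite -qw -w1q (lcoordK iw1).
  by rewrite -w0q -E0 E1 w1q (le_trans qr).
have Kle j : (mu (para i @` [set q | (`|q - lcoord i z| <= r)%R]) <= mu (B j))%E.
  have Gj : mu (iter j G @^-1` B j) = mu (B j).
    apply: (@iter_invariant _ _ _ mu G _ Ginv) => //.
    by apply: continuous_borel; case: CG.
  rewrite -Gj; apply: le_measure; rewrite ?inE.
  - by apply: closed_borel; exact: (closed_chart_ball hM gb (ltW rs')).
  - have mG : measurable_fun setT (G : borel M -> borel M) by apply: continuous_borel; case: CG.
    exact: (measurable_iter_preimage mG).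
  - move=> _ [q /= qr <-]; have [u [ur -> up]] := K_inv q qr j.
    by exists u.
have Bcvg : mu \o B @ \oo --> mu [set para i p].
  rewrite -capB; apply: nonincreasing_cvg_mu => //.
  - by rewrite -ge0_fin_numE// fin_num_measure.
  - exact: bigcap_measurable.
rewrite -(cvg_lim _ Bcvg)//; apply: lime_ge; first exact: cvgP Bcvg.
by apply: nearW => j; exact: Kle.
Qed.

End OrbitContraction.

Lemma iter_iter (T : Type) (f : T -> T) m n x : iter n (iter m f) x = iter (n * m) f x.
Proof. by elim: n => //= n ->; rewrite mulSn iterD. Qed.

Section AttractingAtom.
Context {R : realType} {d : nat} {M : ptopologicalType} {A : smooth_atlas R d M}.
Context (g : riemannian A) (hM : hausdorff_space M) (cM : compact [set: M]).
Context (mu : probability (borel M) R) (h : M -> M).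
Hypothesis Ch : C1_map A h.
Hypothesis hpos : forall n x, 0 < opmap g (iter n h) x.
Hypothesis mu_inv : invariant_measure h mu.

Let mh : measurable_fun setT (h : borel M -> borel M).
Proof. by apply: continuous_borel; case: Ch. Qed.

Let mopmap n : measurable_fun setT (opmap g (iter n h) : borel M -> R).
Proof. by apply: continuous_borel_real; apply: opmap_continuous; exact: C1_map_iter. Qed.

Lemma measurable_opmap_gt n (a : R) : measurable [set x : borel M | a < opmap g (iter n h) x].
Proof.
rewrite -[X in measurable X]setTI.
have := @mopmap n measurableT _ (@measurable_itv R `]a, +oo[).
by congr (measurable (_ `&` _)); apply/seteqP; split => x /=; rewrite in_itv /= andbT.
Qed.

(* The maximal inequality is applied to the visits to the set where h^N
   contracts by less than e^(-Nc), each of which costs at most a fixed factor. *)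
Lemma contracting_points (L : set (borel M)) (c : R) :
  measurable L -> (forall x, L x -> L (h x)) -> (0 < mu L)%E -> 0 < c ->
  (forall eta : R, 0 < eta -> exists N, (0 < N)%N /\
    (mu [set x | L x /\ (expR (- (N%:R * c)) < opmap g (iter N h) x)%R] < eta%:E)%E) ->
  exists N c' (H : set (borel M)), [/\ (0 < N)%N, 0 < c', measurable H, (0 < mu H)%E &
    forall x, H x -> L x /\ forall n,
      \sum_(k < n) ln (opmap g (iter N h) (iter k (iter N h) x)) <= - (n%:R * c')].
Proof.
move=> mL hL L0 c0 small.
have [C C0 HC] := opmap_bounded g cM Ch.
have fL : mu L \is a fin_num by exact: fin_num_measure.
have mL0 : 0 < fine (mu L) by move: L0; rewrite -{1}(fineK fL) lte_fin.
(* A visit to [D] costs at most [N * (C + c)] more than a step at rate [- N * c]; frequency [al]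
   therefore uses up half of the contraction. *)
pose al := c / (2 * (C + c)).
have Cc0 : 0 < C + c by rewrite ltr_wpDl.
have al0 : 0 < al by rewrite divr_gt0// mulr_gt0.
(* With this tolerance the maximal inequality makes the set [bad] smaller than [L]. *)
have [N [N0 HN]] := small _ (mulr_gt0 al0 mL0).
pose F : borel M -> borel M := iter N h.
pose D : set (borel M) := [set x | L x /\ expR (- (N%:R * c)) < opmap g (iter N h) x].
have mD : measurable D by apply: measurableI => //; exact: measurable_opmap_gt.
have mF : measurable_fun setT F by exact: measurable_iter.
have invF B : measurable B -> mu (F @^-1` B) = mu B.
  by move=> mB; exact: (iter_invariant mh).
pose bad : set (borel M) := [set x | exists n, n%:R * al < visits F D n x].
have mbad : measurable bad by exact: measurable_maximal_set.
have maxi := maximal_inequality mF invF mD al0.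
have bad_lt : (mu bad < mu L)%E.
  have : (al%:E * mu bad < al%:E * mu L)%E.
    apply: le_lt_trans maxi _; apply: lt_le_trans HN _.
    by rewrite EFinM (fineK fL).
  by rewrite lte_pmul2l.
pose H := L `\` bad.
have mH : measurable H by exact: measurableD.
have H0 : (0 < mu H)%E.
  rewrite lt0e measure_ge0 andbT; apply/negP => /eqP H00.
  move: bad_lt; apply/negP; rewrite -leNgt.
  apply: (@le_trans _ _ (mu (H `|` bad))).
    apply: le_measure; rewrite ?inE//; first exact: measurableU.
    by move=> x Lx; have [bx|nbx] := pselect (bad x); [right|left].
  have := measureU2 mu mH mbad; set m := (X in (X + _)%E).
  by have -> : m = 0%E by []; rewrite add0e.
exists N, (N%:R * (c / 2)), H; split=> //.
  by rewrite mulr_gt0 ?divr_gt0// ltr0n.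
move=> x [Lx nbad]; split=> // n.
have Liter m : L (iter m h x) by elim: m => //= m; exact: hL.
have vis : visits F D n x <= n%:R * al.
  by rewrite leNgt; apply/negP => Hn; apply: nbad; exists n.
have each k : ln (opmap g (iter N h) (iter k (iter N h) x)) <=
    - (N%:R * c) + N%:R * (C + c) * \1_D (iter k F x).
  set y := iter k (iter N h) x.
  have Ly : L y by rewrite /y iter_iter; exact: Liter.
  have [yD|ynD] := pselect (D y).
    rewrite indicE mem_set// mulr1 -[leRHS]expRK ler_ln ?posrE ?expR_gt0//.
    apply: (le_trans (opmap_iter_bounded N y Ch HC)).
    by rewrite ler_expR mulrDr addrCA addNr addr0.
  rewrite indicE memNset// mulr0 addr0 -[leRHS]expRK ler_ln ?posrE ?expR_gt0//.
  by rewrite leNgt; apply/negP => Hy; apply: ynD.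
apply: (@le_trans _ _ (\sum_(k < n) (- (N%:R * c) + N%:R * (C + c) * \1_D (iter k F x)))).
  by apply: ler_sum => k _; exact: each.
have -> : \sum_(k < n) (- (N%:R * c) + N%:R * (C + c) * \1_D (iter k F x)) =
    n%:R * - (N%:R * c) + N%:R * (C + c) * visits F D n x.
  by rewrite /visits big_split/= sumr_const card_ord -big_distrr/= [n%:R * _]mulr_natl.
have NC0 : 0 <= N%:R * (C + c) by rewrite mulr_ge0// ltW.
apply: le_trans (lerD (lexx _) (ler_wpM2l NC0 vis)) _.
rewrite /al; have -> : N%:R * (C + c) * (n%:R * (c / (2 * (C + c)))) = n%:R * (N%:R * (c / 2)).
  by field; rewrite gt_eqF.
by rewrite le_eqVlt; apply/orP; left; apply/eqP; field.
Qed.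

(** The radii are fixed before the return time: the latter can then be taken so late that the
    contraction beats the constants of the chart ball. *)
Lemma attracting_atom (L : set (borel M)) (c : R) :
  measurable L -> (forall x, L x -> L (h x)) -> (0 < mu L)%E -> 0 < c ->
  (forall eta : R, 0 < eta -> exists N, (0 < N)%N /\
    (mu [set x | L x /\ (expR (- (N%:R * c)) < opmap g (iter N h) x)%R] < eta%:E)%E) ->
  exists p m O, [/\ L p, (0 < mu [set p])%E, periodic_orbit h p m O & attracting g h O].
Proof.
move=> mL hL L0 c0 small.
have [N [c' [H [N0 c'0 mH H0 Hsum]]]] := contracting_points mL hL L0 c0 small.
pose F := iter N h.
have CF : C1_map A F by exact: C1_map_iter.
have pF y : 0 < opmap g F y by exact: hpos.
have c'2 : 0 < c' / 2 by rewrite divr_gt0.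
have [rho rho0 Hrho] := uniform_along_curves g hM cM (ln_opmap_continuous CF pF) c'2.
have [z Hz] := support_point cM mH H0.
have iz := dom_chart_at A z; set i := chart_at A z in iz.
have nT : nbhs z [set: M] by exact: filterT.
have [s' [C [gb' _]]] := near_good_ball g iz nT.
have [_ s'0 C0 _] := gb'.
(* Two points of the [s]-ball are joined by a segment of length at most [2 * C * (2 * s)], below
   [rho]. *)
pose s := Num.min s' (rho / (8 * C)).
have s0 : 0 < s by rewrite lt_min s'0 divr_gt0// mulr_gt0.
have gb : good_ball g i z s C by apply: good_ball_shrink gb'; rewrite s0 ge_min lexx.
have srho : 2 * C * (2 * s) < rho.
  apply: (@le_lt_trans _ _ (2 * C * (2 * (rho / (8 * C))))).
    by rewrite ler_pM2l ?mulr_gt0// ler_pM2l// ge_min lexx orbT.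
  have -> : 2 * C * (2 * (rho / (8 * C))) = rho * 2^-1 by field; rewrite gt_eqF.
  by rewrite gtr_pMr// invf_lt1// ltr1n.
have k0 : 0 < 3 + 8 * C ^+ 2 by rewrite ltr_pwDl// mulr_ge0// sqr_ge0.
have k1 : 1 <= 3 + 8 * C ^+ 2 by have := sqr_ge0 C; lra.
pose r := s / (2 * (3 + 8 * C ^+ 2)).
have r0 : 0 < r by rewrite divr_gt0// mulr_gt0.
have rs : r * (3 + 8 * C ^+ 2) < s.
  have -> : r * (3 + 8 * C ^+ 2) = s * 2^-1 by rewrite /r; field; rewrite gt_eqF.
  by rewrite gtr_pMr// invf_lt1// ltr1n.
have r2s : r / 2 <= s.
  have rle : r <= r * (3 + 8 * C ^+ 2).
    by rewrite ler_peMr ?(ltW r0).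
  apply: le_trans (ltW (le_lt_trans rle rs)).
  by rewrite ler_piMr ?(ltW r0)// invf_le1// ler1n.
have nU : \forall y \near z, dom i y /\ `|lcoord i y - lcoord i z| < r / 2.
  apply: filterI; first by apply: open_nbhs_nbhs; split => //; exact: dom_open.
  have r20 : 0 < r / 2 by rewrite divr_gt0.
  have /cvgrPdist_lt/(_ _ r20) := @lcoord_continuous_at _ _ _ _ i z iz.
  by apply: filterS => y; rewrite distrC.
have : nbhs z [set y | dom i y /\ `|lcoord i y - lcoord i z| < r / 2] := nU.
rewrite nbhsE => -[U [oU Uz] HU].
pose B : set (borel M) := U `&` H.
have mB : measurable B by apply: measurableI => //; exact: open_borel.
have B0 : (0 < mu B)%E by exact: Hz.
(* By [1 + y <= expR y], any [n] beyond [n0] makes [lam] small enough for trapping. *)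
have [n0 Hn0] := exists_nat_ge (16 * (1 + C) ^+ 2) c'2.
have mF : measurable_fun setT (F : borel M -> borel M) by exact: measurable_iter.
have invF (E : set (borel M)) : measurable E -> mu (F @^-1` E) = mu E.
  by move=> mE; exact: (iter_invariant mh).
have [n [x [n0n [Ux Hx] [UGx _]]]] := recurrence mF invF n0 mB B0.
have [ix xr] := HU x Ux; have [iGx Gxr] := HU _ UGx.
pose G := iter n F; pose lam := expR (- (n%:R * (c' / 2))).
have CG : C1_map A G by exact: C1_map_iter.
have lam0 : 0 <= lam by exact: expR_ge0.
have lam_small : lam * (16 * (1 + C) ^+ 2) <= 1.
  rewrite /lam expRN mulrC ler_pdivrMr ?expR_gt0// mul1r.
  apply: le_trans (Hn0 n (ltnW n0n)) _; apply: le_trans (expR_ge1Dx _).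
  by rewrite lerDr.
have [Lx Hxn] := Hsum x Hx.
(* [tracking] passes the contraction from [x] to every point of the ball through the segment joining
   them. *)
have G_small q : `|q - lcoord i z| <= s -> opmap g G (para i q) <= lam.
  move=> qs; have xs : `|lcoord i x - lcoord i z| <= s by exact: le_trans (ltW xr) r2s.
  have [c1 [Cc1 c10 c11 _ c1l]] := segment_curve gb xs qs.
  have c1rho : curve_length g c1 < rho.
    apply: le_lt_trans c1l _; apply: le_lt_trans srho.
    by rewrite ler_pM2l ?mulr_gt0//; exact: distr_le_double xs qs.
  have c10x : c1 0 = x by rewrite c10 (lcoordK ix).
  have one : 0 <= (1 : R) <= 1 by rewrite ler01 lexx.
  rewrite -c11; exact: (tracking CF pF c'0 Hxn Hrho Cc1 c10x c1rho n one).
have rr : r / 2 <= r by rewrite ler_piMr ?(ltW r0)// invf_le1// ler1n.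
have xr' : `|lcoord i x - lcoord i z| <= r by exact: le_trans (ltW xr) rr.
have Gxr' : `|lcoord i (G x) - lcoord i z| <= r / 2 by exact: ltW.
have [p pr pp] := chart_repr_fixpoint hM CG gb r0 rs G_small lam_small lam0 ix xr' iGx Gxr'.
have trap := chart_repr_trapped hM CG gb r0 rs G_small lam_small lam0 ix xr' iGx Gxr'.
have contr := rdist_contraction hM CG gb r0 rs G_small lam_small lam0.
have invG (E : set (borel M)) : measurable E -> mu (G @^-1` E) = mu E.
  by move=> mE; exact: (iter_invariant mF invF).
have meas := trapped_measure hM CG gb r0 rs G_small lam_small lam0 ix xr' iGx Gxr' invG (ltW pr) pp.
pose P := para i p; pose K : set (borel M) := para i @` [set q | `|q - lcoord i z| <= r].
have sr : r <= s.
  apply: le_trans (ltW rs); by rewrite ler_peMr ?(ltW r0).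
have mK : measurable K by apply: closed_borel; exact: (closed_chart_ball hM gb sr).
have BK : B `<=` K.
  move=> y [/HU[iy yr] _]; exists (lcoord i y); last exact: lcoordK.
  exact: le_trans (ltW yr) rr.
have mP : measurable ([set P] : set (borel M)).
  by apply: closed_borel; exact: (accessible_closed_set1 (hausdorff_accessible hM)).
have P0 : (0 < mu [set P])%E.
  apply: lt_le_trans B0 _; apply: le_trans meas.
  by apply: le_measure; rewrite ?inE.
have PK : K P by exists p => //; exact: ltW.
(* All the mass of [K] sits at [P]. The set [B] lies in [K] and in [L] and has positive mass, so it
   must contain [P]. *)
have LP : L P.
  apply: contrapT => nLP; move: B0; apply/negP; rewrite -leNgt.
  apply: (@le_trans _ _ (mu (K `\` [set P]))).
    apply: le_measure; rewrite ?inE//; first exact: measurableD.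
    move=> y By; split; first exact: BK.
    by move=> yP; apply: nLP; rewrite -yP; case: By => _ /Hsum[].
  have Kfin : (mu K < +oo)%E by rewrite -ge0_fin_numE// fin_num_measure.
  have := measureD mK mP Kfin.
  have -> : K `&` [set P] = [set P] by apply/seteqP; split=> [y []//|y ->].
  by move=> ->; rewrite sube_le0.
have GP : G P = P.
  have [iGp _] := trap p (ltW pr).
  by rewrite -(lcoordK iGp) -/(chart_repr G i p) pp.
have GE y : G y = iter (n * N) h y by rewrite /G /F iter_iter.
have per : periodic_orbit h P (n * N) [set iter j h P | j in `I_(n * N)].
  split=> //; last by rewrite -GE.
  by rewrite muln_gt0 N0 (leq_ltn_trans _ n0n).
exists P, (n * N)%N, [set iter j h P | j in `I_(n * N)]; split=> //.
exists P, (n * N)%N; split=> //; exists K; split.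
- have iP : dom i P /\ `|lcoord i P - lcoord i z| < r.
    have [_ _ _ Hgb] := gb; have [[y iy yp] _] := Hgb p (le_trans (ltW pr) sr).
    by rewrite /P -yp (lcoordK iy) yp.
  have nP : \forall y \near P, dom i y /\ `|lcoord i y - lcoord i z| < r.
    have [iPd Pr] := iP.
    apply: filterI; first by apply: open_nbhs_nbhs; split => //; exact: dom_open.
    have cl : {for P, continuous (fun y => `|lcoord i y - lcoord i z|)}.
      apply: (@cvg_norm _ _ _ (nbhs P)); apply: (@cvgB _ _ _ (nbhs P)); last exact: cvg_cst.
      exact: lcoord_continuous_at.
    by apply: (cvgr_lt _ cl).
  apply: filterS nP => y [iy yr]; exists (lcoord i y); last exact: lcoordK.
  exact: ltW.
- move=> _ [q /= qr <-]; rewrite -GE; have [iGq Gqr] := trap q qr.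
  by exists (chart_repr G i q); [exact: ltW|rewrite /chart_repr (lcoordK iGq)].
exists 2^-1; first by rewrite invr_gt0 ltr0n invf_lt1// ltr1n.
move=> _ _ [q1 /= q1r <-] [q2 /= q2r <-] q12; rewrite -!GE; apply: contr => //.
by apply/eqP => q12e; apply: q12; rewrite q12e.
Qed.

End AttractingAtom.

(** * Growth rates and Lyapunov exponents *)

Lemma iterK (T : Type) (f finv : T -> T) n : cancel f finv -> cancel (iter n f) (iter n finv).
Proof. by move=> fK x; elim: n x => //= n IH x; rewrite -iterS iterSr fK IH. Qed.

Section Cocycle.
Context {R : realType} {d : nat} {M : ptopologicalType} {A : smooth_atlas R d M}.
Context (g : riemannian A) (hd : (0 < d)%N) (hM : hausdorff_space M) (cM : compact [set: M]).
Context (f finv : M -> M) (fK : cancel f finv) (finvK : cancel finv f).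
Context (f_C1 : C1_map A f) (finv_C1 : C1_map A finv).

Lemma Dmx_id x : Dmx A id x = 1%:M.
Proof. by rewrite DmxE dmap_id//; exact: dom_chart_at. Qed.

Lemma Dmx_cancel h hinv x : C1_map A h -> C1_map A hinv -> cancel h hinv ->
  Dmx A h x *m Dmx A hinv (h x) = 1%:M.
Proof.
move=> Ch Ci hK; rewrite -(Dmx_comp x Ch Ci) (_ : hinv \o h = id) ?Dmx_id//.
by apply/funext => y /=; rewrite hK.
Qed.

Lemma tnorm_exists x : exists2 v : 'rV[R]_d, v != 0 & 0 < tnorm g x v.
Proof.
have v0 : (const_mx 1 : 'rV[R]_d) != 0.
  apply/eqP => /rowP/(_ (Ordinal hd)); rewrite !mxE => /eqP; by rewrite oner_eq0.
by exists (const_mx 1) => //; case: (tnorm_normlike g x) => _ _; apply.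
Qed.

Lemma opmap_cancel_ge1 h hinv x : C1_map A h -> C1_map A hinv -> cancel h hinv ->
  1 <= opmap g h x * opmap g hinv (h x).
Proof.
move=> Ch Ci hK; have [v v0 vp] := tnorm_exists x.
have H1 := opmap_ub g h x v; have H2 := opmap_ub g hinv (h x) (v *m Dmx A h x).
rewrite -mulmxA (Dmx_cancel x Ch Ci hK) mulmx1 hK in H2.
rewrite -(ler_pM2r vp) mul1r (mulrC (opmap g h x)) -mulrA.
exact: (le_trans H2 (ler_wpM2l (opmap_ge0 _ _ _) H1)).
Qed.

Lemma opmap_gt0 h hinv x : C1_map A h -> C1_map A hinv -> cancel h hinv -> 0 < opmap g h x.
Proof.
move=> Ch Ci hK; rewrite lt_neqAle (opmap_ge0 g h x) andbT eq_sym; apply/eqP => h0.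
by have := opmap_cancel_ge1 x Ch Ci hK; rewrite h0 mul0r ler10.
Qed.

Lemma opmap_iter_gt0 n x : 0 < opmap g (iter n f) x.
Proof. exact: (opmap_gt0 x (C1_map_iter n f_C1) (C1_map_iter n finv_C1) (iterK n fK)). Qed.

Lemma opmap_id1 x : opmap g id x = 1.
Proof.
apply/eqP; rewrite eq_le (opmap_id_le1 g x)/=.
have [v v0 vp] := tnorm_exists x.
have := opmap_ub g id x v; rewrite Dmx_id mulmx1 => H.
by rewrite -(ler_pM2r vp) mul1r.
Qed.

Lemma ln_opmap_comp h1 h2 x : C1_map A h1 -> C1_map A h2 ->
  (0 < opmap g h1 x) -> (0 < opmap g h2 (h1 x)) -> 0 < opmap g (h2 \o h1) x ->
  ln (opmap g (h2 \o h1) x) <= ln (opmap g h1 x) + ln (opmap g h2 (h1 x)).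
Proof.
move=> C1 C2 p1 p2 p12; rewrite -lnM ?posrE// ler_ln ?posrE ?mulr_gt0//.
exact: opmap_comp.
Qed.

Lemma iter_addf m n (h : M -> M) : iter (m + n) h = iter n h \o iter m h.
Proof. by apply/funext => x /=; rewrite addnC iterD. Qed.

End Cocycle.

Section Rates.
Context {R : realType} {d : nat} {M : ptopologicalType} {A : smooth_atlas R d M}.
Context (g : riemannian A) (hd : (0 < d)%N) (hM : hausdorff_space M) (cM : compact [set: M]).
Context (f finv : M -> M) (fK : cancel f finv) (finvK : cancel finv f).
Context (f_C1 : C1_map A f) (finv_C1 : C1_map A finv).

Definition grow n x : R := ln (opmap g (iter n f) x).
(** Logarithm of the norm of the inverse of the derivative of [f^n] at [x]. Evaluating [finv] at the
    end of the orbit segment makes it a subadditive sequence over [f]. *)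
Definition shrink n x : R := ln (opmap g (iter n finv) (iter n f x)).

Let fpos n x : 0 < opmap g (iter n f) x := opmap_iter_gt0 g hd fK f_C1 finv_C1 n x.
Let ipos n x : 0 < opmap g (iter n finv) x := opmap_iter_gt0 g hd finvK finv_C1 f_C1 n x.
Let Cf n : C1_map A (iter n f) := C1_map_iter n f_C1.
Let Ci n : C1_map A (iter n finv) := C1_map_iter n finv_C1.

Lemma log_growthE x : log_growth g f x = fun n : nat => n%:R^-1 * grow n x.
Proof. by apply/funext => n; rewrite /log_growth /grow opmap_opnorm. Qed.

Lemma Dmx_iter_inv n x : invmx (Dmx A (iter n f) x) = Dmx A (iter n finv) (iter n f x).
Proof.
have E := Dmx_cancel x (Cf n) (Ci n) (iterK n fK).
have [u _] := mulmx1_unit E.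
by rewrite -[RHS](mulKmx u) E mulmx1.
Qed.

Lemma log_growth_invE x : log_growth_inv g f x = fun n : nat => n%:R^-1 * shrink n x.
Proof.
apply/funext => n; rewrite /log_growth_inv /shrink opmap_opnorm Dmx_iter_inv.
by rewrite (iterK n fK).
Qed.

Lemma grow_subadd m n x : grow (m + n) x <= grow m x + grow n (iter m f x).
Proof.
rewrite /grow iter_addf; apply: ln_opmap_comp => //.
by have := fpos (m + n) x; rewrite iter_addf.
Qed.

Lemma shrink_subadd m n x : shrink (m + n) x <= shrink m x + shrink n (iter m f x).
Proof.
rewrite /shrink; set y := iter (m + n) f x.
have yE : iter n f (iter m f x) = y by rewrite /y addnC iterD.
rewrite yE addrC [iter (m + n) finv](_ : _ = iter m finv \o iter n finv); last first.
  by rewrite addnC iter_addf.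
have -> : iter m f x = iter n finv y by rewrite -yE (iterK n fK).
apply: ln_opmap_comp => //.
by have := ipos (m + n) y; rewrite addnC iter_addf.
Qed.

Lemma grow0 x : grow 0 x = 0.
Proof. by rewrite /grow opmap_id1// ln1. Qed.

Lemma shrink0 x : shrink 0 x = 0.
Proof. by rewrite /shrink opmap_id1// ln1. Qed.

Lemma grow_measurable n : measurable_fun setT (grow n : borel M -> R).
Proof. by apply: continuous_borel_real; apply: ln_opmap_continuous. Qed.

Lemma shrink_measurable n : measurable_fun setT (shrink n : borel M -> R).
Proof.
apply: continuous_borel_real => x.
apply: (@continuous_comp _ _ _ (iter n f) (fun y => ln (opmap g (iter n finv) y))).
  exact: C1_map_continuous (Cf n).
by apply: ln_opmap_continuous.
Qed.

Lemma grow_shrink_ge0 n x : 0 <= grow n x + shrink n x.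
Proof.
rewrite -lnM ?posrE// ln_ge0//.
exact: (opmap_cancel_ge1 g hd x (Cf n) (Ci n) (iterK n fK)).
Qed.

(** Obtained by writing [iter n f] as [iter n.+1 f] after [finv]. It makes sets defined by an upper
    bound on the rate forward invariant. *)
Lemma grow_step n x : grow n (f x) <= grow n.+1 x + shrink 1 x.
Proof.
rewrite /grow /shrink; have E : iter n f = iter n.+1 f \o finv.
  by apply/funext => y; rewrite /= -iterS iterSr finvK.
rewrite {1}E addrC -{3}(fK x).
apply: (@ln_opmap_comp _ _ _ _ g finv (iter n.+1 f)) => //.
- exact: (ipos 1).
- by rewrite -E.
Qed.

Lemma shrink_step n x : shrink n (f x) <= shrink n.+1 x + grow 1 x.
Proof.
rewrite /grow /shrink -iterSr.
have E : iter n finv = f \o iter n.+1 finv by apply/funext => y; rewrite /= finvK.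
rewrite {1}E -{3}[x](iterK n.+1 fK).
apply: (@ln_opmap_comp _ _ _ _ g (iter n.+1 finv) f) => //.
- exact: (fpos 1).
- by rewrite -E.
Qed.

(** Upper bounds come from compactness; each lower bound comes from the other upper bound, since the
    sum of the two logarithms is nonnegative. *)
Lemma rates_bounded : exists2 C : R, 0 <= C & forall n x,
  `|grow n x| <= n%:R * C /\ `|shrink n x| <= n%:R * C.
Proof.
have [C1 C10 H1] := opmap_bounded g cM f_C1.
have [C2 C20 H2] := opmap_bounded g cM finv_C1.
exists (Num.max C1 C2); first by rewrite le_max C10.
move=> n x.
have u1 : grow n x <= n%:R * Num.max C1 C2.
  rewrite -[leRHS]expRK ler_ln ?posrE ?expR_gt0//.
  apply: (le_trans (opmap_iter_bounded n x f_C1 H1)).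
  by rewrite ler_expR ler_wpM2l// le_max lexx.
have u2 : shrink n x <= n%:R * Num.max C1 C2.
  rewrite -[leRHS]expRK ler_ln ?posrE ?expR_gt0//.
  apply: (le_trans (opmap_iter_bounded n _ finv_C1 H2)).
  by rewrite ler_expR ler_wpM2l// le_max lexx orbT.
have := grow_shrink_ge0 n x; rewrite !ler_norml u1 u2 !andbT.
by move: u1 u2; move: (_ * _) => K; lra.
Qed.

Lemma rates_converge (mu : probability (borel M) R) : invariant_measure f mu ->
  {ae mu, forall x, cvgn (fun n : nat => n%:R^-1 * grow n x) /\
    cvgn (fun n : nat => n%:R^-1 * shrink n x)}.
Proof.
move=> minv; have [C C0 HC] := rates_bounded.
have mf : measurable_fun setT (f : borel M -> borel M).
  by apply: continuous_borel; case: f_C1.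
have H1 : {ae mu, forall x, cvgn (fun n : nat => n%:R^-1 * grow n x)}.
  apply: (@kingman _ _ _ mu f mf minv grow C) => //.
  - exact: grow_measurable.
  - exact: grow0.
  - by move=> x; have [+ _] := HC 1%N x; rewrite mul1r ler_norml => /andP[].
  - by move=> n x; case: (HC n x).
  - by move=> m n x; exact: grow_subadd.
  - move=> n x; apply: le_trans (grow_step n x) _; rewrite lerD2l.
    by have [_ +] := HC 1%N x; rewrite mul1r ler_norml => /andP[].
have H2 : {ae mu, forall x, cvgn (fun n : nat => n%:R^-1 * shrink n x)}.
  apply: (@kingman _ _ _ mu f mf minv shrink C) => //.
  - exact: shrink_measurable.
  - exact: shrink0.
  - by move=> x; have [_ +] := HC 1%N x; rewrite mul1r ler_norml => /andP[].
  - by move=> n x; case: (HC n x).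
  - by move=> m n x; exact: shrink_subadd.
  - move=> n x; apply: le_trans (shrink_step n x) _; rewrite lerD2l.
    by have [+ _] := HC 1%N x; rewrite mul1r ler_norml => /andP[].
apply: negligibleS (negligibleU H1 H2) => x /= nx; apply: contrapT => /not_orP[/contrapT c1 /contrapT c2].
by apply: nx; split.
Qed.

End Rates.

(** * Compactness and measurability of slow vectors *)

Section SlowVectors.
Context {R : realType} {d : nat} {M : ptopologicalType} {A : smooth_atlas R d M}.
Context (g : riemannian A) (hd : (0 < d)%N) (hM : hausdorff_space M) (cM : compact [set: M]).
Context (f finv : M -> M) (fK : cancel f finv) (finvK : cancel finv f).
Context (f_C1 : C1_map A f) (finv_C1 : C1_map A finv).

Let Cf n : C1_map A (iter n f) := C1_map_iter n f_C1.
Let Ci n : C1_map A (iter n finv) := C1_map_iter n finv_C1.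

Lemma Dmx_iter_inj n x (v : 'rV[R]_d) : v != 0 -> v *m Dmx A (iter n f) x != 0.
Proof.
have E := Dmx_cancel x (Cf n) (Ci n) (iterK n fK).
by apply: contra_neq => v0; rewrite -[v]mulmx1 -E mulmxA v0 mul0mx.
Qed.

Lemma tnorm_iter_normlike n x :
  normlike (fun v => tnorm g (iter n f x) (v *m Dmx A (iter n f) x)).
Proof.
have [NZ ND N0] := tnorm_normlike g (iter n f x).
split=> [a v|u v|v v0].
- by rewrite -scalemxAl NZ.
- by rewrite mulmxDl ND.
- by apply: N0; exact: Dmx_iter_inj.
Qed.

Local Notation slow :=
  (slow_until (X := borel M) f (tnorm g) (fun n => Dmx A (iter n f))).

(** If every unit vector failed at some time, compactness of the sphere would make all of them fail
    before a common time. Slowness is invariant under scaling, so unit vectors suffice. *)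
Lemma slow_compact q x :
  (forall N, exists2 v : 'rV[R]_d, v != 0 &
    slow N q x v) ->
  exists2 v : 'rV[R]_d, v != 0 & forall N,
    slow N q x v.
Proof.
move=> slow; apply: contrapT => nslow.
pose Q n v := tnorm g (iter n f x) (v *m Dmx A (iter n f) x) - expR (n%:R * q) * tnorm g x v.
have Qc n : continuous (Q n).
  move=> v; apply: (@cvgB _ _ _ (nbhs v)); first exact: (normlike_continuous (tnorm_iter_normlike n x)).
  apply: (@cvgM _ _ (nbhs v)); first exact: cvg_cst.
  exact: (normlike_continuous (tnorm_normlike g x)).
have : \forall N \near \oo, unit_sphere `<=` (fun v => exists2 n, (n <= N)%N & 0 < Q n v).
  have /compact_near_coveringP := @compact_unit_sphere R d.
  apply => v sv.
  have v0 : v != 0.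
    by apply/eqP => v0; move: sv; rewrite /unit_sphere /= v0 normr0 => /eqP; rewrite eq_sym oner_eq0.
  have [n Qn] : exists n, 0 < Q n v.
    apply: contrapT => H; apply: nslow; exists v => // N n _.
    by rewrite -subr_le0 leNgt; apply/negP => Hn; apply: H; exists n.
  have nv : \forall u \near v, 0 < Q n u by apply: (cvgr_gt _ (Qc n v)).
  exists ([set u | 0 < Q n u], [set N | (n <= N)%N]) => /=.
    by split=> //; exists n.
  by move=> [u N] [/= Qu nN]; exists n.
move=> [N _ /(_ N (leqnn _)) HN].
have [v v0 sv] := slow N.
have [t tt [a a0 va]] := unit_sphere_scale v0.
have [n nN] := HN t tt; rewrite /Q subr_gt0 ltNge => /negP; apply.
have := sv n nN; rewrite va -scalemxAl.
have [NZ _ _] := tnorm_normlike g x; have [NZn _ _] := tnorm_normlike g (iter n f x).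
by rewrite NZ NZn gtr0_norm// mulrCA ler_pM2l.
Qed.

(** Failing to be slow is an open condition on the pair of point and vector; compactness of the
    sphere makes it open in the point alone. This yields the measurability required by
    [slow_vector]. *)
Lemma open_not_slow N q : open [set x | ~ exists2 v : 'rV[R]_d, v != 0 &
    slow N q x v].
Proof.
rewrite openE => x0 /= nslow; rewrite /interior.
have ix0 := dom_chart_at A x0; set i := chart_at A x0 in ix0.
pose jj n := chart_at A (iter n f x0).
have jx0 n : dom (jj n) (iter n f x0) by exact: dom_chart_at.
(* in fixed charts along the orbit of x0, so that it is continuous near x0 *)
pose Q n (x : M) (u : 'rV[R]_d) := qnorm (gram g (jj n) (iter n f x)) (u *m dmap (iter n f) i (jj n) x)
   - expR (n%:R * q) * qnorm (gram g i x) u.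
have QE n x v : dom i x -> dom (jj n) (iter n f x) ->
    Q n x (v *m dmap id (chart_at A x) i x) =
    tnorm g (iter n f x) (v *m Dmx A (iter n f) x) - expR (n%:R * q) * tnorm g x v.
  move=> ix jx; rewrite /Q (tnormE g v ix) (tnormE g _ jx) DmxE; congr (_ - _).
  have ax := dom_chart_at A x; have bx := dom_chart_at A (iter n f x).
  have C1 := @C1_map_id _ _ _ A.
  have E1 := dmap_comp (Cf n) C1 ax bx jx; have E2 := dmap_comp C1 (Cf n) ax ix jx.
  by rewrite -!mulmxA -[X in _ = qnorm _ (v *m X)]E1 -[X in qnorm _ (v *m X)]E2.
have Sx0 u : unit_sphere u -> exists2 n, (n <= N)%N & 0 < Q n x0 u.
  move=> su; apply: contrapT => H; apply: nslow; exists u.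
    by apply/eqP => u0; move: su; rewrite /unit_sphere /= u0 normr0 => /eqP; rewrite eq_sym oner_eq0.
  move=> n nN; rewrite -subr_le0 -(QE n x0 u ix0 (jx0 n)) dmap_id// mulmx1.
  by rewrite leNgt; apply/negP => Hn; apply: H; exists n.
have near_i : \forall x \near x0, dom i x.
  by apply: open_nbhs_nbhs; split => //; exact: dom_open.
have near_j n : \forall x \near x0, dom (jj n) (iter n f x).
  by apply: near_dom_preimage => //; exact: C1_map_continuous (Cf n).
have tube : \forall x \near x0, unit_sphere `<=` (fun u => exists2 n, (n <= N)%N & 0 < Q n x u).
  have /compact_near_coveringP := @compact_unit_sphere R d.
  apply => u su; have [n nN Qn] := Sx0 u su.
  pose H (p : 'rV[R]_d * M) := Q n p.2 p.1.
  have FP : Filter (filter_prod (nbhs u) (nbhs x0)) by apply: filter_prod_filter.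
  have Hc : H @ filter_prod (nbhs u) (nbhs x0) --> Q n x0 u.
    have c1 : fst @ filter_prod (nbhs u) (nbhs x0) --> u by exact: cvg_fst.
    have c2 (U : topologicalType) (h : M -> U) (l : U) : h @ x0 --> l ->
        (fun p : 'rV[R]_d * M => h p.2) @ filter_prod (nbhs u) (nbhs x0) --> l.
      move=> hl B /hl hB; exists (setT, h @^-1` B); last by move=> [? ?] [].
      by split; [exact: filterT|].
    apply: cvgB.
      apply: (@cvg_qnorm _ _ _ _ FP).
        apply: (c2 _ (fun x => gram g (jj n) (iter n f x))).
        apply: (@continuous_comp _ _ _ (iter n f) (gram g (jj n))).
          exact: C1_map_continuous (Cf n).
        exact: gram_continuous.
      apply: (@cvg_mulmx _ _ _ FP) => //.
      by apply: (c2 _ (dmap (iter n f) i (jj n))); exact: dmap_continuous.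
    apply: cvgM; first exact: cvg_cst.
    apply: (@cvg_qnorm _ _ _ _ FP) => //.
    by apply: (c2 _ (gram g i)); exact: gram_continuous.
  have : \forall p \near filter_prod (nbhs u) (nbhs x0), 0 < H p by apply: (cvgr_gt _ Hc).
  by apply: filterS => p Hp; exists n.
(* Only the finitely many times up to [N] matter, so one neighbourhood serves all the charts. *)
have near_all : \forall x \near x0, forall n : 'I_N.+1, dom (jj n) (iter n f x).
  by apply: filter_forall => n; exact: near_j.
near=> x; move=> [v v0 sv].
have ix : dom i x by near: x.
have jx : forall n : 'I_N.+1, dom (jj n) (iter n f x) by near: x.
pose u := v *m dmap id (chart_at A x) i x.
have u0 : u != 0.
  apply: contra_neq v0 => u0; rewrite -[v]mulmx1 -(dmap_id_inv (dom_chart_at A x) ix) mulmxA.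
  by rewrite -/u u0 mul0mx.
have [t tt [a a0 ua]] := unit_sphere_scale u0.
have [n nN Qt] : exists2 n, (n <= N)%N & 0 < Q n x t.
  by move: t tt {ua}; near: x.
have nN' : (n < N.+1)%N by [].
have jn := jx (Ordinal nN').
have := sv n nN; rewrite -subr_le0 -(QE n x v ix jn) -/u ua leNgt => /negP; apply.
have Ni := gram_normlike g ix; have Nj := gram_normlike g jn.
have [[NiZ _ _] [NjZ _ _]] := (Ni, Nj).
have -> : Q n x (a *: t) = a * Q n x t.
  rewrite /Q -scalemxAl NiZ NjZ gtr0_norm//; ring.
by rewrite mulr_gt0.
Unshelve. all: by end_near. Qed.

Lemma measurable_slow N q : measurable ([set x | exists2 v : 'rV[R]_d, v != 0 &
    slow N q x v] : set (borel M)).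
Proof.
rewrite -[X in measurable X]setCK; apply: measurableC; apply: open_borel.
exact: open_not_slow.
Qed.

End SlowVectors.

Section Exponents.
Context {R : realType} {d : nat} {M : ptopologicalType} {A : smooth_atlas R d M}.
Context (g : riemannian A) (hd : (0 < d)%N) (hM : hausdorff_space M) (cM : compact [set: M]).
Context (f finv : M -> M) (fK : cancel f finv) (finvK : cancel finv f).
Context (f_C1 : C1_map A f) (finv_C1 : C1_map A finv).

Let Cf n : C1_map A (iter n f) := C1_map_iter n f_C1.
Let Ci n : C1_map A (iter n finv) := C1_map_iter n finv_C1.
Let fpos n x : 0 < opmap g (iter n f) x := opmap_iter_gt0 g hd fK f_C1 finv_C1 n x.
Let ipos n x : 0 < opmap g (iter n finv) x := opmap_iter_gt0 g hd finvK finv_C1 f_C1 n x.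

(** A vector generic for the norms pulled back from all times grows like the operator norm up to the
    subexponential factor [margin n ^+ d]. *)
Lemma top_exponent x l : (fun n : nat => n%:R^-1 * grow g f n x) @ \oo --> l ->
  lyapunov_exponent g f x l.
Proof.
move=> gl.
pose N n (v : 'rV[R]_d) := tnorm g (iter n f x) (v *m Dmx A (iter n f) x).
have NN n : normlike (N n) by exact: (tnorm_iter_normlike g fK f_C1 finv_C1).
have [v Hv] := generic_vector NN.
have Nx := tnorm_normlike g x.
have [C C0 HC] := norm_le_normlike Nx.
pose K := d%:R * C + 1.
have K0 : 0 < K by rewrite ltr_wpDl// mulr_ge0// ltW.
have sumK (u : 'rV[R]_d) : \sum_i `|u 0 i| <= K * tnorm g x u.
  apply: (@le_trans _ _ (\sum_(i < d) C * tnorm g x u)).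
    by apply: ler_sum => i _; exact: le_trans (coord_le_norm u i) (HC u).
  rewrite sumr_const card_ord -mulr_natl mulrA ler_wpM2r ?normlike_ge0// lerDl//.
have opv n : margin n ^+ d * opmap g (iter n f) x <= K * N n v.
  have mg : 0 < margin n ^+ d :> R by rewrite exprn_gt0// margin_gt0.
  rewrite mulrC -ler_pdivlMr//; apply: opmap_le.
    by rewrite divr_ge0 ?(ltW mg)// mulr_ge0 ?(ltW K0)// normlike_ge0.
  move=> u; rewrite mulrAC ler_pdivlMr// mulrC; apply: le_trans (Hv n u) _.
  by rewrite mulrAC ler_wpM2r ?normlike_ge0.
have v0 : v != 0.
  apply/eqP => v0; have := opv 0%N; rewrite v0 (normlike0 (NN 0%N)) mulr0.
  by rewrite leNgt mulr_gt0// exprn_gt0// margin_gt0.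
have Nv n : 0 < N n v by case: (NN n) => _ _; apply.
exists v => //; apply: cvg_rate_close gl => e e0.
have [K' HK'] := ln_margin_small (R := R) d e0.
exists (`|K'| + `|ln K| + `|ln (tnorm g x v)|) => n; rewrite -/(N n v).
have mg : 0 < margin n ^+ d :> R by rewrite exprn_gt0// margin_gt0.
have vx : 0 < tnorm g x v by case: Nx => _ _; apply.
have H1 : ln (margin n ^+ d) + grow g f n x <= ln K + ln (N n v).
  by rewrite /grow -!lnM ?posrE// ler_ln ?posrE ?mulr_gt0.
have H2 : ln (N n v) <= grow g f n x + ln (tnorm g x v).
  rewrite /grow -lnM ?posrE// ler_ln ?posrE ?mulr_gt0//; exact: opmap_ub.
have H3 := HK' n; rewrite ler_norml.
have := ler_norm K'; have := ler_norm (ln K); have := ler_norm (ln (tnorm g x v)).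
have : 0 <= n%:R * e by rewrite mulr_ge0// ltW.
have := normr_ge0 (ln K); have := normr_ge0 (ln (tnorm g x v)); have := normr_ge0 K'.
move: H1 H2 H3; move: (ln (margin n ^+ d)) (ln K) (ln (N n v)) (ln (tnorm g x v)) (grow g f n x) (n%:R * e) => a1 a2 a3 a4 a5 a6.
lra.
Qed.

Lemma bottom_exponent (mu : probability (borel M) R) : invariant_measure f mu ->
  {ae mu, forall x, forall l : R, (fun n : nat => n%:R^-1 * shrink g f finv n x) @ \oo --> l ->
    lyapunov_exponent g f x (- l)}.
Proof.
move=> minv; have [C C0 HC] := rates_bounded g hd cM fK finvK f_C1 finv_C1.
have mf : measurable_fun setT (f : borel M -> borel M).
  by apply: continuous_borel; case: f_C1.
have ub n x v : tnorm g x v <=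
    expR (shrink g f finv n x) * tnorm g (iter n f x) (v *m Dmx A (iter n f) x).
  rewrite /shrink lnK ?posrE//.
  have := opmap_ub g (iter n finv) (iter n f x) (v *m Dmx A (iter n f) x).
  by rewrite -mulmxA (Dmx_cancel x (Cf n) (Ci n) (iterK n fK)) mulmx1 (iterK n fK).
apply: (@bottom_vector _ (borel M) R d mu f mf minv (tnorm g) (fun n => Dmx A (iter n f))
  (shrink g f finv) C) => //.
- by move=> x; exact: tnorm_normlike.
- by move=> x; exact: Dmx_id.
- move=> m n x; have -> : iter (m + n) f = iter n f \o iter m f by exact: iter_addf.
  exact: (Dmx_comp x (Cf m) (Cf n)).
- by move=> n x v; exact: (Dmx_iter_inj fK f_C1 finv_C1).
- move=> x v; apply: le_trans (ub 1%N x v) _; rewrite ler_wpM2r ?normlike_ge0//.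
    exact: tnorm_normlike.
  rewrite ler_expR; have [_ +] := HC 1%N x; rewrite mul1r; apply: le_trans.
  exact: ler_norm.
- move=> n x B HB; rewrite /shrink -[leRHS]expRK ler_ln ?posrE ?expR_gt0//.
  apply: opmap_le; first exact: expR_ge0.
  move=> w; have := HB (w *m Dmx A (iter n finv) (iter n f x)); rewrite -mulmxA.
  have E := Dmx_cancel x (Cf n) (Ci n) (iterK n fK).
  by rewrite (mulmx1C E) mulmx1 (iterK n fK).
- by move=> N q; exact: (measurable_slow g f_C1).
- by move=> q x; exact: (slow_compact fK f_C1 finv_C1).
Qed.

End Exponents.

(** * Periodic atoms and the decomposition *)

Section PeriodicOrbits.
Context {M : ptopologicalType}.
Implicit Types (f h : M -> M) (p x y : M) (O : set M).

Lemma iter_mul_fixed f p m n : iter m f p = p -> iter (n * m) f p = p.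
Proof. by move=> fp; elim: n => // n IH; rewrite mulSn iterD IH. Qed.

(** This description does not involve the period, so orbits given with different periods can be
    compared. *)
Lemma mem_orbit f p m O y : periodic_orbit f p m O -> (O y <-> exists n, y = iter n f p).
Proof.
move=> [m0 fp ->]; split=> [[j _ <-]|[n ->]]; first by exists j.
exists (n %% m)%N; first by rewrite /= ltn_mod.
by rewrite {2}(divn_eq n m) addnC iterD (iter_mul_fixed _ fp).
Qed.

Lemma periodic_orbit_of f p m O : (0 < m)%N -> iter m f p = p ->
  (forall y, O y <-> exists n, y = iter n f p) -> periodic_orbit f p m O.
Proof.
move=> m0 fp OE; split=> //; have per : periodic_orbit f p m [set iter j f p | j in `I_m] by [].
by apply/seteqP; split=> y; [move=> /OE/(mem_orbit y per)|move=> /(mem_orbit y per)/OE].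
Qed.

Lemma orbit_recenter f p m O x : periodic_orbit f p m O -> O x -> periodic_orbit f x m O.
Proof.
move=> per; have [m0 fp _] := per; move=> /(mem_orbit x per)[j xj].
apply: periodic_orbit_of => //; first by rewrite xj -iterD addnC iterD fp.
move=> y; split=> [/(mem_orbit y per)[n ->]|[n ->]].
  (* A natural number congruent to [n - j] modulo the period. *)
  exists (n + (j * m - j))%N; rewrite xj -iterD -addnA subnK ?leq_pmulr//.
  by rewrite iterD (iter_mul_fixed _ fp).
by apply/(mem_orbit _ per); exists (n + j)%N; rewrite xj iterD.
Qed.

Lemma orbits_eq f p q m n O O' x : periodic_orbit f p m O -> periodic_orbit f q n O' ->
  O x -> O' x -> O = O'.
Proof.
move=> perO perO' Ox O'x; have pO := orbit_recenter perO Ox; have pO' := orbit_recenter perO' O'x.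
by apply/seteqP; split=> y; [move/(mem_orbit y pO)/(mem_orbit y pO')|
  move/(mem_orbit y pO')/(mem_orbit y pO)].
Qed.

Lemma orbit_inv f finv p m O : cancel f finv ->
  periodic_orbit f p m O -> periodic_orbit finv p m O.
Proof.
move=> fK per; have [m0 fp _] := per.
have ip : iter m finv p = p by rewrite -{1}fp (iterK m fK).
have nE n : (n * m - n + n = n * m)%N by rewrite subnK// leq_pmulr.
apply: periodic_orbit_of => // y; split=> [/(mem_orbit y per)[n ->]|[n ->]].
  exists (n * m - n)%N.
  by rewrite -[LHS](iterK (n * m - n) fK) -iterD nE (iter_mul_fixed _ fp).
apply/(mem_orbit _ per); exists (n * m - n)%N.
have E : iter (n * m) f p = iter n f (iter (n * m - n) f p) by rewrite -iterD addnC nE.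
by rewrite -{1}(iter_mul_fixed n fp) E (iterK n fK).
Qed.

(** It shows that the complement of the attracting atoms is forward invariant. *)
Lemma orbit_step_back f p m O : injective f -> periodic_orbit f (f p) m O -> periodic_orbit f p m O.
Proof.
move=> fI per; have [m0 fp _] := per; apply: (orbit_recenter per).
apply/(mem_orbit _ per); exists m.-1; rewrite -iterSr prednK//.
by apply: fI; rewrite -iterS iterSr fp.
Qed.

End PeriodicOrbits.

Section Atoms.
Context {R : realType} {M : ptopologicalType} (hM : hausdorff_space M).
Context (mu : probability (borel M) R).
Implicit Types (p x y : M) (O : set M).

Lemma measurable_point x : measurable ([set x] : set (borel M)).
Proof. by apply: closed_borel; exact: (accessible_closed_set1 (hausdorff_accessible hM)). Qed.

Lemma countable_atoms : countable [set p : M | (0 < mu [set p])%E].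
Proof.
pose E k := [set p : M | (k.+1%:R^-1%:E < mu [set p])%E].
have fE (p : M) : mu [set p] \is a fin_num by exact: (fin_num_measure _ _ (measurable_point p)).
have -> : [set p : M | (0 < mu [set p])%E] = \bigcup_k E k.
  apply/seteqP; split=> p /=; rewrite /E.
    rewrite -(fineK (fE p)) lte_fin => /exists_inv_lt[k Hk]; exists k => //=.
    by rewrite -(fineK (fE p)) lte_fin.
  by move=> [k _ /=]; apply: lt_trans; rewrite lte_fin invr_gt0.
apply: bigcup_countable => // k _; apply: finite_set_countable.
apply: contrapT => /infiniteP/ppcard_leP[u].
have mF i : measurable ([set u i] : set (borel M)) by exact: measurable_point.
(* This many points of mass above [1/(k+1)] would exceed total mass 1. *)
pose n := k.+2.
have := @probability_le1 _ _ _ mu (\bigcup_(i in `I_n) [set u i]).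
rewrite measure_fin_bigcup//; last first.
  move=> i j _ _ [x [/= xi xj]].
  exact: (@inj _ _ setT u _ _ (mem_set I) (mem_set I) (etrans (esym xi) xj)).
have mU : measurable (\bigcup_(i in `I_n) [set u i] : set (borel M)).
  by apply: fin_bigcup_measurable.
move=> /(_ mU); apply/negP; rewrite -ltNge.
have uE i : (k.+1%:R^-1%:E < mu [set u i])%E by have := @funS _ _ _ _ u i I.
have pE i : mu [set u i] = (fine (mu [set u i]))%:E by rewrite fineK.
rewrite (eq_fsbigr _ _ (fun i _ => pE i)) -fsbig_ord sumEFin lte_fin.
apply: (@lt_le_trans _ _ (\sum_(i < n) k.+1%:R^-1)); last first.
  by apply: ler_sum => i _; have := uE i; rewrite pE lte_fin => /ltW.
have -> : \sum_(i < n) k.+1%:R^-1 = n%:R / k.+1%:R :> R by rewrite sumr_const card_ord mulr_natl.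
by rewrite ltr_pdivlMr// mul1r ltr_nat.
Qed.

Lemma measurable_orbit f p m O : periodic_orbit f p m O -> measurable (O : set (borel M)).
Proof.
move=> [_ _ ->]; rewrite (_ : [set _ | _ in _] = \bigcup_(j in `I_m) [set iter j f p]).
  by apply: bigcup_measurable => j _; exact: measurable_point.
by apply/seteqP; split=> x [j jm]; [move=> <-; exists j|move=> ->; exists j].
Qed.

Lemma atom_invariant f x : injective f -> invariant_measure f mu -> mu [set f x] = mu [set x].
Proof.
move=> fI minv; rewrite -minv; last exact: measurable_point.
by congr (mu _); apply/seteqP; split=> y /= => [/fI|->].
Qed.

Lemma atom_iter f x n : injective f -> invariant_measure f mu -> mu [set iter n f x] = mu [set x].
Proof. by move=> fI minv; elim: n => //= n IH; rewrite atom_invariant. Qed.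

Lemma orbit_dirac_restr f p m O (nu : set (borel M) -> \bar R) :
  injective f -> invariant_measure f mu -> periodic_orbit f p m O -> (0 < mu [set p])%E ->
  (forall B : set (borel M), measurable B -> nu B = mu (B `&` O)) -> orbit_dirac f O nu.
Proof.
move=> fI minv per p0 nuE.
have [m0 fp _] := per.
(* With the least period the iterates are distinct and the orbit is a disjoint union of points of
   equal mass; the coefficient is the mass of the whole orbit. *)
have exm : exists t, (0 < t)%N && `[< iter t f p = p >] by exists m; rewrite m0; apply/asboolP.
case: (ex_minnP exm) => t /andP[t0 /asboolP ft] tmin.
have pert : periodic_orbit f p t O.
  by apply: periodic_orbit_of => // y; exact: mem_orbit per.
have fE : mu [set p] \is a fin_num by exact: (fin_num_measure _ _ (measurable_point p)).
have mp0 : 0 < fine (mu [set p]) by move: p0; rewrite -{1}(fineK fE) lte_fin.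
have iterI n : injective (iter n f) by elim: n => [|n IH] x y //= /fI/IH.
have distinct i j : (i < j < t)%N -> iter i f p = iter j f p -> False.
  move=> /andP[ij jt] E; have := tmin (j - i)%N; rewrite subn_gt0 ij /=.
  have -> : `[< iter (j - i) f p = p >].
    by apply/asboolP; apply: (iterI i); rewrite -iterD subnKC// ltnW.
  by move=> /(_ isT); lia.
exists p, t, (t%:R * fine (mu [set p])); split=> //; first by rewrite mulr_gt0// ltr0n.
move=> B mB; rewrite nuE//.
have -> : B `&` O = \bigcup_(j in `I_t) (B `&` [set iter j f p]).
  have [_ _ ->] := pert; apply/seteqP; split=> y.
    by move=> [By [j jt jy]]; exists j.
  by move=> [j jt [By yj]]; split=> //; exists j.
rewrite measure_fin_bigcup//; last first.
  by move=> j _; apply: measurableI => //; exact: measurable_point.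
- move=> i j it jt [y [[_ yi] [_ yj]]]; have ij := etrans (esym yi) yj.
  case: (ltngtP i j) => // lt; exfalso.
    by apply: (@distinct i j) => //; rewrite lt.
  by apply: (@distinct j i) => //; rewrite lt.
have each j : mu (B `&` [set iter j f p]) =
    (fine (mu [set p]) * ((iter j f p \in B)%:R))%:E.
  have [jB|jB] := boolP (iter j f p \in B).
    rewrite mulr1 fineK// -(atom_iter p j fI minv); congr (mu _).
    rewrite inE in jB; apply/seteqP; split=> y; first by case.
    by move=> yj; split=> //; rewrite yj.
  rewrite mulr0 (_ : B `&` _ = set0) ?measure0//.
  apply/seteqP; split=> y; last by [].
  by move=> [By yj]; move: jB; rewrite -yj notin_setE.
rewrite (eq_fsbigr _ _ (fun j _ => each j)) -fsbig_ord.
have -> : (\sum_(j < t) dirac (iter j f p : borel M) B =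
    ((\sum_(j < t) (iter j f p \in B)%:R)%R : R)%:E)%E.
  by rewrite -sumEFin; apply: eq_bigr => j _; rewrite diracE.
rewrite sumEFin -!EFinM -big_distrr/=; congr EFin.
by rewrite mulrACA divff ?mul1r// pnatr_eq0 -lt0n.
Qed.

(** Distinct periodic orbits are disjoint, and each orbit of [C] contains an atom, so there are
    countably many. *)
Lemma enumerate_orbits f (C : set (set M)) :
  (forall O, C O -> exists p m, periodic_orbit f p m O /\ (0 < mu [set p])%E) ->
  exists Os : nat -> set M, [/\ trivIset setT Os,
    forall i, Os i = set0 \/ C (Os i) & forall O, C O -> exists i, Os i = O].
Proof.
move=> HC.
have [C0|/set0P C0] := eqVneq C set0.
  exists (fun=> set0); split=> [i j _ _ [x []//]|i|O]; first by left.
  by rewrite C0.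
have cC : countable C.
  pose orb p := [set y | exists n, y = iter n f p].
  apply: (@sub_countable _ _ _ (orb @` [set p : M | (0 < mu [set p])%E])).
    apply: subset_card_le => O /HC[p [m [per p0]]]; exists p => //.
    by apply/seteqP; split=> y; [move=> /(mem_orbit y per)|move/(mem_orbit y per)].
  apply: sub_countable countable_atoms; exact: card_image_le.
have [s sC] : exists s : nat -> set M, (forall i, C (s i)) /\ forall O, C O -> exists i, s i = O.
  case/pfcard_geP: cC => [CE|[u]]; first by case: C0 => O; rewrite CE.
  exists u; split=> [i|O CO]; first exact: funS.
  by have [i _ <-] := @surj _ _ _ _ u O CO; exists i.
(* The enumeration may repeat orbits: keep the first occurrence and replace the others by the empty
   set. *)
pose fresh i := forall j, (j < i)%N -> s j <> s i.
pose Os i := if `[< fresh i >] then s i else set0.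
have [sC1 sC2] := sC.
exists Os; split.
- move=> i j _ _ [x []]; rewrite /Os.
  case: asboolP => // fi xi; case: asboolP => // fj xj.
  have [p [m [per _]]] := HC _ (sC1 i); have [q [n [qer _]]] := HC _ (sC1 j).
  have E := orbits_eq per qer xi xj.
  by case: (ltngtP i j) => // ij; [case: (fj i ij)|case: (fi j ij)].
- by move=> i; rewrite /Os; case: asboolP => _; [right|left].
move=> O CO; have [i siO] := sC2 O CO.
have exi : exists i, `[< s i = O >] by exists i; apply/asboolP.
case: (ex_minnP exi) => j /asboolP sj jmin; exists j; rewrite /Os asboolT// => k kj skj.
by have := jmin k; rewrite asboolT ?skj// => /(_ isT); rewrite leqNgt kj.
Qed.

End Atoms.

Section NullSets.
Context {R : realType} {d : nat} {M : ptopologicalType} {A : smooth_atlas R d M}.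
Context (g : riemannian A) (hd : (0 < d)%N) (hM : hausdorff_space M) (cM : compact [set: M]).
Context (mu : probability (borel M) R).

(** The unions of the tails of [E] decrease to the empty set. This turns a pointwise bound, valid
    from a time depending on the point, into one that fails on a set of small measure. *)
Lemma small_tail (E : nat -> set (borel M)) (eta : R) :
  (forall n, measurable (E n)) -> (forall x, exists m, forall n, (m <= n)%N -> ~ E n x) ->
  0 < eta -> exists N, (0 < N)%N /\ (mu (E N) < eta%:E)%E.
Proof.
move=> mE evE eta0.
pose T m : set (borel M) := \bigcup_(n in [set n | (m <= n)%N]) E n.
have mT m : measurable (T m) by apply: bigcup_measurable => n _; exact: mE.
have T0 : \bigcap_m T m = set0.
  apply/seteqP; split=> // x Tx; have [m Hm] := evE x.
  by have [n /= mn Enx] := Tx m I; exact: Hm Enx.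
have Tcvg : mu \o T @ \oo --> 0%E.
  rewrite -(@measure0 _ _ _ mu) -T0; apply: nonincreasing_cvg_mu => //.
  - by rewrite -ge0_fin_numE// fin_num_measure.
  - by rewrite T0; exact: measurable0.
  - move=> m n mn; apply/subsetPset => x [k /= nk Ek]; exists k => //=.
    exact: leq_trans nk.
have : \forall n \near \oo, (mu (T n) < eta%:E)%E.
  by apply: (Tcvg (fun y => (y < eta%:E)%E)); apply: open_nbhs_nbhs; split;
    [exact: open_ereal_lt_ereal|rewrite lte_fin].
move=> [m _ Hm]; exists m.+1; split=> //.
apply: le_lt_trans (Hm m.+1 (leqnSn m)).
by apply: le_measure; rewrite ?inE// => x Ex; exists m.+1 => /=.
Qed.

Lemma countable_borel (C : set M) : countable C -> measurable (C : set (borel M)).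
Proof.
move=> /pfcard_geP[->|[s]]; first exact: measurable0.
rewrite (_ : C = \bigcup_n [set s n]).
  by apply: bigcup_measurable => n _; exact: measurable_point.
apply/seteqP; split=> x.
  by move=> Cx; have [n _ <-] := @surj _ _ _ _ s x Cx; exists n.
by move=> [n _ ->]; exact: (@funS _ _ _ _ s n I).
Qed.

(** The restriction to points of positive mass makes this set countable, hence Borel. *)
Definition attracting_atoms (h : M -> M) : set M := [set p | (0 < mu [set p])%E /\
  exists m O, periodic_orbit h p m O /\ attracting g h O].

Lemma measurable_attracting_atoms h : measurable (attracting_atoms h : set (borel M)).
Proof.
apply: countable_borel; apply: sub_countable (countable_atoms hM mu).
by apply: subset_card_le => p [].
Qed.

(** What remains of [L] is still forward invariant. If it had positive measure, [attracting_atom]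
    would find an attracting atom in it. *)
Lemma null_of_contracting h hinv (L : set (borel M)) (c : R) :
  C1_map A h -> C1_map A hinv -> cancel h hinv -> invariant_measure h mu ->
  measurable L -> (forall x, L x -> L (h x)) -> 0 < c ->
  (forall eta : R, 0 < eta -> exists N, (0 < N)%N /\
    (mu [set x | L x /\ (expR (- (N%:R * c)) < opmap g (iter N h) x)%R] < eta%:E)%E) ->
  mu (L `\` attracting_atoms h) = 0%E.
Proof.
move=> Ch Ci hK minv mL hL c0 small.
have hI : injective h := can_inj hK.
have hpos n x : 0 < opmap g (iter n h) x := opmap_iter_gt0 g hd hK Ch Ci n x.
apply/eqP; rewrite -measure_le0 leNgt; apply/negP => L0.
have mLP : measurable (L `\` attracting_atoms h : set (borel M)).
  by apply: measurableD => //; exact: measurable_attracting_atoms.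
have inv : forall x, (L `\` attracting_atoms h) x -> (L `\` attracting_atoms h) (h x).
  move=> x [Lx nx]; split; first exact: hL.
  move=> [hx0 [m [Q [per att]]]]; apply: nx; split; first by rewrite -(atom_invariant hM x hI minv).
  by exists m, Q; split=> //; exact: orbit_step_back per.
have [|p [m [Q [[Lp nPp] p0 per att]]]] := attracting_atom hM cM Ch hpos minv mLP inv L0 c0.
  move=> eta /small[N [N0 HN]]; exists N; split=> //; apply: le_lt_trans HN.
  have mgt := measurable_opmap_gt g Ch N (expR (- (N%:R * c))).
  apply: le_measure; rewrite ?inE.
  + exact: measurableI.
  + exact: measurableI.
  + by move=> x [[Lx _] gx].
by apply: nPp; split=> //; exists m, Q.
Qed.

Context (f finv : M -> M) (fK : cancel f finv) (finvK : cancel finv f).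
Context (f_C1 : C1_map A f) (finv_C1 : C1_map A finv).
Context (mu_inv : invariant_measure f mu).

Lemma invariant_measure_inv : invariant_measure finv mu.
Proof.
move=> B mB; rewrite -mu_inv; last first.
  have mi : measurable_fun setT (finv : borel M -> borel M).
    by apply: continuous_borel; case: finv_C1.
  by rewrite -[X in measurable X]setTI; exact: mi.
by congr (mu _); apply/seteqP; split=> x /=; rewrite fK.
Qed.

(** The margin gives the uniform rate needed for contraction; the union over [j] is the set where
    the growth rate is negative. *)
Definition contracted j : set (borel M) := [set x | ev_below (grow g f ^~ x) (- j.+1%:R^-1)].
Definition expanded j : set (borel M) := [set x | ev_below (shrink g f finv ^~ x) (- j.+1%:R^-1)].

Let mgrow n := grow_measurable g hd fK f_C1 finv_C1 n.
Let mshrink n := shrink_measurable g hd finvK f_C1 finv_C1 n.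

Lemma ev_below_le (s : nat -> R) (c : R) : ev_below s (- c) ->
  exists m, forall n, (m <= n)%N -> s n <= - (n%:R * c).
Proof.
move=> [k [m Hm]]; exists m => n mn; apply: le_trans (Hm n mn) _.
by rewrite -mulrN ler_wpM2l// gerBl.
Qed.

Lemma null_contracted j : mu (contracted j `\` attracting_atoms f) = 0%E.
Proof.
have [C C0 HC] := rates_bounded g hd cM fK finvK f_C1 finv_C1.
have mC : measurable (contracted j) by exact: measurable_ev_below.
apply: (null_of_contracting f_C1 finv_C1 fK mu_inv mC (c := j.+1%:R^-1)) => //.
- move=> x; apply: (@ev_below_shift _ _ _ _ C) => n.
  apply: le_trans (grow_step g hd fK finvK f_C1 finv_C1 n x) _; rewrite lerD2l.
  by have [_ +] := HC 1%N x; rewrite mul1r ler_norml => /andP[].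
move=> eta; apply: small_tail.
  by move=> n; apply: measurableI => //; exact: measurable_opmap_gt.
move=> x; have [/ev_below_le[m Hm]|nC] := pselect (contracted j x); last by exists 0%N => n _ [].
exists m => n mn [_]; apply/negP; rewrite -leNgt.
have := Hm n mn; rewrite /grow -ler_expR lnK// posrE.
exact: (opmap_iter_gt0 g hd fK f_C1 finv_C1).
Qed.

(** The same argument for [finv]. The difference is that [shrink] at time [N] controls the
    derivative of [finv^N] at the point [f^N x] and not at [x]. *)
Lemma null_expanded j : mu (expanded j `\` attracting_atoms finv) = 0%E.
Proof.
have [C C0 HC] := rates_bounded g hd cM fK finvK f_C1 finv_C1.
have mE : measurable (expanded j) by exact: measurable_ev_below.
have stepinv x : expanded j x -> expanded j (finv x).
  apply: (@ev_below_shiftl _ _ _ _ C) => n.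
  rewrite -add1n; apply: le_trans (shrink_subadd g hd fK finvK f_C1 finv_C1 1 n (finv x)) _.
  rewrite addrC /= finvK lerD2l.
  by have [_ +] := HC 1%N (finv x); rewrite mul1r ler_norml => /andP[].
apply: (null_of_contracting finv_C1 f_C1 finvK invariant_measure_inv mE (c := j.+1%:R^-1)) => //.
move=> eta eta0; set c := j.+1%:R^-1.
pose E n : set (borel M) := [set y | expanded j y /\ - (n%:R * c) < shrink g f finv n y].
have mEn n : measurable (E n).
  apply: measurableI => //; rewrite -[X in measurable X]setTI.
  have := mshrink n measurableT (@measurable_itv R `]- (n%:R * c), +oo[).
  by congr (measurable (_ `&` _)); apply/seteqP; split => y /=; rewrite in_itv /= andbT.
have [|N [N0 HN]] := small_tail mEn _ eta0.
  move=> x; have [/ev_below_le[m Hm]|nC] := pselect (expanded j x); last by exists 0%N => n _ [].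
  by exists m => n mn [_]; apply/negP; rewrite -leNgt; exact: Hm.
exists N; split=> //; apply: le_lt_trans HN.
have mi : measurable_fun setT (f : borel M -> borel M).
  by apply: continuous_borel; case: f_C1.
have mS : measurable ([set x | expanded j x /\ expR (- (N%:R * c)) < opmap g (iter N finv) x] : set (borel M)).
  by apply: measurableI => //; exact: measurable_opmap_gt.
(* Invariance under [f^N] moves the bound from [f^N y] to [y], without changing the measure. *)
rewrite -(iter_invariant mi mu_inv N mS); apply: le_measure; rewrite ?inE//.
  exact: (measurable_iter_preimage mi).
move=> y [/= ey gy]; split.
  rewrite -(iterK N fK y); elim: N (iter N f y) ey {N0 mS gy} => // N IH z ez.
  by rewrite iterSr; apply: IH; exact: stepinv.
rewrite /shrink -ltr_expR lnK// posrE.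
exact: (opmap_iter_gt0 g hd finvK finv_C1 f_C1).
Qed.

End NullSets.

Section Decomposition.
Context {R : realType} {d : nat} {M : ptopologicalType} {A : smooth_atlas R d M}.
Context (g : riemannian A) (hd : (0 < d)%N) (hM : hausdorff_space M) (cM : compact [set: M]).
Context (f finv : M -> M) (fK : cancel f finv) (finvK : cancel finv f).
Context (f_C1 : C1_map A f) (finv_C1 : C1_map A finv).
Context (mu : probability (borel M) R) (mu_inv : invariant_measure f mu).

Definition nonneg_rates (x : M) : Prop := [/\ cvgn (log_growth g f x),
  cvgn (log_growth_inv g f x), 0 <= chi g f x & - chi_inv g f x <= 0].

Lemma negligible_rates : mu.-negligible
  ([set x | ~ nonneg_rates x] `\` (attracting_atoms g mu f `|` attracting_atoms g mu finv)).
Proof.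
pose K j := contracted g f j `\` attracting_atoms g mu f.
pose E j := expanded g f finv j `\` attracting_atoms g mu finv.
have mK j : measurable (K j).
  apply: measurableD; last exact: measurable_attracting_atoms.
  by apply: measurable_ev_below => n; exact: (grow_measurable g hd fK f_C1 finv_C1).
have mE j : measurable (E j).
  apply: measurableD; last exact: measurable_attracting_atoms.
  by apply: measurable_ev_below => n; exact: (shrink_measurable g hd finvK f_C1 finv_C1).
have K0 : mu.-negligible (\bigcup_j K j).
  apply: negligible_bigcup_countType => j; apply/negligibleP => //.
  exact: (null_contracted g hd hM cM fK finvK f_C1 finv_C1).
have E0 : mu.-negligible (\bigcup_j E j).
  apply: negligible_bigcup_countType => j; apply/negligibleP => //.
  exact: (null_expanded g hd hM cM fK finvK f_C1 finv_C1).
have C0 := rates_converge g hd cM fK finvK f_C1 finv_C1 mu_inv.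
apply: negligibleS (negligibleU (negligibleU K0 E0) C0) => x [bad nP].
apply: contrapT => nx; apply: bad.
have [cg cs] : cvgn (log_growth g f x) /\ cvgn (log_growth_inv g f x).
  rewrite log_growthE (log_growth_invE g fK f_C1 finv_C1).
  by apply: contrapT => H; apply: nx; right.
split=> //; rewrite ?oppr_le0 leNgt; apply/negP; rewrite -oppr_gt0 => /exists_inv_lt[j Hj];
  apply: nx; left; [left|right]; exists j => //; split; try by move=> a; apply: nP; (left + right).
- apply: lim_lt_ev_below; first by rewrite log_growthE// in cg.
  by rewrite -log_growthE// ltrNr.
- apply: lim_lt_ev_below; first by rewrite (log_growth_invE g fK f_C1 finv_C1) in cs.
  by rewrite -(log_growth_invE g fK f_C1 finv_C1) ltrNr.
Qed.

Lemma zero_exponent_or_hyperbolic : {ae mu, forall x, nonneg_rates x} ->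
  has_zero_exponent g f mu \/ (hyperbolic g f mu /\ exponents_of_different_signs g f mu).
Proof.
move=> good.
have [Z0|Z0] := pselect (mu.-negligible [set x | lyapunov_exponent g f x 0]); last by left.
right; split.
  apply: negligibleS Z0 => x nx; apply: contrapT => n0; apply: nx => l lx.
  by apply/eqP => l0; apply: n0; rewrite -l0.
have bot := bottom_exponent g hd cM fK finvK f_C1 finv_C1 mu_inv.
apply: negligibleS (negligibleU (negligibleU good bot) Z0) => x nx.
apply: contrapT => H; apply: nx.
have [cg cs chi0 chii0] : nonneg_rates x by apply: contrapT => h; apply: H; left; left.
have bx : forall l : R, (fun n : nat => n%:R^-1 * shrink g f finv n x) @ \oo --> l ->
    lyapunov_exponent g f x (- l) by apply: contrapT => h; apply: H; left; right.
have n0 : ~ lyapunov_exponent g f x 0 by move=> h; apply: H; right.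
have L2 : lyapunov_exponent g f x (chi g f x).
  by apply: (top_exponent hd fK f_C1 finv_C1); rewrite -log_growthE; exact: cg.
have L1 : lyapunov_exponent g f x (- chi_inv g f x).
  by apply: bx; rewrite -(log_growth_invE g fK f_C1 finv_C1); exact: cs.
exists (- chi_inv g f x), (chi g f x); split=> //.
  by rewrite lt_neqAle chii0 andbT; apply/eqP => E; rewrite E in L1.
by rewrite lt_neqAle chi0 andbT; apply/eqP => E; rewrite -E in L2.
Qed.

Lemma non_atomic_point (p : M) : non_atomic mu -> mu [set p] = 0%E.
Proof.
move=> na; apply/eqP; rewrite -measure_le0 leNgt; apply/negP.
move=> /(na _ (measurable_point hM p))[C [mC Cp C0]].
have [C0'|/set0P[y Cy]] := eqVneq C set0; first by rewrite C0' measure0 ltxx in C0.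
rewrite (_ : C = [set p]) ?ltxx//; apply/seteqP; split=> // _ ->.
by rewrite -(Cp y Cy).
Qed.

Lemma measure_split (Oa Or : nat -> set (borel M)) :
  (forall i, measurable (Oa i)) -> (forall i, measurable (Or i)) ->
  trivIset setT Oa -> trivIset setT Or -> (\bigcup_i Oa i) `&` (\bigcup_i Or i) = set0 ->
  forall B, measurable B -> mu B = (mu (B `&` ~` ((\bigcup_i Oa i) `|` (\bigcup_i Or i))) +
    \sum_(0 <= i <oo) mu (B `&` Oa i) + \sum_(0 <= i <oo) mu (B `&` Or i))%E.
Proof.
move=> ma mr ta tr ar B mB.
have mOa : measurable (\bigcup_i Oa i) by exact: bigcup_measurable.
have mOr : measurable (\bigcup_i Or i) by exact: bigcup_measurable.
have part (O : nat -> set (borel M)) : (forall i, measurable (O i)) -> trivIset setT O ->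
    mu (B `&` \bigcup_i O i) = (\sum_(0 <= i <oo) mu (B `&` O i))%E.
  move=> mO tO; rewrite setI_bigcupr measure_semi_bigcup//.
  - by move=> i; exact: measurableI.
  - exact: trivIset_setIl.
  - by apply: bigcup_measurable => i _; exact: measurableI.
rewrite -!part// -addeA -measureU; [|exact: measurableI|exact: measurableI|]; last first.
  by rewrite setIACA ar setI0.
by rewrite -setIUr -setDE -measureDI//; exact: measurableU.
Qed.

End Decomposition.

Theorem corollary1p4 (R : realType) (d : nat) (hd : (2 <= d)%N)
  (M : ptopologicalType) (hM : hausdorff_space M)
  (cM : compact [set: M]) (kM : connected [set: M])
  (A : smooth_atlas R d M) (g : riemannian A)
  (f finv : M -> M) (fK : cancel f finv) (finvK : cancel finv f)
  (f_C1 : C1_map A f) (finv_C1 : C1_map A finv)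
  (mu : probability (borel M) R) (mu_inv : invariant_measure f mu) :
  exists (mut : {measure set (borel M) -> \bar R})
         (nu rho : nat -> {measure set (borel M) -> \bar R})
         (Oa Or : nat -> set M),
    [/\ (forall B : set (borel M), measurable B ->
           mu B = (mut B + \sum_(0 <= i <oo) nu i B
                         + \sum_(0 <= j <oo) rho j B)%E),
        trivIset [set: nat] Oa /\
        (forall i, (Oa i = set0 /\ null_measure (nu i)) \/
                   (attracting g f (Oa i) /\ orbit_dirac f (Oa i) (nu i))),
        trivIset [set: nat] Or /\
        (forall j, (Or j = set0 /\ null_measure (rho j)) \/
                   (attracting g finv (Or j) /\ orbit_dirac f (Or j) (rho j))),
        {ae mut, forall x,
           [/\ cvgn (log_growth g f x), cvgn (log_growth_inv g f x),
               0 <= chi g f x & - chi_inv g f x <= 0]} &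
        non_atomic mu ->
          (forall B : set (borel M), measurable B -> mu B = mut B) /\
          (has_zero_exponent g f mu \/
           (hyperbolic g f mu /\ exponents_of_different_signs g f mu))].
Proof.
have d0 : (0 < d)%N by exact: ltnW.
have fI : injective f := can_inj fK.
pose orb O := exists p m, periodic_orbit f p m O /\ (0 < mu [set p])%E.
pose Ca : set (set M) := [set O | orb O /\ attracting g f O].
(* Excluding orbits that attract under [f] makes the two families disjoint by definition. *)
pose Cr : set (set M) := [set O | [/\ orb O, attracting g finv O & ~ attracting g f O]].
have [|Oa [ta Oa1 Oa2]] := @enumerate_orbits _ _ hM mu f Ca; first by move=> O [].
have [|Or [tr Or1 Or2]] := @enumerate_orbits _ _ hM mu f Cr; first by move=> O [].
have morb O : orb O -> measurable (O : set (borel M)).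
  by move=> [p [m [per _]]]; exact: (measurable_orbit hM per).
have ma i : measurable (Oa i : set (borel M)).
  by have [->|[/morb]] := Oa1 i.
have mr i : measurable (Or i : set (borel M)).
  by have [->|[/morb]] := Or1 i.
have mDa : measurable (\bigcup_i Oa i : set (borel M)) by exact: bigcup_measurable.
have mDr : measurable (\bigcup_i Or i : set (borel M)) by exact: bigcup_measurable.
have mD : measurable (~` ((\bigcup_i Oa i) `|` (\bigcup_i Or i)) : set (borel M)).
  by apply: measurableC; exact: measurableU.
have ar0 : (\bigcup_i Oa i) `&` (\bigcup_i Or i) = set0.
  apply/seteqP; split=> // x [[i _ xi] [j _ xj]].
  have [E|[[p [m [per _]]] att]] := Oa1 i; first by rewrite E in xi.
  have [E|[[q [n [qer _]]] _ natt]] := Or1 j; first by rewrite E in xj.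
  by apply: natt; rewrite -(orbits_eq per qer xi xj).
(* The atoms excluded in [negligible_rates] all lie on the listed orbits, so the restriction to the
   complement has nonnegative rates almost everywhere. *)
have atoms_D : attracting_atoms g mu f `|` attracting_atoms g mu finv `<=`
    (\bigcup_i Oa i) `|` (\bigcup_i Or i).
  have key p m O : periodic_orbit f p m O -> (0 < mu [set p])%E ->
      attracting g f O \/ attracting g finv O -> ((\bigcup_i Oa i) `|` (\bigcup_i Or i)) p.
    move=> per p0 att.
    have Op : O p by apply/(mem_orbit p per); exists 0%N.
    have oO : orb O by exists p, m.
    have [af|naf] := pselect (attracting g f O).
      by have [|i Oi] := Oa2 O; [split|left; exists i => //; rewrite Oi].
    have [|i Oi] := Or2 O; first by split=> //; case: att.
    by right; exists i => //; rewrite Oi.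
  move=> p [[p0 [m [Q [per att]]]]|[p0 [m [Q [per att]]]]].
    by apply: key per p0 _; left.
  by apply: key (orbit_inv finvK per) p0 _; right.
pose mut : {measure set (borel M) -> \bar R} := mrestr mu mD.
exists mut, (fun i => mrestr mu (ma i)), (fun i => mrestr mu (mr i)), Oa, Or; split.
- exact: measure_split.
- split=> // i; have [E|[[p [m [per p0]]] att]] := Oa1 i; [left|right]; split=> //.
    by move=> B mB; change (mu (B `&` Oa i) = 0%E); rewrite E setI0 measure0.
  exact: (orbit_dirac_restr hM fI mu_inv per p0).
- split=> // i; have [E|[[p [m [per p0]]] att _]] := Or1 i; [left|right]; split=> //.
    by move=> B mB; change (mu (B `&` Or i) = 0%E); rewrite E setI0 measure0.
  exact: (orbit_dirac_restr hM fI mu_inv per p0).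
- have [Z [mZ Z0 subZ]] := negligible_rates g d0 hM cM fK finvK f_C1 finv_C1 mu_inv.
  exists (Z `|` ((\bigcup_i Oa i) `|` (\bigcup_i Or i))); split.
  + by apply: measurableU => //; exact: measurableU.
  + rewrite /mut /= /mrestr setIUl setICr setU0.
    apply/eqP; rewrite -measure_le0 -Z0; apply: le_measure; rewrite ?inE//.
    exact: measurableI.
  + move=> x nx; have [Dx|nDx] := pselect (((\bigcup_i Oa i) `|` (\bigcup_i Or i)) x).
      by right.
    by left; apply: subZ; split=> // /atoms_D.
(* Each nonempty listed orbit contains an atom; without atoms all of them are empty and nothing is
   removed from [mu]. *)
move=> na; have noatom p : ~ (0 < mu [set p])%E by rewrite (non_atomic_point hM p na) ltxx.
have Oa0 i : Oa i = set0 by have [//|[[p [m [_ /noatom]]]]] := Oa1 i.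
have Or0 i : Or i = set0 by have [//|[[p [m [_ /noatom]]]]] := Or1 i.
split.
  move=> B mB; rewrite /mut /= /mrestr !bigcup0 ?setU0 ?setC0 ?setIT//.
apply: (zero_exponent_or_hyperbolic d0 cM fK finvK f_C1 finv_C1 mu_inv).
apply: negligibleS (negligible_rates g d0 hM cM fK finvK f_C1 finv_C1 mu_inv) => x nx.
by split=> // -[[/noatom]|[/noatom]].
Qed.
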